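(* Let $\lambda>0$ and $y_d\in L^2(Q_T)$, let $u$ be the optimal control of the time-periodic parabolic optimal control problem and $y(u)$ the corresponding state. Then $$\mathcal{J}(y(u),u)\le\mathcal{J}^\oplus(\alpha,\beta;\eta,\boldsymbol{\tau},v)\qquad\forall\,\eta\in H^{1,1}_{0,per}(Q_T),\ \boldsymbol{\tau}\in H(\mathrm{div},Q_T),\ v\in L^2(Q_T),\ \alpha,\beta>0,$$ where $$\mathcal{J}^\oplus(\alpha,\beta;\eta,\boldsymbol{\tau},v)=\frac{1+\alpha}{2}\|\eta-y_d\|^2+\frac{(1+\alpha)(1+\beta)C_F^2}{2\alpha\,\underline{\mu_1}^2}\|\boldsymbol{\tau}-\nu\nabla\eta\|^2+\frac{(1+\alpha)(1+\beta)C_F^4}{2\alpha\beta\,\underline{\mu_1}^2}\|\sigma\partial_t\eta-\mathrm{div}\,\boldsymbol{\tau}-v\|^2+\frac\lambda2\|v\|^2$$ and $\underline{\mu_1}=\frac1{\sqrt2}\min\{\underline\nu,\underline\sigma\}$.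
   Context: $\Omega\subset\mathbb{R}^d$, $d\in\{1,2,3\}$, is a bounded Lipschitz domain with boundary $\Gamma$; $T>0$, $\omega=2\pi/T$, $Q_T=\Omega\times(0,T)$, $\Sigma_T=\Gamma\times(0,T)$. The measurable coefficients $\sigma,\nu:\Omega\to\mathbb{R}$ satisfy $0<\underline\sigma\le\sigma\le\overline\sigma$ and $0<\underline\nu\le\nu\le\overline\nu$ with constants $\underline\sigma,\overline\sigma,\underline\nu,\overline\nu$. $\|\cdot\|$ is the $L^2(Q_T)$-norm (for scalar or vector functions; equal to $+\infty$ if the function is not square integrable), $\langle\cdot,\cdot\rangle_\Omega$ and $\|\cdot\|_\Omega$ are the $L^2(\Omega)$ inner product and norm. $\nabla$ and $\mathrm{div}$ are the generalized spatial gradient and divergence, $\partial_t$ the generalized time derivative. $C_F>0$ is the Friedrichs constant of $\Omega$: $\|w\|_\Omega\le C_F\|\nabla w\|_\Omega$ for $w\in H^1_0(\Omega)$. $H^{1,1}_{0,per}(Q_T)$ is the space of $v\in L^2(Q_T)$ with $\nabla v\in[L^2(Q_T)]^d$, $\partial_tv\in L^2(Q_T)$, $v=0$ on $\Sigma_T$ and $v(\cdot,0)=v(\cdot,T)$. $H(\mathrm{div},Q_T)=\{\boldsymbol{\rho}\in[L^2(Q_T)]^d:\mathrm{div}\,\boldsymbol{\rho}(\cdot,t)\in L^2(\Omega)\text{ for a.e. }t\in(0,T)\}$. The optimal control problem is to minimize $$\mathcal{J}(y,u)=\frac12\|y-y_d\|^2+\frac\lambda2\|u\|^2$$ over controls $u\in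 L^2(Q_T)$ subject to $y=y(u)$, where for $v\in L^2(Q_T)$ the state $y(v)$ is the (weak) solution of $\sigma\partial_ty-\mathrm{div}(\nu\nabla y)=v$ in $Q_T$, $y=0$ on $\Sigma_T$, $y(\cdot,0)=y(\cdot,T)$ in $\overline\Omega$. The weak solution is the $y\in H^{1,\frac12}_{0,per}(Q_T)$ with $$\int_{Q_T}\nu\nabla y\cdot\nabla q\,d\boldsymbol{x}\,dt+\frac T2\sum_{k\ge1}k\omega\langle\sigma\boldsymbol{y}_k,\boldsymbol{q}_k^\perp\rangle_\Omega=\int_{Q_T}v\,q\,d\boldsymbol{x}\,dt\quad\forall q\in H^{1,\frac12}_{0,per}(Q_T).$$ Here functions are expanded as $w=w_0^c+\sum_{k\ge1}(w_k^c\cos(k\omega t)+w_k^s\sin(k\omega t))$, $\boldsymbol{w}_k=(w_k^c,w_k^s)^T$, $\boldsymbol{w}_k^\perp=(-w_k^s,w_k^c)^T$, and $H^{1,\frac12}_{0,per}(Q_T)$ consists of $w\in L^2(Q_T)$ with $\nabla w\in[L^2(Q_T)]^d$, $\frac T2\sum_{k\ge1}k\omega\|\boldsymbol{w}_k\|_\Omega^2<\infty$ and $w=0$ on $\Sigma_T$. The optimal control $u$ is the minimizer of $v\mapsto\mathcal{J}(y(v),v)$. *)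

(* Defs.v *)
From HB Require Import structures.
From mathcomp Require Export all_boot all_order all_algebra.
From mathcomp Require Export all_classical all_reals all_analysis.

Set Implicit Arguments.
Unset Strict Implicit.
Unset Printing Implicit Defensive.

Export Order.TTheory GRing.Theory Num.Theory.
Export numFieldNormedType.Exports.

Local Open Scope classical_set_scope.
Local Open Scope ring_scope.

(* Points of R^n are row vectors. Functions on Omega, (0, T) or Q_T are total
   functions whose values outside the domain are irrelevant, and are understood
   up to null sets. Space-time points have type 'rV[R]_n * measurableTypeR R,
   where measurableTypeR R is R with its Borel sigma-algebra. *)

Definition measure_rV_display : measure_display.
Proof. exact. Qed.

Section measurable_rV.
Variables (R : realType) (n : nat).

Let coors : 'I_n -> 'rV[R]_n -> measurableTypeR R := fun i x => x 0 i.

Let rV_set0 : g_sigma_preimage coors set0.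
Proof. exact: sigma_algebra0. Qed.

Let rV_setC A : g_sigma_preimage coors A -> g_sigma_preimage coors (~` A).
Proof. exact: sigma_algebraC. Qed.

Let rV_bigcup (F : (set 'rV[R]_n)^nat) :
  (forall i, g_sigma_preimage coors (F i)) ->
  g_sigma_preimage coors (\bigcup_i (F i)).
Proof. exact: sigma_algebra_bigcup. Qed.

(* The Borel sigma-algebra of R^n, generated by the coordinate functions. *)
HB.instance Definition _ := @isMeasurable.Build measure_rV_display
  'rV[R]_n (g_sigma_preimage coors) rV_set0 rV_setC rV_bigcup.

End measurable_rV.

Lemma measurable_rV_coord (R : realType) n (i : 'I_n) :
  measurable_fun [set: 'rV[R]_n] (fun x => x 0 i : measurableTypeR R).
Proof.
move=> _ Y mY; rewrite setTI; apply: sub_sigma_algebra => /=.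
rewrite -bigcup_seq/=; exists i => /=; first by rewrite mem_index_enum.
by exists Y => //; rewrite setTI.
Qed.

Lemma measurable_fun_rVP (R : realType) d (X : measurableType d) n
    (f : X -> 'rV[R]_n) :
  measurable_fun [set: X] f <->
  forall i, measurable_fun [set: X] (fun x => f x 0 i : measurableTypeR R).
Proof.
split=> [mf i|mf].
  apply: (measurableT_comp (measurable_rV_coord i) mf).
move=> _ A mA; rewrite setTI.
pose S := [set B : set 'rV[R]_n | measurable (f @^-1` B)].
suff : measurable `<=` S by exact.
apply: smallest_sub.
  split => [|B|F] /=; rewrite /S/=.
  - by rewrite preimage_set0.
  - by move=> mB; rewrite setTD preimage_setC; exact: measurableC.
  - by move=> mF; rewrite preimage_bigcup; exact: bigcup_measurable.
rewrite -bigcup_seq/=; apply: bigcup_sub => i _ B [C mC <-].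
by rewrite /S/= setTI; have := mf i measurableT C mC; rewrite setTI.
Qed.

Section lebesgue_rV.
Variable R : realType.

Definition rV_snoc n (p : 'rV[R]_n * measurableTypeR R) : 'rV[R]_n.+1 :=
  \row_j if unlift ord_max j is Some k then p.1 0 k else p.2.

Lemma measurable_rV_snoc n : measurable_fun setT (@rV_snoc n).
Proof.
apply/measurable_fun_rVP => i.
case: (unliftP ord_max i) => [k ->|->].
  rewrite (_ : (fun _ => _) = (fun x : 'rV[R]_n => x 0 k : measurableTypeR R) \o fst).
    by apply: measurableT_comp; [exact: measurable_rV_coord|exact: measurable_fst].
  by apply/funext => p /=; rewrite mxE liftK.
rewrite (_ : (fun _ => _) = snd); first exact: measurable_snd.
by apply/funext => p /=; rewrite mxE unlift_none.
Qed.

Section snoc_measure.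
Variables (n : nat) (mu : {measure set 'rV[R]_n -> \bar R}).

Definition snoc_measure : set 'rV[R]_n.+1 -> \bar R :=
  pushforward (mu \x (@lebesgue_measure R))%E (@rV_snoc n).

HB.instance Definition _ := Measure.copy snoc_measure
  (measure_function_pushforward__canonical__measure_function_Measure
     (mu \x (@lebesgue_measure R))%E (@measurable_rV_snoc n)).

End snoc_measure.

(* Lebesgue measure on R^n, as an iterated product measure. *)
Fixpoint lebesgue_rV n : {measure set 'rV[R]_n -> \bar R} :=
  match n with
  | 0 => [the measure _ _ of dirac (0 : 'rV[R]_0)]
  | m.+1 => [the measure _ _ of snoc_measure (lebesgue_rV m)]
  end.

End lebesgue_rV.

Section test_functions.
Variables (R : realType) (V : normedModType R).

Fixpoint Ck (k : nat) (f : V -> R) : Prop :=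
  if k is k'.+1 then
    continuous f /\
    forall v : V, (forall x, derivable f x v) /\ Ck k' ('D_v f)
  else continuous f.

Definition smooth (f : V -> R) : Prop := forall k, Ck k f.

Definition test_function (D : set V) (f : V -> R) : Prop :=
  let supp := closure [set x | f x != 0] in
  [/\ smooth f, compact supp & supp `<=` D].

End test_functions.

Section euclidean.
Variables (R : realType) (n : nat).

Definition dotv (a b : 'rV[R]_n) : R := \sum_i a 0 i * b 0 i.

(* The norm `|x| on row vectors is the maximum norm, hence this definition. *)
Definition enorm (a : 'rV[R]_n) : R := Num.sqrt (dotv a a).

(* Near each boundary point p and in suitable Cartesian coordinates with last
   axis e, Omega lies below the graph of a Lipschitz function of the remaining
   coordinates: x has last coordinate dotv x e, and x - dotv x e *: e
   is its projection on the hyperplane orthogonal to e. *)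
Definition lipschitz_domain (Omega : set 'rV[R]_n) : Prop :=
  [/\ open Omega, connected Omega, Omega !=set0 &
      forall p, (closure Omega `\` Omega) p ->
        exists r e gam,
          [/\ 0 < r, dotv e e = 1, [lipschitz gam y | y in [set: 'rV[R]_n]] &
              forall x, ball p r x ->
                (Omega x <-> dotv x e < gam (x - dotv x e *: e))]].

End euclidean.

Section L2.
Variables (R : realType) (d : measure_display) (X : measurableType d).
Variables (mu : {measure set X -> \bar R}) (D : set X).
Local Open Scope ereal_scope.

Definition L2norm (f : X -> R) : \bar R := 'N[mu]_2%:E[EFin \o (f \_ D)].

Definition L2 (f : X -> R) : Prop := measurable_fun D f /\ L2norm f < +oo.

Definition L2vnorm n (f : X -> 'rV[R]_n) : \bar R := L2norm (fun x => enorm (f x)).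

Definition L2v n (f : X -> 'rV[R]_n) : Prop :=
  measurable_fun D f /\ L2vnorm f < +oo.

End L2.

Section space.
Variables (R : realType) (n : nat) (Omega : set 'rV[R]_n).
Local Notation mu := (lebesgue_rV R n).

Definition cgrad (phi : 'rV[R]_n -> R) (x : 'rV[R]_n) : 'rV[R]_n :=
  \row_i 'D_(delta_mx 0 i) phi x.

Definition is_grad (w : 'rV[R]_n -> R) (g : 'rV[R]_n -> 'rV[R]_n) : Prop :=
  forall phi, test_function Omega phi -> forall i,
    \int[mu]_(x in Omega) (w x * cgrad phi x 0 i) =
    - \int[mu]_(x in Omega) (g x 0 i * phi x).

Definition grad (w : 'rV[R]_n -> R) : 'rV[R]_n -> 'rV[R]_n :=
  xget (fun=> 0) [set g | L2v mu Omega g /\ is_grad w g].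

Definition H1 (w : 'rV[R]_n -> R) : Prop :=
  L2 mu Omega w /\ exists g, L2v mu Omega g /\ is_grad w g.

(* H^1_0(Omega), the closure of the test functions in H^1(Omega) *)
Definition H10 (w : 'rV[R]_n -> R) : Prop :=
  H1 w /\
  exists phi : nat -> 'rV[R]_n -> R,
    [/\ forall k, test_function Omega (phi k),
        (L2norm mu Omega (fun x => (w x - phi k x)%R) @[k --> \oo] --> 0)%E &
        (L2vnorm mu Omega (fun x => (grad w x - cgrad (phi k) x)%R)
           @[k --> \oo] --> 0)%E].

Definition is_div (rho : 'rV[R]_n -> 'rV[R]_n) (g : 'rV[R]_n -> R) : Prop :=
  forall phi, test_function Omega phi ->
    \int[mu]_(x in Omega) dotv (rho x) (cgrad phi x) =
    - \int[mu]_(x in Omega) (g x * phi x).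

End space.

Section space_time.
Variables (R : realType) (n : nat) (Omega : set 'rV[R]_n) (T : R).
Local Notation X := ('rV[R]_n * measurableTypeR R)%type.
Local Notation mu := (lebesgue_rV R n).
Local Notation leb := (@lebesgue_measure R).

Definition lebesgue_st : {measure set X -> \bar R} :=
  [the measure _ _ of (mu \x leb)%E].

Definition QT : set X := Omega `*` `]0, T[%classic.

Definition cgradx (phi : X -> R) (z : X) : 'rV[R]_n :=
  \row_i 'D_((delta_mx 0 i, 0) : X) phi z.

Definition cdt (phi : X -> R) (z : X) : R := 'D_((0, 1) : X) phi z.

Definition is_gradx (w : X -> R) (g : X -> 'rV[R]_n) : Prop :=
  forall phi, test_function QT phi -> forall i,
    \int[lebesgue_st]_(z in QT) (w z * cgradx phi z 0 i) =
    - \int[lebesgue_st]_(z in QT) (g z 0 i * phi z).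

Definition is_dt (w g : X -> R) : Prop :=
  forall phi, test_function QT phi ->
    \int[lebesgue_st]_(z in QT) (w z * cdt phi z) =
    - \int[lebesgue_st]_(z in QT) (g z * phi z).

(* The spatial divergence is taken slice by slice in time; g is a jointly
   measurable representative, not required to be in L^2(Q_T). *)
Definition is_divx (rho : X -> 'rV[R]_n) (g : X -> R) : Prop :=
  measurable_fun QT g /\
  {ae leb, forall t, `]0, T[%classic t ->
     L2 mu Omega (fun x => g (x, t)) /\
     is_div Omega (fun x => rho (x, t)) (fun x => g (x, t))}.

(* Generalized derivatives as total operators, meaningful (and unique up to
   null sets) when a generalized derivative exists. *)
Definition gradx (w : X -> R) : X -> 'rV[R]_n :=
  xget (fun=> 0) [set g | L2v lebesgue_st QT g /\ is_gradx w g].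

Definition dt (w : X -> R) : X -> R :=
  xget (fun=> 0) [set g | L2 lebesgue_st QT g /\ is_dt w g].

Definition divx (rho : X -> 'rV[R]_n) : X -> R :=
  xget (fun=> 0) [set g | is_divx rho g].

Definition Hdiv (rho : X -> 'rV[R]_n) : Prop :=
  L2v lebesgue_st QT rho /\ exists g, is_divx rho g.

Definition H1_x (w : X -> R) : Prop :=
  L2 lebesgue_st QT w /\ exists g, L2v lebesgue_st QT g /\ is_gradx w g.

(* w = 0 on Sigma_T: w is the limit in H^{1,0}(Q_T) of smooth
   functions vanishing near that boundary. *)
Definition zero_lateral (w : X -> R) : Prop :=
  exists phi : nat -> X -> R,
    [/\ forall k, smooth (phi k) /\
          exists K : set 'rV[R]_n, [/\ compact K, K `<=` Omega &
            forall x t, ~ K x -> phi k (x, t) = 0],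
        (L2norm lebesgue_st QT (fun z => (w z - phi k z)%R) @[k --> \oo] --> 0)%E &
        (L2vnorm lebesgue_st QT (fun z => (gradx w z - cgradx (phi k) z)%R)
           @[k --> \oo] --> 0)%E].

(* w(., 0) = w(., T), the traces being the values of the representative W of w
   that is continuous from [0, T] to L^2(Omega). *)
Definition time_periodic (w : X -> R) : Prop :=
  exists W : X -> R,
    [/\ {ae lebesgue_st, forall z, QT z -> W z = w z},
        forall t, 0 <= t <= T -> L2 mu Omega (fun x => W (x, t)),
        forall s, 0 <= s <= T ->
          (L2norm mu Omega (fun x => (W (x, t) - W (x, s))%R)
             @[t --> within `[0%R, T]%classic (nbhs s)] --> 0)%E &
        {ae mu, forall x, Omega x -> W (x, 0) = W (x, T)}].

Definition H11_0per (w : X -> R) : Prop :=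
  [/\ H1_x w, exists g, L2 lebesgue_st QT g /\ is_dt w g,
      zero_lateral w & time_periodic w].

Definition omega : R := 2 * pi / T.

(* Fourier coefficients of index k >= 1; the mean w_0^c is not needed. *)
Definition fcos (w : X -> R) (k : nat) (x : 'rV[R]_n) : R :=
  2 / T * \int[leb]_(t in `]0, T[) (w (x, t) * cos (k%:R * omega * t)).

Definition fsin (w : X -> R) (k : nat) (x : 'rV[R]_n) : R :=
  2 / T * \int[leb]_(t in `]0, T[) (w (x, t) * sin (k%:R * omega * t)).

Definition H1half_0per (w : X -> R) : Prop :=
  [/\ H1_x w,
      ((T / 2)%:E * \sum_(1 <= k <oo) (k%:R * omega)%:E *
         (L2norm mu Omega (fcos w k) ^+ 2 + L2norm mu Omega (fsin w k) ^+ 2)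
       < +oo)%E &
      zero_lateral w].

(* <sigma w_k, q_k^perp>_Omega, with q_k^perp = (- q_k^s, q_k^c). *)
Definition fourier_perp (sigma : 'rV[R]_n -> R) (w q : X -> R) (k : nat) : R :=
  \int[mu]_(x in Omega)
    (sigma x * (fcos w k x * - fsin q k x + fsin w k x * fcos q k x)).

(* The series in the variational equation is a limit of partial sums. *)
Definition weak_solution (sigma nu : 'rV[R]_n -> R) (v y : X -> R) : Prop :=
  H1half_0per y /\
  forall q, H1half_0per q ->
    \int[lebesgue_st]_(z in QT) (nu z.1 * dotv (gradx y z) (gradx q z)) +
      T / 2 * (\sum_(1 <= k < N.+1) k%:R * omega * fourier_perp sigma y q k)
      @[N --> \oo] --> \int[lebesgue_st]_(z in QT) (v z * q z).

Definition cost (lam : R) (yd y u : X -> R) : \bar R :=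
  ((2^-1)%:E * L2norm lebesgue_st QT (fun z => (y z - yd z)%R) ^+ 2 +
   (lam / 2)%:E * L2norm lebesgue_st QT u ^+ 2)%E.

(* y is the control-to-state map. *)
Definition optimal_control (lam : R) (yd : X -> R)
    (y : (X -> R) -> X -> R) (u : X -> R) : Prop :=
  L2 lebesgue_st QT u /\
  forall v, L2 lebesgue_st QT v -> (cost lam yd (y u) u <= cost lam yd (y v) v)%E.

Definition mu1 (nu_lo sigma_lo : R) : R :=
  (Num.sqrt 2)^-1 * Num.min nu_lo sigma_lo.

Definition majorant (sigma nu : 'rV[R]_n -> R) (nu_lo sigma_lo CF lam : R)
    (yd : X -> R) (a b : R) (eta : X -> R) (tau : X -> 'rV[R]_n) (v : X -> R)
    : \bar R :=
  let m := mu1 nu_lo sigma_lo in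
  (((1 + a) / 2)%:E * L2norm lebesgue_st QT (fun z => (eta z - yd z)%R) ^+ 2 +
   ((1 + a) * (1 + b) * CF ^+ 2 / (2 * a * m ^+ 2))%:E *
     L2vnorm lebesgue_st QT (fun z => (tau z - nu z.1 *: gradx eta z)%R) ^+ 2 +
   ((1 + a) * (1 + b) * CF ^+ 4 / (2 * a * b * m ^+ 2))%:E *
     L2norm lebesgue_st QT
       (fun z => (sigma z.1 * dt eta z - divx tau z - v z)%R) ^+ 2 +
   (lam / 2)%:E * L2norm lebesgue_st QT v ^+ 2)%E.

End space_time.

(* Main.v *)
From HB Require Import structures.
Require Import Defs.
From mathcomp Require Import measurable_realfun ring lra.

(** The cost at the optimal control does not exceed the cost of the admissible
    pair made of [v] and its state [y v]. It remains to bound the distance from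
    [y v] to the desired state, hence the norm of the error [e = y v - eta].

    The error is an admissible test function in the weak equation. The pairing of
    order one half in time is skew, so that only [eta] contributes to it when the
    equation is tested with [e] ([fourier_perp_energy]); as [eta] has a time
    derivative, Parseval's identity identifies this contribution with the
    integral of [sigma * dt eta * e] ([energy_cvg]). Inserting the flux [tau],
    whose divergence may be moved to a gradient on [e] ([div_by_parts]), one gets
    the energy identity ([error_energy])
      int nu |grad e|^2
        = int (tau - nu grad eta) . grad e - int (sigma dt eta - div tau - v) e.
    Cauchy-Schwarz, Friedrichs' inequality in space-time ([poincare]) and the
    lower bound of [nu], which is at least [mu1], bound the norm of [e] by the two
    residuals ([error_estimate]). Young's inequality with the parameters alpha and
    beta concludes ([majorant_le]). If the residual containing div tau is not
    square integrable, the majorant is infinite and there is nothing to prove.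

    Three analytic facts support this argument. Weak gradients are unique up to
    null sets, by the fundamental lemma of the calculus of variations
    ([fundamental_lemma], [fundamental_lemma_st]); this yields the gradient of the
    error and applies Friedrichs' inequality to test functions. Trigonometric
    polynomials are dense, because convolution with the normalized powers of
    (1 + cos) / 2 is an approximate identity ([trig_dense], [parseval]). Finally
    the Fourier coefficients of the time derivative of [eta] are those of [eta]
    rotated and multiplied by the frequency ([dt_fourier]): in the integration by
    parts, the boundary terms cancel by periodicity. With Bessel's inequality this
    also shows that [eta], hence the error, has finite energy of order one half
    ([half_norm_dt], [error_half]). *)

Set Implicit Arguments.
Unset Strict Implicit.
Unset Printing Implicit Defensive.

Local Open Scope classical_set_scope.
Local Open Scope ring_scope.

(** * Square-integrable functions *)

(** Minimize the quadratic at [s = - b / c]; when [c = 0], an affine function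
    that stays nonnegative is constant. *)
Lemma quad_discriminant (R : realType) (a b c : R) : 0 <= c ->
  (forall s, 0 <= a + 2 * s * b + s ^+ 2 * c) -> b ^+ 2 <= a * c.
Proof.
rewrite le_eqVlt => /predU1P[<-|c0] h.
  rewrite mulr0; have [->|b0] := eqVneq b 0; first by rewrite expr0n.
  have := h (- (a + 1) / (2 * b)); rewrite mulr0 addr0.
  rewrite (_ : 2 * _ * b = - (a + 1)); last by field.
  by lra.
have := h (- b / c).
rewrite (_ : a + _ + _ = (a * c - b ^+ 2) / c); last by field; rewrite gt_eqF.
by rewrite pmulr_lge0 ?invr_gt0// subr_ge0.
Qed.

Section L2_toolkit.
Context (R : realType) (d : measure_display) (X : measurableType d).
Variables (mu : {measure set X -> \bar R}) (D : set X) (mD : measurable D).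
Implicit Types f g : X -> R.

(** The squared norm as a real number. It is meaningful on [L2] functions
    only: the real-valued integral sends an infinite value to 0. *)
Definition sqn f : R := \int[mu]_(x in D) (f x) ^+ 2.

Lemma L2norm_sqE f : (L2norm mu D f ^+ 2 = \int[mu]_(x in D) ((f x) ^+ 2)%:E)%E.
Proof.
have h : (L2norm mu D f `^ 2 = L2norm mu D f ^+ 2)%E.
  have : (0 <= L2norm mu D f)%E by exact: Lnorm_ge0.
  case: (L2norm mu D f) => [r|_|//].
  - by rewrite lee_fin => r0; rewrite poweR_EFin powR_mulrn.
  - by rewrite poweRyr.
rewrite -h /L2norm poweR_Lnorm ?pnatr_eq0// [RHS]integral_mkcond.
apply: eq_integral => x _ /=.
rewrite powR_mulrn// /patch; case: ifP => _ /=.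
  by rewrite real_normK ?num_real.
by rewrite normr0 expr0n.
Qed.

Lemma L2norm_ge0 f : (0 <= L2norm mu D f)%E.
Proof. exact: Lnorm_ge0. Qed.

Lemma L2P f : L2 mu D f <->
  measurable_fun D f /\ mu.-integrable D (EFin \o (fun x => f x ^+ 2)).
Proof.
have E : (L2norm mu D f < +oo <-> \int[mu]_(x in D) (f x ^+ 2)%:E < +oo)%E.
  rewrite -L2norm_sqE; have := L2norm_ge0 f.
  case: (L2norm mu D f) => [r|_|//]; first by rewrite -EFin_expe !ltry.
  by split.
split=> -[mf h]; split => //.
  apply/integrableP; split.
    by apply/measurable_EFinP; exact: measurable_funX.
  rewrite (eq_integral (fun x => (f x ^+ 2)%:E)) ?(E.1 h)// => x _.
  by rewrite /= ger0_norm ?sqr_ge0.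
apply/E; move/integrableP : h => [_].
by rewrite (eq_integral (fun x => (f x ^+ 2)%:E))// => x _;
  rewrite /= ger0_norm ?sqr_ge0.
Qed.

Lemma L2_sq_integrable f : L2 mu D f ->
  mu.-integrable D (EFin \o (fun x => f x ^+ 2)).
Proof. by move=> /L2P[]. Qed.

Lemma L2_measurable f : L2 mu D f -> measurable_fun D f.
Proof. by case. Qed.

Lemma sqn_ge0 f : 0 <= sqn f.
Proof. by apply: Rintegral_ge0 => x _; exact: sqr_ge0. Qed.

Lemma L2norm_sqn f : L2 mu D f -> (L2norm mu D f ^+ 2 = (sqn f)%:E)%E.
Proof.
move=> /L2_sq_integrable fi; rewrite L2norm_sqE /sqn /Rintegral fineK//.
exact: integrable_fin_num.
Qed.

Lemma L2norm_sqrt f : L2 mu D f -> L2norm mu D f = (Num.sqrt (sqn f))%:E.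
Proof.
move=> /L2norm_sqn; have := L2norm_ge0 f.
case: (L2norm mu D f) => [r| |] //; rewrite lee_fin => r0.
by rewrite -EFin_expe => -[<-]; rewrite sqrtr_sqr ger0_norm.
Qed.

Lemma L2_ae_le f g : measurable_fun D f ->
  mu.-integrable D (EFin \o g) -> {ae mu, forall x, D x -> f x ^+ 2 <= g x} ->
  L2 mu D f.
Proof.
move=> mf gi fg; apply/L2P; split=> //; apply/integrableP; split.
  by apply/measurable_EFinP; exact: measurable_funX.
have /integrableP[mg] := gi; apply: le_lt_trans.
apply: ae_ge0_le_integral => //.
- apply: measurableT_comp => //; apply/measurable_EFinP; exact: measurable_funX.
- exact: measurableT_comp.
- apply: filterS fg => x h Dx; rewrite /= lee_fin ger0_norm ?sqr_ge0//.
  by rewrite (le_trans (h Dx))// ler_norm.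
Qed.

Lemma L2_le f g : measurable_fun D f ->
  mu.-integrable D (EFin \o g) -> (forall x, D x -> f x ^+ 2 <= g x) ->
  L2 mu D f.
Proof. by move=> mf gi fg; apply: L2_ae_le gi _ => //; exact: aeW. Qed.

Lemma integrableEFinD f g : mu.-integrable D (EFin \o f) ->
  mu.-integrable D (EFin \o g) -> mu.-integrable D (EFin \o (fun x => f x + g x)).
Proof. by move=> fi gi; have := integrableD mD fi gi. Qed.

Lemma integrableEFinZ f c : mu.-integrable D (EFin \o f) ->
  mu.-integrable D (EFin \o (fun x => c * f x)).
Proof. by move=> fi; have := integrableZl mD c fi. Qed.

Lemma integrableEFinB f g : mu.-integrable D (EFin \o f) ->
  mu.-integrable D (EFin \o g) -> mu.-integrable D (EFin \o (fun x => f x - g x)).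
Proof. by move=> fi gi; have := integrableB mD fi gi. Qed.

Lemma integrableEFin_cst (c : R) : (mu D < +oo)%E ->
  mu.-integrable D (EFin \o (fun=> c)).
Proof.
move=> muD; apply/integrableP; split; first exact: measurable_cst.
by rewrite /= integral_cst// lte_mul_pinfty.
Qed.

Lemma L2_bounded f (C : R) : (mu D < +oo)%E -> measurable_fun D f ->
  (forall x, D x -> `|f x| <= C) -> L2 mu D f.
Proof.
move=> muD mf fC; apply: (L2_le mf (g := cst (C ^+ 2))).
  exact: integrableEFin_cst.
move=> x Dx /=; have := fC _ Dx => h.
by rewrite -real_normK ?num_real// ler_sqr// ?nnegrE// (le_trans _ h).
Qed.

Lemma L2M_integrable f g : L2 mu D f -> L2 mu D g ->
  mu.-integrable D (EFin \o (fun x => f x * g x)).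
Proof.
move=> /L2P[mf fi] /L2P[mg gi].
apply: (le_integrable mD _ _ (integrableEFinD fi gi)).
  by apply/measurable_EFinP; exact: measurable_funM.
move=> x Dx /=; rewrite lee_fin [leRHS]ger0_norm ?addr_ge0 ?sqr_ge0//.
by rewrite ler_norml; apply/andP; split; nra.
Qed.

Lemma L2D f g : L2 mu D f -> L2 mu D g -> L2 mu D (fun x => f x + g x).
Proof.
move=> fL gL; have /L2P[mf fi] := fL; have /L2P[mg gi] := gL.
apply: (L2_le (g := fun x => 2 * (f x ^+ 2 + g x ^+ 2))).
- exact: measurable_funD.
- by apply: integrableEFinZ; exact: integrableEFinD.
- by move=> x _; have := sqr_ge0 (f x - g x); nra.
Qed.

Lemma L2_ae_bM (b : X -> R) f (C : R) : measurable_fun D b ->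
  {ae mu, forall x, D x -> `|b x| <= C} -> L2 mu D f -> L2 mu D (fun x => b x * f x).
Proof.
move=> mb bC fL; have fi := L2_sq_integrable fL.
apply: (L2_ae_le _ (integrableEFinZ (C ^+ 2) fi)).
  by apply: measurable_funM => //; exact: L2_measurable fL.
apply: filterS bC => x h Dx; rewrite exprMn ler_wpM2r ?sqr_ge0//.
by rewrite -real_normK ?num_real// ler_sqr ?nnegrE// ?h// (le_trans _ (h Dx)).
Qed.

Lemma L2bM (b : X -> R) f (C : R) : measurable_fun D b -> (forall x, D x -> `|b x| <= C) ->
  L2 mu D f -> L2 mu D (fun x => b x * f x).
Proof. by move=> mb bC; apply: L2_ae_bM => //; apply: aeW => x; exact: bC. Qed.

Lemma L2Z f c : L2 mu D f -> L2 mu D (fun x => c * f x).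
Proof. by apply: (@L2bM (cst c) f `|c|) => //; exact: measurable_cst. Qed.

Lemma L2N f : L2 mu D f -> L2 mu D (fun x => - f x).
Proof.
move=> /(L2Z (-1)); rewrite (_ : (fun x => -1 * f x) = (fun x => - f x))//.
by apply/funext => x; rewrite mulN1r.
Qed.

Lemma L2B f g : L2 mu D f -> L2 mu D g -> L2 mu D (fun x => f x - g x).
Proof. by move=> fL gL; apply: L2D => //; exact: L2N. Qed.

Lemma L2_sum (I : finType) (F : I -> X -> R) : (forall i, L2 mu D (F i)) ->
  L2 mu D (fun x => \sum_i F i x).
Proof.
move=> h; rewrite (_ : (fun x => _) = \sum_i F i); last first.
  by apply/funext => x; rewrite fct_sumE.
elim/big_rec : _ => [|i f _ fL].
  apply/L2P; split; first exact: measurable_cst.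
  apply: (eq_integrable mD (cst 0%E)); last exact: integrable0.
  by move=> x _ /=; rewrite expr0n.
exact: L2D.
Qed.

Lemma Rintegral_sum_nat (F : nat -> X -> R) (m p : nat) :
  (forall k, mu.-integrable D (EFin \o F k)) ->
  mu.-integrable D (EFin \o (fun x => \sum_(m <= k < p) F k x)) /\
  \int[mu]_(x in D) (\sum_(m <= k < p) F k x) =
  \sum_(m <= k < p) \int[mu]_(x in D) F k x.
Proof.
move=> Fi; elim: p => [|p [IHi IHe]].
  rewrite big_geq//; split.
    apply: eq_integrable (integrable0 mu D) => // x _.
    by rewrite /= big_geq.
  by under eq_Rintegral do rewrite big_geq//; rewrite Rintegral_cst// mul0r.
have [mp|mp] := leqP m p; last first.
  rewrite big_geq//; split.
    by apply: eq_integrable (integrable0 mu D) => // x _; rewrite /= big_geq.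
  by under eq_Rintegral do rewrite big_geq//; rewrite Rintegral_cst// mul0r.
split.
  apply: eq_integrable (integrableEFinD IHi (Fi p)) => // x _.
  by rewrite /= big_nat_recr.
under eq_Rintegral do rewrite big_nat_recr//=.
by rewrite RintegralD// IHe big_nat_recr.
Qed.

Lemma integral_sq_quad f g s : L2 mu D f -> L2 mu D g ->
  sqn (fun x => f x + s * g x) =
  sqn f + 2 * s * \int[mu]_(x in D) (f x * g x) + s ^+ 2 * sqn g.
Proof.
move=> fL gL; have fgi := L2M_integrable fL gL.
have fi := L2_sq_integrable fL; have gi := L2_sq_integrable gL.
rewrite /sqn -[X in _ + X + _]RintegralZl// -[X in _ + X]RintegralZl//.
rewrite -RintegralD//; [|exact: integrableEFinZ].
rewrite -RintegralD//; [|apply: integrableEFinD => //|]; try exact: integrableEFinZ.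
by apply: eq_Rintegral => x _; ring.
Qed.

Lemma cauchy_schwarz_sq f g : L2 mu D f -> L2 mu D g ->
  (\int[mu]_(x in D) (f x * g x)) ^+ 2 <= sqn f * sqn g.
Proof.
move=> fL gL; apply: quad_discriminant; first exact: sqn_ge0.
by move=> t; rewrite -integral_sq_quad// sqn_ge0.
Qed.

Lemma cauchy_schwarz f g : L2 mu D f -> L2 mu D g ->
  `|\int[mu]_(x in D) (f x * g x)| <= Num.sqrt (sqn f) * Num.sqrt (sqn g).
Proof.
move=> fL gL; rewrite -sqrtrM ?sqn_ge0// -sqrtr_sqr ler_wsqrtr//.
exact: cauchy_schwarz_sq.
Qed.

Lemma sqrt_sqnD f g : L2 mu D f -> L2 mu D g ->
  Num.sqrt (sqn (fun x => f x + g x)) <= Num.sqrt (sqn f) + Num.sqrt (sqn g).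
Proof.
move=> fL gL; rewrite -(@ler_pXn2r _ 2)// ?nnegrE ?addr_ge0 ?sqrtr_ge0//.
rewrite sqr_sqrtr ?sqn_ge0// (_ : sqn _ = sqn (fun x => f x + 1 * g x)); last first.
  by congr sqn; apply/funext => x; rewrite mul1r.
rewrite integral_sq_quad// sqrrD !sqr_sqrtr ?sqn_ge0// mulr1 expr1n mul1r.
rewrite lerD2r lerD2l -[leRHS]mulr_natl ler_pM2l// (le_trans (ler_norm _))//.
exact: cauchy_schwarz.
Qed.

Lemma sqnN f : sqn (fun x => - f x) = sqn f.
Proof. by apply: eq_Rintegral => x _; rewrite sqrrN. Qed.

Lemma sqnD_le f g : L2 mu D f -> L2 mu D g ->
  sqn (fun x => f x + g x) <= 2 * (sqn f + sqn g).
Proof.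
move=> fL gL; rewrite mulrDr -!RintegralZl ?L2_sq_integrable// -RintegralD//;
  try by apply: integrableEFinZ; exact: L2_sq_integrable.
apply: le_Rintegral => //.
- by apply: L2_sq_integrable; exact: L2D.
- by apply: integrableEFinD; apply: integrableEFinZ; exact: L2_sq_integrable.
- by move=> x _; have := sqr_ge0 (f x - g x); nra.
Qed.

Lemma sqnB_le f g : L2 mu D f -> L2 mu D g ->
  sqn (fun x => f x - g x) <= 2 * (sqn f + sqn g).
Proof. by move=> fL gL; rewrite -(sqnN g); apply: sqnD_le => //; exact: L2N. Qed.

Lemma ae_eq_Rintegral f g : measurable_fun D f -> measurable_fun D g ->
  {ae mu, forall x, D x -> f x = g x} ->
  \int[mu]_(x in D) f x = \int[mu]_(x in D) g x.
Proof.
move=> mf mg fg; congr fine; apply: ae_eq_integral => //.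
- exact/measurable_EFinP.
- exact/measurable_EFinP.
- by apply: filterS fg => x h Dx; rewrite h.
Qed.

Lemma ae_le_Rintegral f g : mu.-integrable D (EFin \o f) ->
  mu.-integrable D (EFin \o g) -> {ae mu, forall x, D x -> f x <= g x} ->
  \int[mu]_(x in D) f x <= \int[mu]_(x in D) g x.
Proof.
move=> fi gi fg; rewrite -subr_ge0 -RintegralB//.
have gfi := integrableEFinB gi fi.
rewrite (ae_eq_Rintegral (g := fun x => `|g x - f x|)).
- by apply: Rintegral_ge0.
- by have /measurable_int/measurable_EFinP := gfi.
- by have /measurable_int/measurable_EFinP := integrable_abse gfi.
- by apply: filterS fg => x h Dx; rewrite ger0_norm// subr_ge0 h.
Qed.

Lemma ae_eq_sqn f g : measurable_fun D f -> measurable_fun D g ->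
  {ae mu, forall x, D x -> f x = g x} -> sqn f = sqn g.
Proof.
move=> mf mg fg; apply: ae_eq_Rintegral; try exact: measurable_funX.
by apply: filterS fg => x h Dx; rewrite h.
Qed.

Lemma integral_sqn f : L2 mu D f ->
  (\int[mu]_(x in D) (f x ^+ 2)%:E = (sqn f)%:E)%E.
Proof. by move=> fL; rewrite -L2norm_sqE L2norm_sqn. Qed.

Lemma sqn_ae_le f g : L2 mu D f -> L2 mu D g ->
  {ae mu, forall x, D x -> f x ^+ 2 <= g x ^+ 2} -> sqn f <= sqn g.
Proof. by move=> fL gL; apply: ae_le_Rintegral => //; exact: L2_sq_integrable. Qed.

Lemma dominated_cvg_real (f_ : nat -> X -> R) f g :
  (forall j, measurable_fun D (f_ j)) -> measurable_fun D f ->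
  {ae mu, forall x, D x -> f_ j x @[j --> \oo] --> f x} ->
  mu.-integrable D (EFin \o g) ->
  {ae mu, forall x j, D x -> `|f_ j x| <= g x} ->
  mu.-integrable D (EFin \o f) /\
  \int[mu]_(x in D) f_ j x @[j --> \oo] --> \int[mu]_(x in D) f x.
Proof.
move=> mf_ mf cf gi fg.
have [||||fi _ h] := @dominated_convergence _ _ _ mu D mD (fun j x => (f_ j x)%:E)
  (EFin \o f) (EFin \o g) _ _ _ gi.
- by move=> j; exact/measurable_EFinP.
- exact/measurable_EFinP.
- by apply: filterS cf => x cx Dx; apply: cvg_EFin; [exact: nearW|exact: cx].
- by apply: filterS fg => x gx j Dx; rewrite lee_fin gx.
split=> //; apply: fine_cvg; rewrite fineK//.
exact: integrable_fin_num.
Qed.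

End L2_toolkit.

Section L2_cvg.
Context (R : realType) (d : measure_display) (X : measurableType d).
Variables (mu : {measure set X -> \bar R}) (D : set X) (mD : measurable D).
Local Open Scope ereal_scope.

Lemma cvge0P (u : nat -> \bar R) : (forall k, 0 <= u k) ->
  (u k @[k --> \oo] --> 0) <->
  (forall e : R, (0 < e)%R -> \forall k \near \oo, u k < e%:E).
Proof.
move=> u0; split=> [/fine_cvgP[uf uc] e e0|h].
  near=> k.
  have uk : u k \is a fin_num by near: k.
  rewrite -(fineK uk) lte_fin.
  have : (`|0 - (fine \o u) k| < e)%R.
    by near: k; move/cvgrPdist_lt : uc => /(_ _ e0).
  by rewrite /= sub0r normrN; apply: le_lt_trans; exact: ler_norm.
apply/fine_cvgP; split.
  have := h 1%R ltr01; apply: filterS => k uk.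
  by rewrite ge0_fin_numE// (lt_trans uk)// ltry.
apply/cvgrPdist_lt => e e0; near=> k => /=.
have uk : u k < e%:E by near: k; exact: h.
rewrite sub0r normrN ger0_norm ?fine_ge0// -lte_fin fineK//.
by rewrite ge0_fin_numE// (lt_trans uk)// ltry.
Unshelve. all: by end_near. Qed.

Lemma L2norm_lt (f : X -> R) (e : R) : (0 < e)%R ->
  (L2norm mu D f < e%:E) = (\int[mu]_(x in D) (f x ^+ 2)%:E < (e ^+ 2)%:E).
Proof.
move=> e0; rewrite -L2norm_sqE//; have := L2norm_ge0 mu D f => //.
case: (L2norm mu D f) => [r|_|//].
  by rewrite -EFin_expe !lte_fin lee_fin => r0; rewrite ltr_pXn2r// nnegrE// ltW.
by rewrite !ltNge !leey.
Qed.

(** Convergence is expressed by extended-real integrals of squares, so that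
    the approximants need not be known to be square integrable. *)
Lemma L2norm_cvg0P (f_ : nat -> X -> R) :
  (L2norm mu D (f_ k) @[k --> \oo] --> 0) <->
  (forall e : R, (0 < e)%R ->
     \forall k \near \oo, \int[mu]_(x in D) (f_ k x ^+ 2)%:E < e%:E).
Proof.
rewrite cvge0P; last by move=> k; exact: L2norm_ge0.
split=> h e e0.
  have s0 : (0 < Num.sqrt e)%R by rewrite sqrtr_gt0.
  by apply: filterS (h _ s0) => k; rewrite L2norm_lt// sqr_sqrtr// ltW.
by apply: filterS (h _ (exprn_gt0 2 e0)) => k; rewrite L2norm_lt.
Qed.

Lemma sqn_lt (f : X -> R) (e : R) : measurable_fun D f ->
  \int[mu]_(x in D) (f x ^+ 2)%:E < e%:E -> L2 mu D f /\ (sqn mu D f < e)%R.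
Proof.
move=> mf fe; have fL : L2 mu D f.
  apply/L2P => //; split => //; apply/integrableP; split.
    by apply/measurable_EFinP; exact: measurable_funX.
  rewrite (eq_integral (fun x => (f x ^+ 2)%:E)) ?(lt_trans fe) ?ltry// => x _.
  by rewrite /= ger0_norm ?sqr_ge0.
split=> //; rewrite -lte_fin /sqn /Rintegral fineK//.
by apply: integrable_fin_num => //; exact: L2_sq_integrable.
Qed.

End L2_cvg.

Section vector_L2.
Context (R : realType) (d : measure_display) (X : measurableType d) (n : nat).
Variables (mu : {measure set X -> \bar R}) (D : set X) (mD : measurable D).
Implicit Types a b : 'rV[R]_n.
Implicit Types f g : X -> 'rV[R]_n.

Lemma rowBE a b i : (a - b) 0 i = a 0 i - b 0 i.
Proof. by rewrite !mxE. Qed.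

Lemma dotvv_ge0 a : 0 <= dotv a a.
Proof. by apply: sumr_ge0 => i _; rewrite -expr2 sqr_ge0. Qed.

Lemma enorm_sq a : enorm a ^+ 2 = dotv a a.
Proof. by rewrite sqr_sqrtr// dotvv_ge0. Qed.

Lemma coord_enorm a i : (a 0 i) ^+ 2 <= enorm a ^+ 2.
Proof.
rewrite enorm_sq /dotv (bigD1 i)//= -expr2 lerDl; apply: sumr_ge0 => j _.
by rewrite -expr2 sqr_ge0.
Qed.

Lemma dotvBl a b (c : 'rV[R]_n) : dotv (a - b) c = dotv a c - dotv b c.
Proof. by rewrite /dotv -sumrB; apply: eq_bigr => i _; rewrite rowBE mulrBl. Qed.

Lemma dotvBr a b (c : 'rV[R]_n) : dotv a (b - c) = dotv a b - dotv a c.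
Proof. by rewrite /dotv -sumrB; apply: eq_bigr => i _; rewrite rowBE mulrBr. Qed.

Lemma dotvZl (k : R) a b : dotv (k *: a) b = k * dotv a b.
Proof. by rewrite /dotv mulr_sumr; apply: eq_bigr => i _; rewrite mxE mulrA. Qed.

Lemma enormB_sym a b : enorm (a - b) = enorm (b - a).
Proof.
by rewrite /enorm /dotv; congr Num.sqrt; apply: eq_bigr => i _; rewrite !rowBE; ring.
Qed.

Lemma measurable_fun_rVonP f : measurable D ->
  measurable_fun D f <->
  forall i, measurable_fun D (fun x => f x 0 i : measurableTypeR R).
Proof.
move=> _; split=> [mf i|mf].
  by apply: (measurable_comp measurableT _ (measurable_rV_coord i) mf).
move=> _ A mA.
pose S := [set B : set 'rV[R]_n | measurable (D `&` f @^-1` B)].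
suff : measurable `<=` S by exact.
apply: smallest_sub.
  split => [|B|F] /=; rewrite /S/=.
  - by rewrite preimage_set0 setI0.
  - move=> mB; rewrite setTD preimage_setC -setDE.
    rewrite (_ : D `\` _ = D `\` (D `&` f @^-1` B)); last by rewrite setDIr setDv set0U.
    exact: measurableD.
  - move=> mF; rewrite preimage_bigcup setI_bigcupr; exact: bigcup_measurable.
rewrite -bigcup_seq/=; apply: bigcup_sub => i _ B [C mC <-].
by rewrite /S/= setTI; have := mf i mD C mC.
Qed.

Lemma measurable_dotv f g :
  (forall i, measurable_fun D (fun x => f x 0 i : R)) ->
  (forall i, measurable_fun D (fun x => g x 0 i : R)) ->
  measurable_fun D (fun x => dotv (f x) (g x)).
Proof.
by move=> mf mg; apply: measurable_sum => i; exact: measurable_funM.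
Qed.

Lemma measurable_enorm f :
  (forall i, measurable_fun D (fun x => f x 0 i : R)) ->
  measurable_fun D (fun x => enorm (f x)).
Proof.
move=> mf; apply: (@measurableT_comp _ _ _ _ _ _ (@Num.sqrt R)).
  by apply: continuous_measurable_fun; exact: sqrt_continuous.
exact: measurable_dotv.
Qed.

Lemma enorm2_integrable f : (forall i, L2 mu D (fun x => f x 0 i)) ->
  mu.-integrable D (EFin \o (fun x => enorm (f x) ^+ 2)).
Proof.
move=> h; apply: (eq_integrable mD (EFin \o (fun x => \sum_i (f x 0 i) ^+ 2))).
  by move=> x _ /=; rewrite enorm_sq; congr EFin; apply: eq_bigr => i _; rewrite expr2.
rewrite (_ : EFin \o _ = fun x => (\sum_i ((f x 0 i) ^+ 2)%:E)%E); last first.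
  by apply/funext => x /=; rewrite sumEFin.
apply: integrable_sum => // i _.
have := L2_sq_integrable (h i).
exact.
Qed.

(** The coordinates are dominated by the Euclidean norm, whose square is the
    sum of their squares. *)
Lemma L2vP f : L2v mu D f <-> forall i, L2 mu D (fun x => f x 0 i).
Proof.
split=> [[mf fe] i|h].
  have mfi := (measurable_fun_rVonP f mD).1 mf i.
  have me : measurable_fun D (fun x => enorm (f x)).
    by apply: measurable_enorm; exact: (measurable_fun_rVonP f mD).1 mf.
  have eL : L2 mu D (fun x => enorm (f x)) by split.
  apply: (L2_le mD mfi (g := fun x => enorm (f x) ^+ 2)).
    exact: L2_sq_integrable.
  by move=> x _; exact: coord_enorm.
have mf : measurable_fun D f.
  by apply/(measurable_fun_rVonP f mD) => i; have [] := h i.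
split => //; rewrite /L2vnorm.
suff [] : L2 mu D (fun x => enorm (f x)) by [].
apply/L2P => //; split; last exact: enorm2_integrable.
by apply: measurable_enorm => i; have [] := h i.
Qed.

Lemma L2_enorm f : (forall i, L2 mu D (fun x => f x 0 i)) ->
  L2 mu D (fun x => enorm (f x)).
Proof.
move=> h; have /L2vP[mf fe] := h.
by split => //; apply: measurable_enorm => i; have [] := h i.
Qed.

Lemma dotv_integrable f g : (forall i, L2 mu D (fun x => f x 0 i)) ->
  (forall i, L2 mu D (fun x => g x 0 i)) ->
  mu.-integrable D (EFin \o (fun x => dotv (f x) (g x))).
Proof.
move=> hf hg.
rewrite (_ : EFin \o _ = fun x => (\sum_i ((f x 0 i * g x 0 i)%:E))%E); last first.
  by apply/funext => x /=; rewrite sumEFin.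
by apply: integrable_sum => // i _; exact: (L2M_integrable mD (hf i) (hg i)).
Qed.

Lemma dotv_le a b : `|dotv a b| <= enorm a * enorm b.
Proof.
rewrite -sqrtrM ?dotvv_ge0// -sqrtr_sqr ler_wsqrtr//.
have q0 s : 0 <= dotv a a + 2 * s * dotv a b + s ^+ 2 * dotv b b.
  rewrite (_ : _ + _ = dotv (a + s *: b) (a + s *: b)) ?dotvv_ge0//.
  rewrite /dotv !mulr_sumr -!big_split/=; apply: eq_bigr => i _.
  by rewrite !mxE; ring.
by apply: quad_discriminant => //; exact: dotvv_ge0.
Qed.

Lemma cauchy_schwarz_dotv f g : (forall i, L2 mu D (fun x => f x 0 i)) ->
  (forall i, L2 mu D (fun x => g x 0 i)) ->
  `|\int[mu]_(x in D) dotv (f x) (g x)| <=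
  Num.sqrt (sqn mu D (fun x => enorm (f x))) *
  Num.sqrt (sqn mu D (fun x => enorm (g x))).
Proof.
move=> hf hg; have fL := L2_enorm hf; have gL := L2_enorm hg.
apply: le_trans (le_trans (ler_norm _) (cauchy_schwarz mD fL gL)).
apply: le_trans (le_normr_Rintegral mD (dotv_integrable hf hg)) _.
apply: le_Rintegral => //.
- have := dotv_integrable hf hg => /integrable_abse.
  by rewrite (_ : _ \o _ = EFin \o (fun x => `|dotv (f x) (g x)|)).
- exact: L2M_integrable.
- by move=> x _; exact: dotv_le.
Qed.

Lemma enormB_sq_le a b : enorm (a - b) ^+ 2 <= 2 * (enorm a ^+ 2 + enorm b ^+ 2).
Proof.
rewrite !enorm_sq /dotv -big_split/= mulr_sumr; apply: ler_sum => i _.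
by rewrite !mxE; have := sqr_ge0 (a 0 i + b 0 i); nra.
Qed.

Lemma enormD a b : enorm (a + b) <= enorm a + enorm b.
Proof.
rewrite -(@ler_pXn2r _ 2)// ?nnegrE ?addr_ge0 ?sqrtr_ge0//.
rewrite sqrrD !enorm_sq.
have -> : dotv (a + b) (a + b) = dotv a a + dotv a b *+ 2 + dotv b b.
  rewrite /dotv -sumrMnl -!big_split/=; apply: eq_bigr => i _.
  by rewrite !mxE; ring.
by rewrite lerD2r lerD2l lerMn2r/= (le_trans (ler_norm _))// dotv_le.
Qed.

End vector_L2.

(** * Fubini and Tonelli on rectangles *)

Section sigma_finite_copy.
Context (R : realType) (d : measure_display) (T : measurableType d).
Variables (m : {measure set T -> \bar R}) (s : sigma_finite setT m).

(** Fubini's theorem asks for a canonical sigma-finite structure, which the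
    recursively defined [lebesgue_rV] does not carry; the copy attaches to a
    measure a proof that it is sigma-finite. *)
Definition sf_copy of sigma_finite setT m : set T -> \bar R := m.

HB.instance Definition _ := Measure.copy (sf_copy s) m.
HB.instance Definition _ := Measure_isSigmaFinite.Build _ _ _ (sf_copy s) s.

Definition sf_measure : {sigma_finite_measure set T -> \bar R} := sf_copy s.

End sigma_finite_copy.

Lemma sf_measureE (R : realType) (d : measure_display) (T : measurableType d)
    (m : {measure set T -> \bar R}) (s : sigma_finite setT m) :
  sf_measure s = m :> {measure set T -> \bar R}.
Proof. by case: m s => f [] a b s. Qed.

Section Fubini_rectangle.
Context (R : realType) (d1 d2 : measure_display).
Context (T1 : measurableType d1) (T2 : measurableType d2).
Variables (m1 : {measure set T1 -> \bar R}) (s1 : sigma_finite setT m1).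
Variable (m2 : {sigma_finite_measure set T2 -> \bar R}).
Variables (A : set T1) (B : set T2) (mA : measurable A) (mB : measurable B).
Local Open Scope ereal_scope.

Let patchE (f : T1 * T2 -> \bar R) x y :
  (f \_ (A `*` B)) (x, y) = ((fun x => ((fun y => f (x, y)) \_ B) y) \_ A) x.
Proof.
rewrite /patch; have [xA|xA] := boolP (x \in A); have [yB|yB] := boolP (y \in B).
- by rewrite mem_set//; split; exact/set_mem.
- by rewrite memNset// => -[/= _ /mem_set]; apply/negP.
- by rewrite memNset// => -[/= /mem_set + _]; apply/negP.
- by rewrite memNset// => -[/= _ /mem_set]; apply/negP.
Qed.

Let patch1 (f : T1 * T2 -> \bar R) x :
  \int[m2]_y (f \_ (A `*` B)) (x, y) =
  ((fun x => \int[m2]_(y in B) f (x, y)) \_ A) x.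
Proof.
rewrite (eq_integral _ _ (fun y _ => patchE f x y)).
rewrite /patch; case: ifPn => xA; last by rewrite integral0.
by rewrite [RHS]integral_mkcond.
Qed.

Let patch2 (f : T1 * T2 -> \bar R) y :
  \int[m1]_x (f \_ (A `*` B)) (x, y) =
  ((fun y => \int[m1]_(x in A) f (x, y)) \_ B) y.
Proof.
rewrite (eq_integral _ _ (fun x _ => patchE f x y)).
rewrite -integral_mkcond /patch; case: ifPn => yB; last by rewrite integral0.
by [].
Qed.

Let mAB : measurable (A `*` B). Proof. exact: measurableX. Qed.

(** Restricting the integrand to the rectangle reduces this to the theorem on
    the whole product, a slice of a restriction being the restriction of a
    slice. *)
Lemma tonelli_rect (f : T1 * T2 -> \bar R) :
  measurable_fun (A `*` B) f -> (forall z, (A `*` B) z -> 0 <= f z) ->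
  [/\ measurable_fun A (fun x => \int[m2]_(y in B) f (x, y)),
     measurable_fun B (fun y => \int[m1]_(x in A) f (x, y)),
     \int[(m1 \x m2)%E]_(z in A `*` B) f z =
       \int[m1]_(x in A) \int[m2]_(y in B) f (x, y) &
     \int[(m1 \x m2)%E]_(z in A `*` B) f z =
       \int[m2]_(y in B) \int[m1]_(x in A) f (x, y)].
Proof.
move=> mf f0.
have mfp : measurable_fun setT (f \_ (A `*` B)) := (measurable_restrictT f mAB).1 mf.
have fp0 z : 0 <= (f \_ (A `*` B)) z.
  by rewrite /patch; case: ifPn => // /set_mem; exact: f0.
have h1 := measurable_fun_fubini_tonelli_F (m2 := m2) _ mfp fp0.
have h2 := measurable_fun_fubini_tonelli_G (m1 := sf_measure s1) _ mfp fp0.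
have h3 := fubini_tonelli1 (m1 := sf_measure s1) (m2 := m2) _ mfp fp0.
have h4 := fubini_tonelli2 (m1 := sf_measure s1) (m2 := m2) _ mfp fp0.
have prodI (g : T1 * T2 -> \bar R) :
    \int[(sf_measure s1 \x m2)%E]_z g z = \int[(m1 \x m2)%E]_z g z.
  by apply: eq_measure_integral => C mC _.
move: h1 h2 h3 h4; rewrite !prodI /fubini_F /fubini_G.
rewrite (sf_measureE s1).
rewrite (funext (patch1 f)) (funext (patch2 f)) => h1 h2 h3 h4; split.
- exact/(measurable_restrictT _ mA).
- exact/(measurable_restrictT _ mB).
- by rewrite [LHS]integral_mkcond [RHS]integral_mkcond.
- by rewrite [LHS]integral_mkcond [RHS]integral_mkcond.
Qed.

(** The inner integrals are finite almost everywhere only, hence their real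
    parts agree with them up to a null set. *)
Lemma fubini_rect (f : T1 * T2 -> R) :
  (m1 \x m2).-integrable (A `*` B) (EFin \o f) ->
  [/\ {ae m1, forall x, A x -> m2.-integrable B (fun y => (f (x, y))%:E)},
     {ae m2, forall y, B y -> m1.-integrable A (fun x => (f (x, y))%:E)},
     m1.-integrable A (EFin \o (fun x => \int[m2]_(y in B) f (x, y))%R) &
     m2.-integrable B (EFin \o (fun y => \int[m1]_(x in A) f (x, y))%R)] /\
  (\int[(m1 \x m2)%E]_(z in A `*` B) f z =
     \int[m1]_(x in A) \int[m2]_(y in B) f (x, y))%R /\
  (\int[(m1 \x m2)%E]_(z in A `*` B) f z =
     \int[m2]_(y in B) \int[m1]_(x in A) f (x, y))%R.
Proof.
move=> /(integrable_mkcond _ mAB) fi.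
have ae1 := ae_integrable1 (m1 := sf_measure s1) (m2 := m2) fi.
have ae2 := ae_integrable2 (m1 := sf_measure s1) (m2 := m2) fi.
have i1 := integrable_fubini_F (m1 := sf_measure s1) (m2 := m2) fi.
have i2m := measurable_fubini_G (m1 := sf_measure s1) (m2 := m2) fi.
have e1 := integral12_prod_meas1 (m1 := sf_measure s1) (m2 := m2) fi.
have e2 := integral21_prod_meas1 (m1 := sf_measure s1) (m2 := m2) fi.
move: (measurable_int _ fi) => mf.
have fub := (integrable21ltyP (sf_measure s1) m2 mf).1 fi.
have fubm : measurable_fun setT
    (fun y => \int[sf_measure s1]_x `| (EFin \o f) \_ (A `*` B) (x, y)|).
  apply: (measurable_fun_fubini_tonelli_G (m1 := sf_measure s1)
    (abse \o ((EFin \o f) \_ (A `*` B)))) => [|z].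
    exact: measurableT_comp.
  exact: abse_ge0.
have i2 : m2.-integrable setT (fubini_G (sf_measure s1) ((EFin \o f) \_ (A `*` B))).
  apply/integrableP; split => //; apply: le_lt_trans fub.
  apply: ge0_le_integral => //.
  - exact: measurableT_comp.
  - move=> y _; apply: le_abse_integral => //.
    exact: (measurableT_comp mf).
move: ae1 ae2 i1 i2 e1 e2; rewrite /fubini_F /fubini_G (sf_measureE s1).
rewrite (funext (patch1 _)) (funext (patch2 _)) => ae1 ae2 i1 i2 e1 e2.
move/(integrable_mkcond _ mA) : i1 => i1.
move/(integrable_mkcond _ mB) : i2 => i2.
have fineI d (T : measurableType d) (m : {measure set T -> \bar R}) (C : set T)
    (g : T -> \bar R) : measurable C -> m.-integrable C g ->
    m.-integrable C (EFin \o (fine \o g)) /\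
    \int[m]_(x in C) (fine (g x))%:E = \int[m]_(x in C) g x.
  move=> mC gi; have mg := measurable_int _ gi.
  have mfg : measurable_fun C (EFin \o (fine \o g)).
    by apply/measurable_EFinP; exact: measurableT_comp.
  split.
    apply: le_integrable gi => // x _ /=.
    by case: (g x) => [r| |] //=; rewrite normr0 leey.
  apply: ae_eq_integral => //.
  have := integrable_ae mC gi; apply: filterS => x h Cx /=.
  by rewrite fineK// h.
have [j1 k1] := fineI _ _ _ _ _ mA i1.
have [j2 k2] := fineI _ _ _ _ _ mB i2.
split; first split => //.
- apply: filterS ae1 => x + Ax.
  move=> /(eq_integrable measurableT _ _ (fun y _ => patchE _ x y)).
  rewrite /patch mem_set// => h; apply/(integrable_mkcond _ mB).
  by apply: eq_integrable h.
- apply: filterS ae2 => y + By.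
  move=> /(eq_integrable measurableT _ _ (fun x _ => patchE _ x y)).
  move=> /(integrable_mkcond _ mA); rewrite /patch mem_set//.
split.
- by rewrite /Rintegral k1; congr fine; rewrite integral_mkcond [RHS]integral_mkcond; exact: (esym e1).
- by rewrite /Rintegral k2; congr fine; rewrite integral_mkcond [RHS]integral_mkcond; exact: (esym e2).
Qed.

Lemma measurable_slice1 (f : T1 * T2 -> R) y : measurable_fun (A `*` B) f -> B y ->
  measurable_fun A (fun x => f (x, y)).
Proof.
move=> /(measurable_restrictT _ mAB) mf By; apply/(measurable_restrictT _ mA).
have := measurable_fun_pair1 y mf; apply: eq_measurable_fun => x _.
rewrite /patch; case: ifPn => [|/negP xA].
  by rewrite inE => -[/= /mem_set ->].
case: ifPn => // /set_mem Ax; case: xA; rewrite inE; split => //.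
Qed.

Lemma measurable_slice2 (f : T1 * T2 -> R) x : measurable_fun (A `*` B) f -> A x ->
  measurable_fun B (fun y => f (x, y)).
Proof.
move=> /(measurable_restrictT _ mAB) mf Ax; apply/(measurable_restrictT _ mB).
have := measurable_fun_pair2 x mf; apply: eq_measurable_fun => y _.
rewrite /patch; case: ifPn => [|/negP yB].
  by rewrite inE => -[/= _ /mem_set ->].
case: ifPn => // /set_mem By; case: yB; rewrite inE; split => //.
Qed.

End Fubini_rectangle.

Section null_slices.
Context (R : realType) (d1 d2 : measure_display).
Context (T1 : measurableType d1) (T2 : measurableType d2).
Variables (m1 : {measure set T1 -> \bar R}) (s1 : sigma_finite setT m1).
Variable (m2 : {sigma_finite_measure set T2 -> \bar R}).
Local Open Scope ereal_scope.

(** By Tonelli, the measures of the sections of a null set integrate to 0. *)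
Lemma ae_slice1 (P : T1 * T2 -> Prop) : {ae (m1 \x m2), forall z, P z} ->
  {ae m2, forall y, {ae m1, forall x, P (x, y)}}.
Proof.
move=> [N [mN N0 PN]].
have mI : measurable_fun ([set: T1] `*` [set: T2]) (fun z => (\1_N z)%:E : \bar R).
  by apply/measurable_EFinP; exact: measurable_indic.
have p1N z : ([set: T1] `*` [set: T2]) z -> 0 <= (\1_N z)%:E :> \bar R by rewrite lee_fin.
have [_ m2N _ e] := tonelli_rect s1 m2 measurableT measurableT mI p1N.
have {}e : \int[m2]_y \int[m1]_x (\1_N (x, y))%:E = 0.
  by rewrite -e setXTT integral_indic// setIT.
have e' : \int[m2]_y `| \int[m1]_x (\1_N (x, y))%:E | = 0.
  rewrite -[RHS]e; apply: eq_integral => y _; rewrite gee0_abs//.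
  by apply: integral_ge0 => x _; rewrite lee_fin.
have := (ae_eq_integral_abs m2 measurableT m2N).1 e'.
apply: filterS => y /(_ I) /= yN.
have mNy : measurable (ysection N y) by exact: measurable_ysection.
exists (ysection N y); split => //.
  rewrite -yN -[X in m1 X]setIT -integral_indic//; apply: eq_integral => x _.
  by rewrite !indicE; congr ((_ _)%:R)%:E; apply/idP/idP; rewrite !inE /ysection/= inE.
by move=> x hx; rewrite /ysection/= inE; apply: PN.
Qed.

End null_slices.

(** * Borel sets and Lebesgue measure of the Euclidean space *)

Section boxes.
Variable (R : realType).
Implicit Type n : nat.

Definition obox n (a b : 'rV[R]_n) : set 'rV[R]_n :=
  [set x | forall i, a 0 i < x 0 i < b 0 i].

Definition cbox n (a b : 'rV[R]_n) : set 'rV[R]_n :=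
  [set x | forall i, a 0 i <= x 0 i <= b 0 i].

Lemma obox_cbox n (a b : 'rV[R]_n) : obox a b `<=` cbox a b.
Proof. by move=> x h i; have /andP[/ltW -> /ltW ->] := h i. Qed.

Lemma measurable_coord_set n (i : 'I_n) (A : set R) : measurable A ->
  measurable [set x : 'rV[R]_n | A (x 0 i)].
Proof.
by move=> mA; have := measurable_rV_coord i measurableT mA; rewrite setTI.
Qed.

Lemma measurable_obox n (a b : 'rV[R]_n) : measurable (obox a b).
Proof.
rewrite (_ : obox a b = \bigcap_(i in [set: 'I_n]) [set x | `]a 0 i, b 0 i[%classic (x 0 i)]).
  apply: fin_bigcap_measurable; first exact: finite_finset.
  by move=> i _; exact: (@measurable_coord_set n i `]a 0 i, b 0 i[%classic).
apply/seteqP; split=> x.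
  by move=> h i _; have := h i; rewrite /= in_itv.
by move=> h i; have := h i I; rewrite /= in_itv.
Qed.

Lemma measurable_cbox n (a b : 'rV[R]_n) : measurable (cbox a b).
Proof.
rewrite (_ : cbox a b = \bigcap_(i in [set: 'I_n]) [set x | `[a 0 i, b 0 i]%classic (x 0 i)]).
  apply: fin_bigcap_measurable; first exact: finite_finset.
  by move=> i _; exact: (@measurable_coord_set n i `[a 0 i, b 0 i]%classic).
apply/seteqP; split=> x.
  by move=> h i _; have := h i; rewrite /= in_itv.
by move=> h i; have := h i I; rewrite /= in_itv.
Qed.

(** Rational corners make the union countable; requiring the closed box to lie
    in [U] leaves room for bump functions compactly supported in [U]. *)
Lemma open_cbox_bigcup n (U : set 'rV[R]_n) : open U ->
  U = \bigcup_(pq : 'rV[rat]_n * 'rV[rat]_n)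
    [set x | cbox (map_mx ratr pq.1) (map_mx ratr pq.2) `<=` U /\
             obox (map_mx ratr pq.1) (map_mx ratr pq.2) x].
Proof.
move=> oU; apply/seteqP; split=> [x Ux|x [pq _ [h xb]]]; last first.
  by apply: h; exact: obox_cbox.
have /nbhs_ballP[e /= e0 xeU] := open_nbhs_nbhs (conj oU Ux).
have e20 : 0 < e / 2 by rewrite divr_gt0.
have /choice[p hp] (i : 'I_n) : exists q : rat, x 0 i - e / 2 < ratr q < x 0 i.
  have [q] := @rat_in_itvoo R (x 0 i - e / 2) (x 0 i) ltac:(lra).
  by rewrite in_itv/= => ?; exists q.
have /choice[q hq] (i : 'I_n) : exists q : rat, x 0 i < ratr q < x 0 i + e / 2.
  have [r] := @rat_in_itvoo R (x 0 i) (x 0 i + e / 2) ltac:(lra).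
  by rewrite in_itv/= => ?; exists r.
exists (\row_i p i, \row_i q i) => //; split => /=.
  move=> y yb; apply: xeU; split => // i j; rewrite ord1.
  have := yb j; rewrite !mxE => /andP[py yq].
  have /andP[? ?] := hp j; have /andP[? ?] := hq j.
  by rewrite /ball /= ltr_norml; apply/andP; split; lra.
move=> i; rewrite !mxE.
by have /andP[_ ->] := hp i; have /andP[-> _] := hq i.
Qed.

Lemma open_measurable_rV n (U : set 'rV[R]_n) : open U -> measurable U.
Proof.
move=> /open_cbox_bigcup ->; apply: countable_bigcupT_measurable => // pq.
have [h|h] := pselect (cbox (map_mx ratr pq.1) (map_mx ratr pq.2) `<=` U).
  rewrite (_ : [set x | _] = obox (map_mx ratr pq.1) (map_mx ratr pq.2)).
    exact: measurable_obox.
  by apply/seteqP; split => x //; case.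
rewrite (_ : [set x | _] = set0) //.
by apply/seteqP; split => x //; case.
Qed.

Lemma continuous_measurable_rV n (f : 'rV[R]_n -> R) :
  continuous f -> measurable_fun setT f.
Proof.
move=> cf; apply: (measurability _ (RGenOInfty.measurableE R)) => //.
move=> _ [_ [x ->] <-]; rewrite setTI; apply: open_measurable_rV.
by move/continuousP : cf; apply; exact: interval_open.
Qed.

Lemma row_lift_continuous n (i : 'I_n.+1) :
  continuous (fun x : 'rV[R]_n.+1 => \row_k x 0 (lift i k) : 'rV[R]_n).
Proof.
move=> x; apply/(@cvg_ballP _ _ _ (nbhs x)) => e e0.
have : \forall y \near x, ball x e y by exact: nbhsx_ballx.
apply: filterS => y [_ h]; split => // j k; rewrite !mxE.
exact: h.
Qed.

Definition unsnoc n (x : 'rV[R]_n.+1) : 'rV[R]_n * measurableTypeR R :=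
  (\row_k x 0 (lift ord_max k), x 0 ord_max).

Lemma rV_snocK n : cancel (@rV_snoc R n) (@unsnoc n).
Proof.
case=> x t; rewrite /unsnoc; congr pair; last by rewrite mxE unlift_none.
by apply/rowP => j; rewrite !mxE liftK.
Qed.

Lemma unsnoc_continuous n : continuous (@unsnoc n : _ -> 'rV[R]_n * R).
Proof.
move=> x; apply: (@cvg_pair _ _ _ (nbhs x) _ _ _ (nbhs_filter _) (nbhs_filter _)).
  exact: row_lift_continuous.
exact: coord_continuous.
Qed.

(** Open sets are known to be measurable for row vectors, whence the detour
    through [unsnoc]. *)
Lemma continuous_measurable_st n (f : 'rV[R]_n * measurableTypeR R -> R) :
  continuous (f : 'rV[R]_n * R -> R) -> measurable_fun setT f.
Proof.
move=> cf; rewrite (_ : f = (f \o @unsnoc n) \o @rV_snoc R n); last first.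
  by apply/funext => z /=; rewrite rV_snocK.
apply: measurableT_comp; last exact: measurable_rV_snoc.
apply: continuous_measurable_rV => x.
by apply: continuous_comp; [exact: unsnoc_continuous|exact: cf].
Qed.

Lemma lebesgue_rVS n : lebesgue_rV R n.+1 =
  pushforward (lebesgue_st R n) (@rV_snoc R n) :> (set _ -> \bar R).
Proof. by []. Qed.

Lemma cbox_finite n (a b : 'rV[R]_n) : (lebesgue_rV R n (cbox a b) < +oo)%E.
Proof.
elim: n a b => [|n IH] a b; first by rewrite /= diracE ltry.
rewrite lebesgue_rVS /pushforward.
rewrite (_ : _ @^-1` _ = cbox (unsnoc a).1 (unsnoc b).1 `*` `[(unsnoc a).2, (unsnoc b).2]).
  rewrite /lebesgue_st /= product_measure1E//; last exact: measurable_cbox.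
  rewrite lte_mul_pinfty//.
    by rewrite ge0_fin_numE.
  rewrite [X in (X < _)%E](_ : _ = lebesgue_measure `[(unsnoc a).2, (unsnoc b).2]%classic)//.
  by rewrite lebesgue_measure_itv/=; case: ifP; rewrite -?EFinB ltry.
apply/seteqP; split => [[x t] /= h|[x t] /= [h1 h2] i].
  split=> /=; first by move=> i; have := h (lift ord_max i); rewrite !mxE liftK.
  by have := h ord_max; rewrite !mxE unlift_none /= in_itv.
rewrite mxE; case: unliftP => [k ->|->] /=.
  by have := h1 k; rewrite !mxE.
by move: h2; rewrite in_itv.
Qed.

Lemma bigcup_obox n : \bigcup_k obox (const_mx (- k%:R)) (const_mx k%:R) = [set: 'rV[R]_n].
Proof.
apply/seteqP; split => // x _.
pose M := \sum_i `|x 0 i|; exists (Num.truncn M).+1 => // i.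
have xM : `|x 0 i| < (Num.truncn M).+1%:R.
  apply: le_lt_trans (truncnS_gt M).
  by rewrite /M (bigD1 i)//= lerDl sumr_ge0.
by rewrite !mxE -ltr_norml.
Qed.

Lemma bigcup_cbox n : \bigcup_k cbox (const_mx (- k%:R)) (const_mx k%:R) = [set: 'rV[R]_n].
Proof.
apply/seteqP; split => //; rewrite -bigcup_obox.
by apply: subset_bigcup => k _; exact: obox_cbox.
Qed.

Lemma lebesgue_rV_sigma_finite n : sigma_finite setT (lebesgue_rV R n).
Proof.
exists (fun k => cbox (const_mx (- k%:R)) (const_mx k%:R)).
  by rewrite bigcup_cbox.
by move=> k; split; [exact: measurable_cbox|exact: cbox_finite].
Qed.

Lemma bounded_cbox n (A : set 'rV[R]_n) : bounded_set A ->
  exists a b, A `<=` cbox a b.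
Proof.
move=> [M [_ hM]]; exists (const_mx (- (M + 1))), (const_mx (M + 1)) => x Ax i.
have xM := hM (M + 1) ltac:(by rewrite ltrDl) x Ax.
rewrite !mxE -ler_norml; apply: le_trans xM.
rewrite [leRHS]/Num.norm/= mx_normrE.
by rewrite (le_trans _ (le_bigmax _ _ (0, i)))//=.
Qed.

Lemma bounded_finite n (A : set 'rV[R]_n) : measurable A -> bounded_set A ->
  (lebesgue_rV R n A < +oo)%E.
Proof.
move=> mA /bounded_cbox[a [b Aab]]; apply: le_lt_trans (cbox_finite a b).
by rewrite le_measure ?inE//; exact: measurable_cbox.
Qed.

Definition boxes n : set (set 'rV[R]_n) := [set B | exists a b, B = obox a b].

Lemma obox_setI n (a b c d : 'rV[R]_n) : obox a b `&` obox c d =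
  obox (\row_i Num.max (a 0 i) (c 0 i)) (\row_i Num.min (b 0 i) (d 0 i)).
Proof.
apply/seteqP; split => [x [h1 h2] i|x h].
  rewrite !mxE gt_max lt_min.
  by have /andP[-> ->] := h1 i; have /andP[-> ->] := h2 i.
by split => i; have := h i; rewrite !mxE gt_max lt_min => /andP[/andP[? ?] /andP[? ?]]; apply/andP.
Qed.

Lemma boxes_setI n : setI_closed (@boxes n).
Proof. by move=> _ _ [a [b ->]] [c [d ->]]; rewrite obox_setI; do 2!eexists. Qed.

(** The points whose [i]-th coordinate exceeds [r] form a countable union of
    boxes, and open half-lines generate the Borel sets of the line. *)
Lemma measurable_boxes n : @measurable _ 'rV[R]_n = <<s @boxes n >>.
Proof.
apply/seteqP; split; last first.
  apply: smallest_sub; first exact: sigma_algebra_measurable.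
  by move=> _ [a [b ->]]; exact: measurable_obox.
apply: smallest_sub; first exact: smallest_sigma_algebra.
rewrite -bigcup_seq/=; apply: bigcup_sub => i _ B [C mC <-].
rewrite setTI.
pose S := [set A : set R | <<s @boxes n >> ((fun x : 'rV[R]_n => x 0 i) @^-1` A)].
have [s0 sC sU] := smallest_sigma_algebra [set: 'rV[R]_n] (@boxes n).
suff : (@ocitv R).-sigma.-measurable `<=` S by apply.
rewrite RGenOInfty.measurableE; apply: smallest_sub.
  split; rewrite /S/=.
  - by rewrite preimage_set0.
  - by move=> A mA; rewrite setTD preimage_setC -setTD; exact: sC.
  - by move=> F mF; rewrite preimage_bigcup; exact: sU.
move=> _ [r ->]; rewrite /S/=.
pose a k : 'rV[R]_n := \row_j if j == i then r else - k%:R.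
pose b k : 'rV[R]_n := const_mx k%:R.
rewrite (_ : _ @^-1` _ = \bigcup_k obox (a k) (b k)).
  by apply: sU => k; apply: sub_sigma_algebra; exists (a k), (b k).
apply/seteqP; split => [x /=|x [k _ h]]; last first.
  have := h i; rewrite !mxE eqxx => /andP[rx _] /=; by rewrite in_itv/= rx.
rewrite in_itv/= andbT => rx.
have : [set: 'rV[R]_n] x by [].
rewrite -bigcup_obox => -[k _ h]; exists k => // j.
have := h j; rewrite !mxE; case: eqP => [->|//] /andP[_ ->].
by rewrite rx.
Qed.

End boxes.

(** * Smooth functions *)

Section Ck_calculus.
Variables (R : realType) (V : normedModType R).
Implicit Types (f g : V -> R) (k : nat).

Lemma CkS k f : Ck k.+1 f -> Ck k f.
Proof.
elim: k f => [|k IH] f; first by case.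
by move=> [cf h]; split => // v; have [? ?] := h v; split => //; exact: IH.
Qed.

Lemma Ck_cst k (c : R) : Ck k (fun _ : V => c).
Proof.
elim: k c => [|k IH] c; first by move=> /= x; exact: cvg_cst.
split => [x|v]; first exact: cvg_cst.
split=> [x|]; first exact: derivable_cst.
rewrite (_ : 'D_v _ = fun=> 0); first exact: IH.
by apply/funext => x; exact: derive_cst.
Qed.

Lemma CkD k f g : Ck k f -> Ck k g -> Ck k (fun x => f x + g x).
Proof.
elim: k f g => [|k IH] f g; first by move=> /= cf cg x; apply: cvgD; [exact: cf|exact: cg].
move=> [cf hf] [cg hg]; split=> [x|v]; first by apply: cvgD; [exact: cf|exact: cg].
have [df Cf] := hf v; have [dg Cg] := hg v.
split=> [x|]; first exact: derivableD.
rewrite (_ : 'D_v _ = fun x => 'D_v f x + 'D_v g x); first exact: IH.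
by apply/funext => x; exact: deriveD.
Qed.

Lemma CkM k f g : Ck k f -> Ck k g -> Ck k (fun x => f x * g x).
Proof.
elim: k f g => [|k IH] f g; first by move=> /= cf cg x; apply: cvgM; [exact: cf|exact: cg].
move=> Ckf Ckg; have Ckf' := CkS Ckf; have Ckg' := CkS Ckg.
move: Ckf Ckg => [cf hf] [cg hg]; split=> [x|v].
  by apply: cvgM; [exact: cf|exact: cg].
have [df Cf] := hf v; have [dg Cg] := hg v.
split=> [x|]; first exact: derivableM.
rewrite (_ : 'D_v _ = fun x => f x * 'D_v g x + g x * 'D_v f x).
  by apply: CkD; exact: IH.
by apply/funext => x; exact: deriveM.
Qed.

Lemma CkZ k f (c : R) : Ck k f -> Ck k (fun x => c * f x).
Proof. by apply: CkM; exact: Ck_cst. Qed.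

Lemma CkN k f : Ck k f -> Ck k (fun x => - f x).
Proof.
rewrite (_ : (fun x => - f x) = (fun x => -1 * f x)); first exact: CkZ.
by apply/funext => x; rewrite mulN1r.
Qed.

Lemma CkV k g : (forall x, g x != 0) -> Ck k g -> Ck k (fun x => (g x)^-1).
Proof.
move=> g0; elim: k => [|k IH]; first by move=> /= cg x; apply: cvgV => //; exact: cg.
move=> Ckg; have Ckg' := CkS Ckg.
move: Ckg => [cg hg]; split=> [x|v]; first by apply: cvgV => //; exact: cg.
have [dg Cg] := hg v.
split=> [x|]; first exact: derivableV.
rewrite (_ : 'D_v _ = fun x => - ((g x)^-1 * (g x)^-1) * 'D_v g x).
  by apply: CkM => //; apply: CkN; apply: CkM; exact: IH.
apply/funext => x; rewrite deriveV//= /GRing.scale/=; congr (_ * _).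
by rewrite -invfM -expr2.
Qed.

Lemma Ck_prod k (I : Type) (s : seq I) (P : pred I) (F : I -> V -> R) :
  (forall i, Ck k (F i)) -> Ck k (fun x => \prod_(i <- s | P i) F i x).
Proof.
move=> h; elim: s => [|i s IH].
  by under eq_fun do rewrite big_nil; exact: Ck_cst.
under eq_fun do rewrite big_cons; case: (P i) => //.
exact: CkM.
Qed.

Lemma smooth_derivable f x v : smooth f -> derivable f x v.
Proof. by move=> /(_ 1%N)[_ /(_ v)[+ _]]; exact. Qed.

Lemma smooth_derive f v : smooth f -> smooth ('D_v f).
Proof. by move=> sf k; have [_ /(_ v)[_ +]] := sf k.+1. Qed.

End Ck_calculus.

Section Ck_affine.
Variables (R : realType) (V W : normedModType R).

(** [B] is the linear part of the affine map [A], and the chain rule is a mere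
    rewriting of the difference quotient. *)
Lemma derive_affine (A : V -> W) (B : V -> W) (f : W -> R) x v :
  (forall h v x, A (h *: v + x) = h *: B v + A x) ->
  'D_v (f \o A) x = 'D_(B v) f (A x).
Proof. by move=> AB; rewrite /derive; under eq_fun do rewrite /= AB. Qed.

Lemma derivable_affine (A : V -> W) (B : V -> W) (f : W -> R) x v :
  (forall h v x, A (h *: v + x) = h *: B v + A x) ->
  derivable f (A x) (B v) -> derivable (f \o A) x v.
Proof. by move=> AB; rewrite /derivable; under [in X in _ -> X]eq_fun do rewrite /= AB. Qed.

Lemma Ck_affine k (A : V -> W) (B : V -> W) (f : W -> R) :
  continuous A -> (forall h v x, A (h *: v + x) = h *: B v + A x) ->
  Ck k f -> Ck k (f \o A).
Proof.
move=> cA AB; elim: k f => [|k IH] f.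
  by move=> cf x; apply: continuous_comp; [exact: cA|exact: cf].
move=> [cf hf]; split=> [x|v].
  by apply: continuous_comp; [exact: cA|exact: cf].
have [df Cf] := hf (B v); split=> [x|]; first exact: derivable_affine.
rewrite (_ : 'D_v _ = 'D_(B v) f \o A); first exact: IH.
by apply/funext => x /=; exact: derive_affine.
Qed.

End Ck_affine.

Section Ck_real.
Variable R : realType.
Implicit Types (f g : R -> R).

Lemma derivable_scale f x v : derivable f x 1 ->
  derivable f x v /\ 'D_v f x = v * 'D_1 f x.
Proof.
move=> /derivable1_diffP df; split; first exact: diff_derivable.
by rewrite !deriveE// -[v in LHS]mulr1 -[v * 1]/(v *: (1 : R)) linearZ.
Qed.

(** On the line, every directional derivative is a multiple of the one in
    direction 1. *)
Lemma Ck_real k f g : (forall x : R, is_derive x 1 f (g x)) -> Ck k g -> Ck k.+1 f.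
Proof.
move=> fg Cg; have df x : derivable f x 1 by have [] := fg x.
split=> [x|v].
  by have /derivable1_diffP/differentiable_continuous := df x.
split=> [x|]; first by have [] := derivable_scale v (df x).
rewrite (_ : 'D_v f = fun x => v * g x); first exact: CkZ.
apply/funext => x; have [_ ->] := derivable_scale v (df x).
by have [_ ->] := fg x.
Qed.

Lemma is_derive_trig (w a b x : R) : is_derive x 1 (fun t : R => a * cos (w * t) + b * sin (w * t))
    ((b * w) * cos (w * x) + (- (a * w)) * sin (w * x)).
Proof.
have dw : is_derive x 1 (fun t : R => w * t) w.
  rewrite -[X in is_derive _ _ _ X]mulr1.
  exact: (@is_deriveZ _ _ _ (@id R) w x 1 1).
have dc : is_derive x 1 (fun t : R => cos (w * t)) (- sin (w * x) * w).
  exact: (@is_derive1_comp _ (@cos R) (fun t => w * t)).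
have ds : is_derive x 1 (fun t : R => sin (w * t)) (cos (w * x) * w).
  exact: (@is_derive1_comp _ (@sin R) (fun t => w * t)).
have h : is_derive x 1 (fun t : R => a * cos (w * t) + b * sin (w * t))
    (a * (- sin (w * x) * w) + b * (cos (w * x) * w)).
  exact: (is_deriveD (is_deriveZ a dc) (is_deriveZ b ds)).
by apply: is_derive_eq h _; ring.
Qed.

Lemma Ck_trig k (w a b : R) :
  Ck k (fun t : R => a * cos (w * t) + b * sin (w * t)).
Proof.
elim: k a b => [|k IH] a b; last by apply: (Ck_real (fun x => is_derive_trig w a b x)); exact: IH.
move=> x; have [/derivable1_diffP/differentiable_continuous + _] := is_derive_trig w a b x.
exact.
Qed.

(** The derivatives of the flat function [flat 0] are combinations of the members
    of this family, which is stable under differentiation. *)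
Definition flat m (x : R) : R :=
  if 0 < x then x ^- m * expR (- x^-1) else 0.

Lemma flat_ge0 m x : 0 <= flat m x.
Proof.
rewrite /flat; case: ifPn => // x0.
by rewrite mulr_ge0 ?expR_ge0// invr_ge0 exprn_ge0// ltW.
Qed.

Lemma flat_gt0 m x : 0 < x -> 0 < flat m x.
Proof.
by move=> x0; rewrite /flat x0 mulr_gt0 ?expR_gt0// invr_gt0 exprn_gt0.
Qed.

(** The exponential dominates the term of degree [m + 1] of its series. *)
Lemma flat_le m x : 0 <= x -> flat m x <= m.+1`!%:R * x.
Proof.
rewrite le_eqVlt => /predU1P[<-|x0]; first by rewrite /flat ltxx mulr0.
rewrite /flat x0 expRN -exprVn.
have y0 : 0 < x^-1 by rewrite invr_gt0.
have := expR_ge1Dxn m (ltW y0) => h.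
have f0 : (0 : R) < m.+1`!%:R by rewrite ltr0n fact_gt0.
rewrite ler_pdivrMr ?expR_gt0//.
have {}h : x^-1 ^+ m.+1 / m.+1`!%:R <= expR x^-1 by apply: le_trans h; rewrite lerDr.
have := ler_wpM2l (ltW (mulr_gt0 f0 x0)) h; apply: le_trans.
rewrite exprS le_eqVlt; apply/orP; left; apply/eqP; field.
by rewrite !gt_eqF.
Qed.

(** At the origin, [flat_le] makes the difference quotient tend to 0. *)
Lemma is_derive_flat m (x : R) : is_derive x 1 (flat m) (flat m.+2 x - m%:R * flat m.+1 x).
Proof.
have [x0|x0|<-] := ltgtP 0 x.
- have xn0 : x != 0 by rewrite gt_eqF.
  have dV : is_derive x 1 (fun t : R => t^-1) (- x ^- 2).
    split; first exact: derivableV.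
    by rewrite deriveV// derive_id /GRing.scale/= mulr1.
  have dN : is_derive x 1 (fun t : R => - t^-1) (x ^- 2).
    by apply: is_derive_eq (is_deriveN dV) _; rewrite opprK.
  have dE : is_derive x 1 (fun t : R => expR (- t^-1)) (expR (- x^-1) * x ^- 2).
    exact: (@is_derive1_comp _ (@expR R) (fun t => - t^-1)).
  have dX : is_derive x 1 (fun t : R => t ^- m) (- m%:R * x ^- m.+1).
    rewrite (_ : (fun t : R => t ^- m) = (fun t => t^-1) ^+ m); last first.
      by apply/funext => t; rewrite exprfctE exprVn.
    apply: is_derive_eq (is_deriveX m dV) _; rewrite /GRing.scale/=.
    case: m => [|m]; first by rewrite !mul0r oppr0 mul0r.
    by rewrite succnK exprVn !exprS; field; rewrite expf_neq0.
  apply: (@near_eq_is_derive _ _ _ (fun t : R => t ^- m * expR (- t^-1))); rewrite ?oner_eq0//.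
    near=> t; rewrite /flat ifT//; near: t.
    exact: lt_nbhsr.
  apply: is_derive_eq (is_deriveM dX dE) _; rewrite /GRing.scale/= /flat x0.
  by rewrite !exprSr; field; rewrite xn0 expf_neq0.
- apply: (@near_eq_is_derive _ _ _ (fun t : R => 0 : R)); rewrite ?oner_eq0//.
    near=> t; rewrite /flat ifF//; apply/negbTE; rewrite -leNgt ltW//; near: t.
    exact: lt_nbhsl.
  by apply: is_derive_eq (is_derive_cst _ _ _) _; rewrite /flat ltNge (ltW x0)/= mulr0 subr0.
- have h0 : (fun h : R => h^-1 *: ((flat m \o shift 0) (h *: 1) - flat m 0)) h @[h --> 0^'] --> (0 : R).
    apply/cvgrPdist_le => e e0.
    pose C : R := m.+2`!%:R.
    have C0 : 0 < C by rewrite ltr0n fact_gt0.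
    near=> h; rewrite sub0r normrN /= addr0 /flat ltxx subr0 [h%:A]mulr1.
    have [h0|h0] := ltP 0 h; last by rewrite scaler0 normr0 ltW.
    rewrite /GRing.scale/=.
    have -> : h^-1 * (h ^- m * expR (- h^-1)) = flat m.+1 h.
      by rewrite /flat h0 exprS invfM mulrA.
    rewrite ger0_norm ?flat_ge0// (le_trans (flat_le _ (ltW h0)))// mulrC -ler_pdivlMr//.
    rewrite (le_trans (ler_norm _))//; near: h.
    by apply: dnbhs0_le; rewrite divr_gt0.
  split; first by apply/cvg_ex; exists 0.
  by rewrite /flat !ltxx mulr0 subr0; apply: cvg_lim.
Unshelve. all: by end_near. Qed.

Lemma Ck_flat k m : Ck k (flat m).
Proof.
elim: k m => [|k IH] m.
  move=> x; have [/derivable1_diffP/differentiable_continuous + _] := is_derive_flat m x.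
  exact.
apply: Ck_real => [x|]; first exact: is_derive_flat.
by apply: CkD => //; apply: CkN; apply: CkZ.
Qed.

(** A smooth transition between the values 0, on negative numbers, and 1, on
    numbers larger than 1. *)
Definition step (x : R) : R := flat 0 x / (flat 0 x + flat 0 (1 - x)).

Lemma step_den_gt0 x : 0 < flat 0 x + flat 0 (1 - x).
Proof.
have [x0|x0] := ltP 0 x; first by rewrite ltr_pwDl ?flat_gt0 ?flat_ge0.
by rewrite ltr_wpDl ?flat_ge0// flat_gt0//; lra.
Qed.

Lemma smooth_step : smooth step.
Proof.
move=> k; apply: CkM; first exact: Ck_flat.
apply: CkV => [x|]; first by rewrite gt_eqF// step_den_gt0.
apply: CkD; first exact: Ck_flat.
apply: (@Ck_affine R R R k (fun x : R => 1 - x) (fun v : R => - v) (flat 0)) => [x|h v x|].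
- by apply: cvgB; [exact: cvg_cst|exact: cvg_id].
- by rewrite /GRing.scale/=; ring.
- exact: Ck_flat.
Qed.

Lemma step0 x : x <= 0 -> step x = 0.
Proof. by move=> x0; rewrite /step /flat ltNge x0/= mul0r. Qed.

Lemma step1 x : 1 <= x -> step x = 1.
Proof.
move=> x1; have x0 : 0 < x by lra.
rewrite /step {3}/flat subr_gt0 ltNge x1/= addr0 divff// gt_eqF//.
exact: flat_gt0.
Qed.

Lemma step_ge0 x : 0 <= step x.
Proof. by rewrite /step divr_ge0 ?flat_ge0// ltW// step_den_gt0. Qed.

Lemma step_le1 x : step x <= 1.
Proof.
by rewrite /step ler_pdivrMr ?step_den_gt0// mul1r lerDl flat_ge0.
Qed.

Lemma derive_step_eq0 x : x < 0 \/ 1 < x -> 'D_1 step x = 0.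
Proof.
case=> hx.
  rewrite (@near_eq_derive _ _ _ step (cst 0)) ?derive_cst//.
  by near=> t; rewrite step0// ltW//; near: t; exact: lt_nbhsl.
rewrite (@near_eq_derive _ _ _ step (cst 1)) ?derive_cst//.
by near=> t; rewrite step1// ltW//; near: t; exact: lt_nbhsr.
Unshelve. all: by end_near. Qed.

Lemma derive_step_bounded : exists2 C, 0 < C & forall x, `|'D_1 step x| <= C.
Proof.
have [_ /(_ 1)[_ cs]] := smooth_step 1%N.
have cn : continuous (fun x : R => `|'D_1 step x|).
  by move=> x; apply: cvg_norm; exact: cs.
have [c _ hc] := EVT_max ler01 (continuous_subspaceT cn).
exists (`|'D_1 step c| + 1); first by rewrite ltr_wpDl.
move=> x; have [x0|x0] := ltP x 0.
  by rewrite derive_step_eq0 ?normr0 ?addr_ge0//; left.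
have [x1|x1] := ltP 1 x.
  by rewrite derive_step_eq0 ?normr0 ?addr_ge0//; right.
by rewrite (le_trans (hc x _)) ?lerDl// in_itv/= x0 x1.
Qed.

Lemma derivable_step x : derivable step x 1.
Proof. exact: smooth_derivable smooth_step. Qed.

Lemma step_gt0 x : step x != 0 -> 0 < x.
Proof. by apply: contraNT; rewrite -leNgt => /step0 ->. Qed.

End Ck_real.

(** * Test functions and the fundamental lemma of the calculus of variations *)

Section test_function_theory.
Variables (R : realType) (V : normedModType R).
Implicit Types (D : set V) (phi : V -> R).

Lemma closure_sub_compact (A K : set V) : compact K -> A `<=` K ->
  closure A `<=` K /\ compact (closure A).
Proof.
move=> cK AK; have clK := compact_closed (@norm_hausdorff _ _) cK.
have AK' : closure A `<=` K by rewrite closureE; apply: smallest_sub.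
by split=> //; apply: subclosed_compact cK AK'; exact: closed_closure.
Qed.

Lemma test_function_bounded D phi : test_function D phi ->
  exists2 C, 0 < C & forall x, `|phi x| <= C.
Proof.
move=> [sphi cphi _]; set K := closure _ in cphi.
have cont : {within K, continuous phi}.
  by apply: continuous_subspaceT; exact: (sphi 0%N).
have [M [_ hM]] := compact_bounded (continuous_compact cont cphi).
exists (`|M| + 1); first by rewrite ltr_wpDl.
move=> x; have [xK|xK] := pselect (K x).
  apply: hM; last by exists x.
  by rewrite (le_lt_trans (ler_norm _))// ltrDl.
have -> : phi x = 0.
  by apply: contrapT => /eqP p0; apply: xK; exact: subset_closure.
by rewrite normr0 addr_ge0.
Qed.

Lemma test_function_out D phi x : test_function D phi -> ~ D x -> phi x = 0.
Proof.
move=> [_ _ sD] Dx; apply: contrapT => /eqP p0; apply: Dx; apply: sD.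
exact: subset_closure.
Qed.

Lemma derive_supp phi v x : 'D_v phi x != 0 -> closure [set x | phi x != 0] x.
Proof.
move=> h; apply: contrapT => xK.
have : nbhs x (~` closure [set x | phi x != 0]).
  by apply: open_nbhs_nbhs; split => //; apply: closed_openC; exact: closed_closure.
move=> nx; move/eqP : h; apply.
rewrite (@near_eq_derive _ _ _ phi (cst 0)) ?derive_cst//.
apply: filterS nx => y hy; apply: contrapT => /eqP p0; apply: hy.
exact: subset_closure.
Qed.

Lemma test_function_derive D phi v : test_function D phi -> test_function D ('D_v phi).
Proof.
move=> [sphi cphi sD].
have [h1 h2] := @closure_sub_compact [set x | 'D_v phi x != 0] _ cphi (@derive_supp phi v).
split; [|exact: h2|exact: subset_trans h1 sD].
exact: smooth_derive.
Qed.

Lemma test_functionM_smooth D phi f : test_function D phi -> smooth f ->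
  test_function D (fun x => phi x * f x).
Proof.
move=> [sphi cphi sD] sf.
have [|h1 h2] := @closure_sub_compact [set x | phi x * f x != 0] _ cphi.
  move=> x /=; rewrite mulf_eq0 negb_or => /andP[p0 _]; exact: subset_closure.
split; [|exact: h2|exact: subset_trans h1 sD].
by move=> k; apply: CkM; [exact: sphi|exact: sf].
Qed.

End test_function_theory.

Section bump.
Variables (R : realType) (n : nat).
Implicit Types (a b x : 'rV[R]_n) (j k : nat).

(** Approximation from below of the indicator function of an open box, which
    improves as [j] grows. *)
Definition bump a b j x : R :=
  \prod_(i < n) (step (j.+1%:R * (x 0 i - a 0 i)) * step (j.+1%:R * (b 0 i - x 0 i))).

Lemma smooth_bump a b j : smooth (bump a b j).
Proof.
move=> k; apply: Ck_prod => i; apply: CkM.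
- apply: (@Ck_affine R _ R k (fun x : 'rV[R]_n => j.+1%:R * (x 0 i - a 0 i))
    (fun x => j.+1%:R * x 0 i) (@step R)) => [x|h v x|].
  + apply: (@CkZ R _ 0%N); apply: (@CkD R _ 0%N); first exact: coord_continuous.
    exact: (@Ck_cst R _ 0%N).
  + by rewrite !mxE /GRing.scale/=; ring.
  + exact: smooth_step.
- apply: (@Ck_affine R _ R k (fun x : 'rV[R]_n => j.+1%:R * (b 0 i - x 0 i))
    (fun x => - (j.+1%:R * x 0 i)) (@step R)) => [x|h v x|].
  + apply: (@CkZ R _ 0%N); apply: (@CkD R _ 0%N); first exact: (@Ck_cst R _ 0%N).
    by apply: (@CkN R _ 0%N); exact: coord_continuous.
  + by rewrite !mxE /GRing.scale/=; ring.
  + exact: smooth_step.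
Qed.

Lemma bump_ge0 a b j x : 0 <= bump a b j x.
Proof. by apply: prodr_ge0 => i _; rewrite mulr_ge0 ?step_ge0. Qed.

Lemma bump_le1 a b j x : bump a b j x <= 1.
Proof.
apply: prodr_ile1 => i _; rewrite mulr_ge0 ?step_ge0//=.
by rewrite mulr_ile1 ?step_ge0 ?step_le1.
Qed.

Lemma bump_supp a b j x : bump a b j x != 0 -> obox a b x.
Proof.
move=> /prodf_neq0 h i; have := h i isT; rewrite mulf_eq0 negb_or => /andP[].
move=> /step_gt0; rewrite pmulr_rgt0// subr_gt0 => ->.
by move=> /step_gt0; rewrite pmulr_rgt0// subr_gt0 => ->.
Qed.

Lemma bump_cvg a b x : obox a b x -> bump a b j x @[j --> \oo] --> (1 : R).
Proof.
move=> xab; apply: cvg_near_cst.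
have h (c : R) : 0 < c -> \forall j \near \oo, step (j.+1%:R * c) = 1.
  move=> c0; near=> j; apply: step1.
  rewrite -ler_pdivrMr// mul1r (le_trans (ltW (truncnS_gt _)))// ler_nat ltnS.
  by near: j; exact: nbhs_infty_ge.
suff : \forall j \near \oo, forall i : 'I_n,
    step (j.+1%:R * (x 0 i - a 0 i)) * step (j.+1%:R * (b 0 i - x 0 i)) = 1.
  apply: filterS => j hj; rewrite /bump.
  by rewrite (eq_bigr (fun=> 1)) ?big1_eq.
apply: filter_forall => i; have /andP[ax xb] := xab i.
rewrite -subr_gt0 in ax; rewrite -subr_gt0 in xb.
near=> j; rewrite (near (h _ ax) j)// (near (h _ xb) j)// mulr1.
Unshelve. all: by end_near. Qed.

Lemma compact_cbox a b : compact (cbox a b).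
Proof.
rewrite (_ : cbox a b = [set v : 'rV[R]_n | forall i, `[a 0 i, b 0 i]%classic (v ord0 i)]).
  by apply: (@rV_compact _ _ (fun i => `[a 0 i, b 0 i]%classic)) => i; exact: segment_compact.
by apply/seteqP; split => x h i; have := h i; rewrite /= in_itv.
Qed.

Lemma test_function_bump (D : set 'rV[R]_n) a b j :
  cbox a b `<=` D -> test_function D (bump a b j).
Proof.
move=> abD; have [h1 h2] := @closure_sub_compact _ _ [set x | bump a b j x != 0]
  _ (@compact_cbox a b) (fun x hx => obox_cbox (bump_supp hx)).
by split; [exact: smooth_bump|exact: h2|exact: subset_trans h1 abD].
Qed.

End bump.

Section fundamental_lemma.
Variables (R : realType) (n : nat).
Local Notation mu := (lebesgue_rV R n).
Variables (D : set 'rV[R]_n) (oD : open D) (g : 'rV[R]_n -> R).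
Hypothesis gi : mu.-integrable D (EFin \o g).
Hypothesis g0 : forall phi, test_function D phi ->
  \int[mu]_(x in D) (g x * phi x) = 0.

Let mD : measurable D. Proof. exact: open_measurable_rV. Qed.
Let mg : measurable_fun D g.
Proof. by have /measurable_int/measurable_EFinP := gi. Qed.

Lemma test_function_measurable (E : set 'rV[R]_n) phi : test_function E phi ->
  measurable_fun setT phi.
Proof. by move=> [s _ _]; exact: continuous_measurable_rV (s 0%N). Qed.

(** Dominated convergence along the bump functions of the box. *)
Let int_obox a b : cbox a b `<=` D -> (\int[mu]_(x in obox a b) (g x)%:E = 0)%E.
Proof.
move=> abD; have oD' : obox a b `<=` D by apply: subset_trans abD; exact: obox_cbox.
have mo := measurable_obox a b.
have mphi j : measurable_fun D (bump a b j).
  by apply: measurable_funTS; exact: test_function_measurable (test_function_bump j abD).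
have mind : measurable_fun D (fun x => g x * \1_(obox a b) x) by apply: measurable_funM.
have lim : \int[mu]_(x in D) (g x * bump a b j x) @[j --> \oo] -->
    \int[mu]_(x in D) (g x * \1_(obox a b) x).
  have iabs : mu.-integrable D (EFin \o (fun x => `|g x|)) by exact: (integrable_abse gi).
  apply: (dominated_cvg_real mD _ mind _ iabs _).2.
  - by move=> j; exact: measurable_funM.
  - apply: aeW => x Dx; apply: cvgM; first exact: cvg_cst.
    have [xab|xab] := pselect (obox a b x).
      by rewrite indicE mem_set//; exact: bump_cvg.
    rewrite indicE memNset//; apply: cvg_near_cst; apply: nearW => j.
    by apply/eqP; apply: contrapT => /negP/bump_supp.
  - apply: aeW => x j Dx; rewrite normrM ler_piMr// ger0_norm ?bump_ge0//.
    exact: bump_le1.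
have {}lim : (0 : R) = \int[mu]_(x in D) (g x * \1_(obox a b) x).
  apply: (cvg_unique _ _ lim) => //.
  apply: cvg_near_cst; apply: nearW => j; apply: g0; exact: test_function_bump.
have goi : mu.-integrable (obox a b) (EFin \o g) by apply: integrableS gi.
rewrite -(fineK (integrable_fin_num mo goi)); congr EFin.
rewrite [RHS]lim -/(Rintegral _ _ _) -{1}(setIidr oD') Rintegral_mkcondr.
apply: eq_Rintegral => x _; rewrite /patch indicE; case: ifPn => _.
  by rewrite mulr1.
by rewrite mulr0.
Qed.

(** Boxes are stable under intersection and generate the Borel sets: a Dynkin
    class argument extends the previous identity to Borel subsets of a box. *)
Let int_measurable a b A : cbox a b `<=` D -> measurable A ->
  (\int[mu]_(x in A `&` obox a b) (g x)%:E = 0)%E.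
Proof.
move=> abD mA; have oD' : obox a b `<=` D by apply: subset_trans abD; exact: obox_cbox.
have mo := measurable_obox a b.
have giA B : measurable B -> mu.-integrable (B `&` obox a b) (EFin \o g).
  move=> mB; apply: integrableS gi => //; first exact: measurableI.
  by move=> x [_ /oD'].
apply: (@dynkin_induction _ _ (@boxes R n)
  (fun A => (\int[mu]_(x in A `&` obox a b) (g x)%:E = 0)%E)).
- exact: measurable_boxes.
- exact: boxes_setI.
- by rewrite setTI; exact: int_obox.
- move=> _ [c [e ->]].
  rewrite obox_setI; apply: int_obox; apply: subset_trans abD => x h i; have := h i.
  by rewrite !mxE ge_max le_min => /andP[/andP[? ?] /andP[? ?]]; apply/andP.
- move=> S mS S0.
  have goi : mu.-integrable (obox a b) (EFin \o g) by apply: integrableS gi.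
  have UE : obox a b = (S `&` obox a b) `|` (~` S `&` obox a b).
    by rewrite -setIUl setUv setTI.
  have h : (\int[mu]_(x in obox a b) (g x)%:E = 0)%E by exact: int_obox.
  rewrite UE integral_setU// in h.
  + by rewrite S0 add0e in h.
  + exact: measurableI.
  + by apply: measurableI => //; exact: measurableC.
  + by rewrite -UE; exact: measurable_int goi.
  + apply/disj_setPS => x [[Sx _] [/= nSx _]]; exact: nSx.
- move=> F mF tF F0; rewrite setI_bigcupl integral_bigcup//.
  + by apply: eseries0 => i _ _; exact: F0.
  + move=> i j _ _ [x [[Fx _] [Gx _]]]; apply: tF => //.
    by exists x.
  + by move=> k; exact: measurableI.
  + rewrite -setI_bigcupl; apply: giA; exact: bigcupT_measurable.
- by rewrite -measurable_boxes.
Qed.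

(** Since its integrals over the Borel subsets of a rational box in [D] vanish,
    [g] vanishes almost everywhere in that box, and countably many such boxes
    cover [D]. *)
Lemma fundamental_lemma : {ae mu, forall x, D x -> g x = 0}.
Proof.
pose P (pq : 'rV[rat]_n * 'rV[rat]_n) (x : 'rV[R]_n) :=
  cbox (map_mx ratr pq.1) (map_mx ratr pq.2) `<=` D ->
  obox (map_mx ratr pq.1) (map_mx ratr pq.2) x -> g x = 0.
have hP pq : {ae mu, forall x, P pq x}.
  have [h|h] := pselect (cbox (map_mx ratr pq.1) (map_mx ratr pq.2) `<=` D); last first.
    by apply: aeW => x /h.
  set a : 'rV[R]_n := map_mx ratr pq.1; set b : 'rV[R]_n := map_mx ratr pq.2.
  have oD' : obox a b `<=` D by apply: subset_trans h; exact: obox_cbox.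
  have mo := measurable_obox a b.
  have goi : mu.-integrable (obox a b) (EFin \o g) by apply: integrableS gi.
  have := @integral_ae_eq _ _ _ mu (obox a b) mo (cst 0%E) (EFin \o g) goi
    (measurable_cst _).
  have h0 (E : set 'rV[R]_n) : E `<=` obox a b -> measurable E ->
      (\int[mu]_(x in E) (EFin \o g) x = \int[mu]_(x in E) (cst 0) x)%E.
    move=> Eab mE; rewrite integral0 -(int_measurable h mE).
    by congr integral; apply/esym/setIidl.
  move=> /(_ h0); apply: filterS => x hx _ xab.
  by have := hx xab; case.
pose Q k x := if unpickle k is Some pq then P pq x else True.
have hQ k : {ae mu, forall x, Q k x}.
  by rewrite /Q; case: unpickle => [pq|]; [exact: hP|exact: aeW].
have := ae_foralln hQ; apply: filterS => x Qx Dx.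
have := Dx; rewrite {1}(open_cbox_bigcup oD) => -[pq _ [h1 h2]].
by have := Qx (pickle pq); rewrite /Q pickleK => /(_ h1 h2).
Qed.

End fundamental_lemma.

Section fundamental_lemma_st.
Variables (R : realType) (n : nat).
Local Notation X := ('rV[R]_n * measurableTypeR R)%type.
Local Notation X' := ('rV[R]_n * R)%type.
Variables (D : set X) (oD : open (D : set X')) (mD : measurable D) (g : X -> R).
Hypothesis gi : (lebesgue_st R n).-integrable D (EFin \o g).
Hypothesis g0 : forall phi, test_function (D : set X') phi ->
  \int[lebesgue_st R n]_(z in D) (g z * phi z) = 0.

Lemma rV_snoc_continuous : continuous (@rV_snoc R n : X' -> 'rV[R]_n.+1).
Proof.
move=> [x t]; apply/(@cvg_ballP _ _ _ (nbhs ((x, t) : X'))) => e e0.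
have : \forall z \near ((x, t) : X'), ball ((x, t) : X') e z by exact: nbhsx_ballx.
apply: filterS => -[y s] [/= [_ hx] ht]; split => // j k; rewrite !mxE.
case: unliftP => [i _|_] //=.
Qed.

Lemma measurable_unsnoc : measurable_fun setT (@unsnoc R n).
Proof.
apply/measurable_fun_pairP; split; last exact: measurable_rV_coord.
apply/measurable_fun_rVP => i; under eq_fun do rewrite /= mxE.
exact: measurable_rV_coord.
Qed.

(** The product with the time axis is identified with row vectors having one
    more coordinate. *)
Lemma fundamental_lemma_st : {ae lebesgue_st R n, forall z, D z -> g z = 0}.
Proof.
pose mu1 := lebesgue_rV R n.+1.
pose D' : set 'rV[R]_n.+1 := @unsnoc R n @^-1` D.
have oD' : open D' by move/continuousP : (@unsnoc_continuous R n); exact.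
have mD' : measurable D' by exact: open_measurable_rV.
have mg : measurable_fun D g by have /measurable_int/measurable_EFinP := gi.
pose G : X -> R := g \_ D.
have mG : measurable_fun setT G := (measurable_restrictT g mD).1 mg.
pose f x := G (unsnoc x).
have mf : measurable_fun setT f by exact: (measurableT_comp mG measurable_unsnoc).
have preD : @rV_snoc R n @^-1` D' = D.
  by apply/seteqP; split => z; rewrite /D' /= rV_snocK.
have fsnoc : f \o @rV_snoc R n = G.
  by apply/funext => z; rewrite /f /= rV_snocK.
have Gi : (lebesgue_st R n).-integrable D (EFin \o G).
  apply: eq_integrable gi => // z Dz /=; by rewrite /G /patch Dz.
have msn := @measurable_rV_snoc R n.
have Gi' : (lebesgue_st R n).-integrable (@rV_snoc R n @^-1` D')
    ((EFin \o f) \o @rV_snoc R n).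
  by rewrite preD -compA fsnoc.
have fi : mu1.-integrable D' (EFin \o f).
  exact: (@integrable_pushforward _ _ _ _ _ _ msn (lebesgue_st R n) _ _
    ((measurable_EFinP _ _).2 mf) Gi' mD').
have ctr (h : 'rV[R]_n.+1 -> R) : measurable_fun setT h ->
    (lebesgue_st R n).-integrable D (EFin \o (h \o @rV_snoc R n)) ->
    \int[mu1]_(x in D') h x = \int[lebesgue_st R n]_(z in D) h (rV_snoc z).
  move=> mh hi; congr fine.
  rewrite [LHS](@integral_pushforward _ _ _ _ _ _ msn (lebesgue_st R n) _ (EFin \o h)) ?preD//.
  exact/measurable_EFinP.
have f0 phi : test_function D' phi -> \int[mu1]_(x in D') (f x * phi x) = 0.
  move=> tphi; have [sphi cphi phiD'] := tphi.
  have mphi := test_function_measurable tphi.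
  have tphi' : test_function (D : set X') (phi \o @rV_snoc R n).
    have KD : (@unsnoc R n @` closure [set x | phi x != 0]) `<=` D.
      by move=> _ [x + <-] => /phiD'.
    have cK : compact (@unsnoc R n @` closure [set x | phi x != 0] : set X').
      apply: continuous_compact => //; apply: continuous_subspaceT.
      exact: unsnoc_continuous.
    have [|h1 h2] := @closure_sub_compact R X' [set z | phi (rV_snoc z) != 0] _ cK.
      move=> z /= hz; exists (rV_snoc z); last by rewrite rV_snocK.
      exact: subset_closure.
    split; [|exact: h2|exact: subset_trans h1 KD].
    move=> k; apply: (@Ck_affine R X' _ k (@rV_snoc R n) (@rV_snoc R n)).
    - exact: rV_snoc_continuous.
    - move=> h [x1 t1] [x2 t2]; apply/rowP => j; rewrite !mxE.
      by case: unliftP => [i _|_] //=; rewrite !mxE.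
    - exact: sphi.
  have [C C0 hC] := test_function_bounded tphi.
  rewrite ctr.
  + rewrite -[RHS](g0 tphi'); apply: eq_Rintegral => z Dz /=.
    by rewrite /f rV_snocK /G /patch Dz.
  + exact: measurable_funM.
  + have Ci : (lebesgue_st R n).-integrable D (EFin \o (fun z => C * G z)).
      exact: integrableEFinZ.
    apply: (le_integrable mD _ _ Ci).
      apply/measurable_EFinP; apply: measurable_funTS.
      apply: measurableT_comp => //; exact: measurable_funM.
    move=> z Dz /=; rewrite /f rV_snocK lee_fin !normrM mulrC ler_wpM2r//.
    by rewrite (gtr0_norm C0).
have := fundamental_lemma oD' fi f0.
move=> [A [mA A0 DA]]; exists (@rV_snoc R n @^-1` A); split => //.
  by rewrite -[X in measurable X]setTI; exact: msn.
move=> z hz; apply: DA => h; apply: hz => Dz.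
have := h; rewrite /D' /f /= rV_snocK => /(_ Dz); by rewrite /G /patch mem_set.
Qed.

End fundamental_lemma_st.

(** * Weak gradients and Friedrichs' inequality for test functions *)

Section integral_of_derivative.
Variable R : realType.

Lemma continuous_pairl (V W : normedModType R) (t : W) :
  continuous (fun x : V => (x, t)).
Proof.
move=> x; apply: (@cvg_pair _ _ _ (nbhs x) _ _ _ (nbhs_filter _) (nbhs_filter _)).
  exact: cvg_id.
exact: cvg_cst.
Qed.

Lemma continuous_pairr (V W : normedModType R) (x : V) :
  continuous (fun t : W => (x, t)).
Proof.
move=> t; apply: (@cvg_pair _ _ _ (nbhs t) _ _ _ (nbhs_filter _) (nbhs_filter _)).
  exact: cvg_cst.
exact: cvg_id.
Qed.

Lemma test_function_comp (V W : normedModType R) (D : set V) (phi : W -> R)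
    (A : V -> W) (B : V -> W) (p : W -> V) : test_function setT phi ->
  continuous A -> (forall h v x, A (h *: v + x) = h *: B v + A x) ->
  continuous p -> cancel A p -> test_function setT (phi \o A).
Proof.
move=> [sphi cphi _] cA AB cp Ap.
have cK : compact (p @` closure [set x | phi x != 0]).
  by apply: continuous_compact => //; exact: continuous_subspaceT.
have [|h1 h2] := @closure_sub_compact _ _ [set x | (phi \o A) x != 0] _ cK.
  move=> x /= hx; exists (A x); last exact: Ap.
  exact: subset_closure.
split; [|exact: h2|by []].
by move=> k; apply: Ck_affine => //; exact: sphi.
Qed.

(** Fundamental theorem of calculus on an interval that contains the
    support. *)
Lemma integral_deriveR (psi : R -> R) : test_function setT psi ->
  \int[lebesgue_measure]_x 'D_1 psi x = 0.
Proof.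
move=> tpsi; have [spsi cpsi _] := tpsi.
have [M [_ hM]] := compact_bounded cpsi.
pose m := `|M| + 1.
have m0 : 0 < m by rewrite /m ltr_wpDl.
have out x : m <= `|x| -> psi x = 0.
  move=> mx; apply: contrapT => /eqP p0.
  have Mh : M < `|M| + 2^-1 by rewrite (le_lt_trans (ler_norm _))// ltrDl.
  have := hM _ Mh x (subset_closure (p0 : [set x | psi x != 0] x)) => /= h.
  by rewrite /m in mx; lra.
have outD x : m < `|x| -> 'D_1 psi x = 0.
  move=> mx; rewrite (@near_eq_derive _ _ _ psi (cst 0)) ?derive_cst//.
  have : \forall y \near x, m < `|y|.
    by apply: (cvgr_gt _ (@norm_continuous _ R^o x)).
  by apply: filterS => y my; rewrite out// ltW.
have d1 x : derivable psi x 1 by exact: smooth_derivable.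
have cD : continuous ('D_1 psi) by have [_ /(_ 1)[_]] := spsi 1%N; exact.
have cpsi0 : continuous psi := spsi 0%N.
have mm : - m < m by rewrite gtrN.
transitivity (\int[lebesgue_measure]_(x in `[- m, m]) 'D_1 psi x).
  rewrite [RHS]Rintegral_mkcond; apply: eq_Rintegral => x _.
  rewrite /patch; case: ifPn => // /negP xm; apply: outD.
  rewrite ltNge; apply/negP => h; apply: xm; rewrite inE/= in_itv/=.
  by rewrite -ler_norml.
rewrite /Rintegral (@continuous_FTC2 _ _ psi)//.
- by rewrite (out m) ?(out (- m)) ?normrN ?ger0_norm ?(ltW m0)//= subrr.
- exact: continuous_subspaceT.
- split.
  + by move=> x _; exact: d1.
  + by apply: cvg_at_right_filter; exact: cpsi0.
  + by apply: cvg_at_left_filter; exact: cpsi0.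
- by move=> x _; rewrite derive1E.
Qed.

Lemma test_function_integrable n (phi : 'rV[R]_n -> R) : test_function setT phi ->
  (lebesgue_rV R n).-integrable setT (EFin \o phi).
Proof.
move=> tphi; have [C C0 hC] := test_function_bounded tphi.
have mphi := test_function_measurable tphi.
have [_ cphi _] := tphi.
have [a [b hab]] := bounded_cbox (compact_bounded cphi).
have mc := measurable_cbox a b.
have ci : (lebesgue_rV R n).-integrable (cbox a b) (EFin \o (fun=> C)).
  by apply: integrableEFin_cst => //; exact: cbox_finite.
have pi : (lebesgue_rV R n).-integrable (cbox a b) (EFin \o phi).
  apply: (le_integrable mc _ _ ci).
    by apply/measurable_EFinP; exact: measurable_funTS.
  by move=> x _ /=; rewrite lee_fin (gtr0_norm C0).
move/(integrable_mkcond _ mc) : pi; apply: eq_integrable => // x _.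
rewrite /patch; case: ifPn => // /negP xab; rewrite /=.
congr EFin; apply: contrapT => /eqP p0; apply: xab; rewrite inE; apply: hab.
by apply: subset_closure => /=; rewrite eq_sym.
Qed.

Lemma integral_rVS n (f : 'rV[R]_n.+1 -> R) : measurable_fun setT f ->
  (lebesgue_rV R n.+1).-integrable setT (EFin \o f) ->
  (lebesgue_st R n).-integrable setT (EFin \o (f \o @rV_snoc R n)) /\
  \int[lebesgue_rV R n.+1]_x f x = \int[lebesgue_st R n]_z f (rV_snoc z).
Proof.
move=> mf /integrableP[mfi fi]; have msn := @measurable_rV_snoc R n.
have fi' : (lebesgue_st R n).-integrable setT (EFin \o (f \o @rV_snoc R n)).
  apply/integrableP; split.
    by apply/measurable_EFinP; exact: measurableT_comp.
  move: fi; rewrite [X in (X < _)%E -> _](@ge0_integral_pushforward _ _ _ _ _ _ msn (lebesgue_st R n))//.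
  exact: measurableT_comp.
split=> //; congr fine.
rewrite [LHS](@integral_pushforward _ _ _ _ _ _ msn (lebesgue_st R n) _ (EFin \o f))//.
Qed.

(** When the derivative is along the last coordinate, integrate along it first;
    otherwise freeze the last coordinate and use the induction hypothesis. *)
Lemma integral_derive n (i : 'I_n) (phi : 'rV[R]_n -> R) : test_function setT phi ->
  \int[lebesgue_rV R n]_x 'D_(delta_mx 0 i) phi x = 0.
Proof.
elim: n i phi => [[] //|n IH] i phi tphi.
have tD := test_function_derive (delta_mx 0 i) tphi.
have [fi ->] := integral_rVS (test_function_measurable tD) (test_function_integrable tD).
rewrite -setXTT in fi *.
have [_ [e1 e2]] := fubini_rect (lebesgue_rV_sigma_finite R n) measurableT measurableT fi.
case: (unliftP ord_max i) => [k ik|ik].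
  etransitivity; first exact: e2.
  transitivity (\int[lebesgue_measure]_(t in setT) (0 : R)); last first.
    by rewrite /Rintegral integral0.
  apply: eq_Rintegral => t _.
  pose A (x : 'rV[R]_n) : 'rV[R]_n.+1 := rV_snoc (x, t).
  have AB h (v x : 'rV[R]_n) : A (h *: v + x) = h *: rV_snoc (v, 0) + A x.
    apply/rowP => j; rewrite !mxE; case: unliftP => [l _|_] //=; rewrite ?mxE//.
    by rewrite mulr0 add0r.
  rewrite -[RHS](IH k (phi \o A)).
    apply: eq_Rintegral => x _; rewrite (derive_affine _ _ _ AB) /=.
    congr ('D_ _ phi _); apply/rowP => j; rewrite !mxE ik.
    case: unliftP => [l ->|->] /=; last by rewrite (negbTE (neq_lift _ _)).
    by rewrite mxE (inj_eq lift_inj).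
  apply: (@test_function_comp _ _ setT phi A (fun v => rV_snoc (v, 0))
    (fun y => (unsnoc y).1)) => //.
  - move=> x; apply: (@continuous_comp _ _ _ (fun x => (x, t)) (@rV_snoc R n)).
      exact: continuous_pairl.
    exact: rV_snoc_continuous.
  - move=> x; apply: (@continuous_comp _ _ _ (@unsnoc R n) fst).
      exact: unsnoc_continuous.
    exact: cvg_fst.
  - by move=> x; rewrite /A rV_snocK.
etransitivity; first exact: e1.
transitivity (\int[lebesgue_rV R n]_(x in setT) (0 : R)); last first.
  by rewrite /Rintegral integral0.
apply: eq_Rintegral => x _.
pose A (t : R) : 'rV[R]_n.+1 := rV_snoc (x, t).
have AB (h v t : R) : A (h *: v + t) = h *: rV_snoc (0, v) + A t.
  apply/rowP => j; rewrite !mxE; case: unliftP => [l _|_] //=.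
  by rewrite !mxE mulr0 add0r.
rewrite -[RHS](@integral_deriveR (phi \o A)).
  apply: eq_Rintegral => t _; rewrite (derive_affine _ _ _ AB) /=.
  congr ('D_ _ phi _); apply/rowP => j; rewrite !mxE ik.
  case: unliftP => [l ->|->] /=; last by rewrite eqxx.
  by rewrite mxE eq_sym (negbTE (neq_lift _ _)).
apply: (@test_function_comp _ _ setT phi A (fun v => rV_snoc (0, v))
  (fun y => (unsnoc y).2)) => //.
- move=> t; apply: (@continuous_comp _ _ _ (fun t => (x, t)) (@rV_snoc R n)).
    exact: continuous_pairr.
  exact: rV_snoc_continuous.
- move=> y; exact: coord_continuous.
- by move=> t; rewrite /A rV_snocK.
Qed.

End integral_of_derivative.

Section gradient_Omega.
Variables (R : realType) (n : nat) (Omega : set 'rV[R]_n).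
Local Notation mu := (lebesgue_rV R n).
Hypotheses (oO : open Omega) (bO : bounded_set Omega).

Lemma measurable_Omega : measurable Omega. Proof. exact: open_measurable_rV. Qed.
Local Notation mO := measurable_Omega.

Lemma finite_Omega : (mu Omega < +oo)%E.
Proof. by apply: bounded_finite => //; exact: mO. Qed.

Lemma L2_integrable (f : 'rV[R]_n -> R) : L2 mu Omega f ->
  mu.-integrable Omega (EFin \o f).
Proof.
move=> fL; have c1 : L2 mu Omega (fun=> 1 : R).
  apply: (L2_bounded mO (C := 1) finite_Omega); first exact: measurable_cst.
  by move=> x _; rewrite normr1.
have := L2M_integrable mO fL c1; apply: eq_integrable; first exact: mO.
by move=> x _ /=; rewrite mulr1.
Qed.

Lemma test_functionT (V : normedModType R) (D : set V) phi :
  test_function D phi -> test_function setT phi.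
Proof. by case=> *; split. Qed.

Lemma test_function_L2 phi : test_function Omega phi -> L2 mu Omega phi.
Proof.
move=> tphi; have [C C0 hC] := test_function_bounded tphi.
apply: (L2_bounded mO finite_Omega _ (fun x _ => hC x)).
by apply: measurable_funTS; exact: test_function_measurable tphi.
Qed.

Lemma cgrad_L2 phi i : test_function Omega phi ->
  L2 mu Omega (fun x => cgrad phi x 0 i).
Proof.
move=> tphi; under [X in L2 _ _ X]eq_fun do rewrite mxE.
exact: test_function_L2 (test_function_derive (delta_mx 0 i) tphi).
Qed.

(** The derivative of the product of two test functions integrates to 0. *)
Lemma is_grad_cgrad phi : test_function Omega phi -> is_grad Omega phi (cgrad phi).
Proof.
move=> tphi psi tpsi i; pose v : 'rV[R]_n := delta_mx 0 i.
have tp : test_function Omega (fun x => phi x * psi x).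
  by apply: test_functionM_smooth => //; case: tpsi.
have tD := test_function_derive v tp.
have dphi x : derivable phi x v.
  by apply: smooth_derivable; case: tphi.
have dpsi x : derivable psi x v.
  by apply: smooth_derivable; case: tpsi.
have DE x : 'D_v (fun x => phi x * psi x) x = phi x * cgrad psi x 0 i + cgrad phi x 0 i * psi x.
  by rewrite deriveM// !mxE /GRing.scale/=; congr (_ + _); rewrite mulrC.
have := integral_derive i (test_functionT tp).
rewrite (_ : Rintegral _ _ _ = \int[mu]_(x in Omega) 'D_v (fun x => phi x * psi x) x); last first.
  rewrite [RHS]Rintegral_mkcond; apply: eq_Rintegral => x _.
  rewrite /patch; case: ifPn => // /negP xO; apply: test_function_out tD _.
  by move/mem_set.
under eq_Rintegral do rewrite DE.
rewrite RintegralD; [|exact: mO|..].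
- by move/eqP; rewrite addr_eq0 => /eqP.
- by apply: (L2M_integrable mO); [exact: test_function_L2|exact: cgrad_L2].
- by apply: (L2M_integrable mO); [exact: cgrad_L2|exact: test_function_L2].
Qed.

Lemma is_grad_unique w (g1 g2 : 'rV[R]_n -> 'rV[R]_n) : L2 mu Omega w ->
  (forall i, L2 mu Omega (fun x => g1 x 0 i)) ->
  (forall i, L2 mu Omega (fun x => g2 x 0 i)) ->
  is_grad Omega w g1 -> is_grad Omega w g2 ->
  {ae mu, forall x, Omega x -> g1 x = g2 x}.
Proof.
move=> wL L1 L2' h1 h2.
have h i : {ae mu, forall x, Omega x -> g1 x 0 i - g2 x 0 i = 0}.
  apply: fundamental_lemma => // [|phi tphi].
    by apply: L2_integrable; apply: (L2B mO).
  have phiL := test_function_L2 tphi.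
  under eq_Rintegral do rewrite mulrBl.
  rewrite RintegralB; [|exact: mO|exact: (L2M_integrable mO)..].
  by have := h1 _ tphi i; rewrite h2// => /oppr_inj ->; rewrite subrr.
have : {ae mu, forall x i, Omega x -> g1 x 0 i - g2 x 0 i = 0}.
  exact: filter_forall.
apply: filterS => x hx Ox; apply/rowP => i; apply/eqP.
by rewrite -subr_eq0 hx.
Qed.

Lemma gradP w : H1 Omega w -> L2v mu Omega (grad Omega w) /\ is_grad Omega w (grad Omega w).
Proof.
move=> [wL [g gP]].
exact: (@xgetPex _ (fun=> 0) [set g | L2v mu Omega g /\ is_grad Omega w g] (ex_intro _ g gP)).
Qed.

Variable CF : R.
Hypothesis friedrichs : forall w, H10 Omega w ->
  (L2norm mu Omega w <= CF%:E * L2vnorm mu Omega (grad Omega w))%E.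

(** A test function is in [H10], as the limit of a constant sequence, and its
    weak gradient is its classical one by uniqueness. *)
Lemma friedrichs_test phi : 0 < CF -> test_function Omega phi ->
  sqn mu Omega phi <= CF ^+ 2 * sqn mu Omega (fun x => enorm (cgrad phi x)).
Proof.
move=> CF0 tphi; have phiL := test_function_L2 tphi.
have gL : forall i, L2 mu Omega (fun x => cgrad phi x 0 i) by move=> i; exact: cgrad_L2.
have gLv : L2v mu Omega (cgrad phi) by exact: (L2vP mu mO _).2 gL.
have H1phi : H1 Omega phi.
  by split => //; exists (cgrad phi); split => //; exact: is_grad_cgrad.
have [Lg Gg] := gradP H1phi.
have Lgi := (L2vP mu mO _).1 Lg.
have gradE : {ae mu, forall x, Omega x -> grad Omega phi x = cgrad phi x}.
  by apply: (is_grad_unique phiL) => //; exact: is_grad_cgrad.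
have nE : sqn mu Omega (fun x => enorm (grad Omega phi x)) =
          sqn mu Omega (fun x => enorm (cgrad phi x)).
  apply: ae_eq_sqn; [exact: mO|by have [] := L2_enorm mO Lgi|by have [] := L2_enorm mO gL|].
  by apply: filterS gradE => x hx /hx ->.
have H10phi : H10 Omega phi.
  split => //; exists (fun=> phi); split => //.
    apply/L2norm_cvg0P => e e0; apply: nearW => k.
    by rewrite integral0_eq ?lte_fin// => x _; rewrite subrr expr0n.
  apply/L2norm_cvg0P => e e0; apply: nearW => k.
  rewrite (ae_eq_integral (cst 0%E)) ?integral0//.
  - exact: mO.
  - apply/measurable_EFinP; apply: measurable_funX; apply: measurable_enorm => i.
    under eq_fun do rewrite rowBE.
    by apply: measurable_funB; [have [] := Lgi i|have [] := gL i].
  - apply: filterS gradE => x hx /hx ->; rewrite /= subrr enorm_sq.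
    by congr EFin; rewrite /dotv big1// => i _; rewrite mxE mul0r.
have := friedrichs H10phi.
rewrite (L2norm_sqrt mO phiL) /L2vnorm (L2norm_sqrt mO (L2_enorm mO Lgi)) nE -EFinM lee_fin.
move=> h; rewrite -[leLHS]sqr_sqrtr ?sqn_ge0// -[X in _ <= _ * X]sqr_sqrtr ?sqn_ge0//.
by rewrite -exprMn ler_pXn2r// nnegrE ?mulr_ge0 ?sqrtr_ge0// ltW.
Qed.

End gradient_Omega.

(** * Functions on the space-time cylinder *)

Section space_time.
Variables (R : realType) (n : nat) (Omega : set 'rV[R]_n) (T : R).
Local Notation X := ('rV[R]_n * measurableTypeR R)%type.
Local Notation X' := ('rV[R]_n * R)%type.
Local Notation mu := (lebesgue_rV R n).
Local Notation leb := (@lebesgue_measure R).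
Local Notation st := (lebesgue_st R n).
Local Notation QT := (QT Omega T).
Hypotheses (oO : open Omega) (bO : bounded_set Omega).

Let mO := measurable_Omega oO.

Lemma measurable_QT : measurable (QT : set X).
Proof. by apply: measurableX; [exact: mO|exact: measurable_itv]. Qed.
Local Notation mQ := measurable_QT.

Lemma finite_QT : (st QT < +oo)%E.
Proof.
rewrite /lebesgue_st /= /Defs.QT product_measure1E//.
rewrite lte_mul_pinfty//.
  by rewrite ge0_fin_numE// finite_Omega.
rewrite [X in (X < _)%E](_ : _ = lebesgue_measure `]0, T[%classic)//.
by rewrite lebesgue_measure_itv/=; case: ifP; rewrite -?EFinB ltry.
Qed.

Lemma open_QT : open (QT : set X').
Proof.
rewrite (_ : QT = (fst @^-1` Omega) `&` (snd @^-1` `]0, T[%classic)); last by [].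
apply: openI; apply: open_comp => //; try exact: interval_open.
- by move=> z _; exact: cvg_fst.
- by move=> z _; exact: cvg_snd.
Qed.

Lemma L2_integrable_QT (f : X -> R) : L2 st QT f -> st.-integrable QT (EFin \o f).
Proof.
move=> fL; have c1 : L2 st QT (fun=> 1 : R).
  apply: (L2_bounded mQ (C := 1) finite_QT); first exact: measurable_cst.
  by move=> x _; rewrite normr1.
have := L2M_integrable mQ fL c1; apply: eq_integrable; first exact: mQ.
by move=> x _ /=; rewrite mulr1.
Qed.

Lemma smooth_measurable_QT (phi : X -> R) : smooth (phi : X' -> R) ->
  measurable_fun setT phi.
Proof. by move=> s; apply: continuous_measurable_st; exact: (s 0%N). Qed.

Lemma test_function_L2_QT (phi : X -> R) : test_function (QT : set X') phi -> L2 st QT phi.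
Proof.
move=> tphi; have [C C0 hC] := test_function_bounded tphi.
apply: (L2_bounded mQ finite_QT _ (fun x _ => hC x)).
by apply: measurable_funTS; apply: smooth_measurable_QT; case: tphi.
Qed.

Lemma is_gradx_unique w (g1 g2 : X -> 'rV[R]_n) :
  (forall i, L2 st QT (fun x => g1 x 0 i)) ->
  (forall i, L2 st QT (fun x => g2 x 0 i)) ->
  is_gradx Omega T w g1 -> is_gradx Omega T w g2 ->
  {ae st, forall x, QT x -> g1 x = g2 x}.
Proof.
move=> L1 L2' h1 h2.
have h i : {ae st, forall x, QT x -> g1 x 0 i - g2 x 0 i = 0}.
  apply: fundamental_lemma_st; [exact: open_QT|exact: mQ|..].
    by apply: L2_integrable_QT; apply: (L2B mQ).
  move=> phi tphi; have phiL := test_function_L2_QT tphi.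
  under eq_Rintegral do rewrite mulrBl.
  rewrite RintegralB; [|exact: mQ|exact: (L2M_integrable mQ)..].
  by have := h1 _ tphi i; rewrite h2// => /oppr_inj ->; rewrite subrr.
have : {ae st, forall x i, QT x -> g1 x 0 i - g2 x 0 i = 0}.
  exact: filter_forall.
apply: filterS => x hx Ox; apply/rowP => i; apply/eqP.
by rewrite -subr_eq0 hx.
Qed.

Lemma gradxP w : H1_x Omega T w ->
  L2v st QT (gradx Omega T w) /\ is_gradx Omega T w (gradx Omega T w).
Proof.
move=> [wL [g gP]].
exact: (@xgetPex _ (fun=> 0) [set g | L2v st QT g /\ is_gradx Omega T w g] (ex_intro _ g gP)).
Qed.

Lemma gradx_L2 w i : H1_x Omega T w -> L2 st QT (fun z => gradx Omega T w z 0 i).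
Proof. by move=> /gradxP[+ _] => /(L2vP st mQ). Qed.

Lemma dtP w : (exists g, L2 st QT g /\ is_dt Omega T w g) ->
  L2 st QT (dt Omega T w) /\ is_dt Omega T w (dt Omega T w).
Proof.
move=> [g gP].
exact: (@xgetPex _ (fun=> 0) [set g | L2 st QT g /\ is_dt Omega T w g] (ex_intro _ g gP)).
Qed.

Lemma divxP rho : (exists g, is_divx Omega T rho g) -> is_divx Omega T rho (divx Omega T rho).
Proof.
move=> [g gP].
exact: (@xgetPex _ (fun=> 0) [set g | is_divx Omega T rho g] (ex_intro _ g gP)).
Qed.

(** functions admissible in the definition of [zero_lateral] *)
Definition lateral_test (phi : X -> R) : Prop :=
  smooth (phi : X' -> R) /\
  exists K : set 'rV[R]_n, [/\ compact K, K `<=` Omega &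
    forall x t, ~ K x -> phi (x, t) = 0].

Lemma lateral_test_slice phi t : lateral_test phi ->
  test_function Omega (fun x => phi (x, t)) /\
  forall x, cgrad (fun x => phi (x, t)) x = cgradx phi (x, t).
Proof.
move=> [sphi [K [cK KO Kphi]]].
have AB (h : R) (v x : 'rV[R]_n) : ((h *: v + x, t) : X') = h *: ((v, 0) : X') + (x, t).
  by congr pair; rewrite /= scaler0 add0r.
split.
  have [|h1 h2] := @closure_sub_compact R 'rV[R]_n [set x | phi (x, t) != 0] _ cK.
    by move=> x /= /eqP p0; apply: contrapT => /Kphi.
  split; [|exact: h2|exact: subset_trans h1 KO].
  move=> k; apply: (@Ck_affine _ _ X' k (fun x => (x, t)) (fun v => (v, 0)) phi) => //.
  exact: continuous_pairl.
move=> x; apply/rowP => i; rewrite !mxE.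
exact: (@derive_affine _ _ X' (fun x => (x, t)) (fun v => (v, 0)) phi).
Qed.

Lemma measurable_cgradx phi i : lateral_test phi ->
  measurable_fun setT (fun z => cgradx phi z 0 i).
Proof.
move=> [sphi _]; under eq_fun do rewrite mxE.
apply: continuous_measurable_st.
have [_ /(_ ((delta_mx 0 i, 0) : X'))[_]] := sphi 1%N; exact.
Qed.

Variable CF : R.
Hypothesis friedrichs : forall w, H10 Omega w ->
  (L2norm mu Omega w <= CF%:E * L2vnorm mu Omega (grad Omega w))%E.

(** Friedrichs' inequality on every time slice, integrated in time. *)
Lemma poincare_test phi : 0 < CF -> lateral_test phi ->
  (\int[st]_(z in QT) (phi z ^+ 2)%:E <=
  (CF ^+ 2)%:E * \int[st]_(z in QT) (enorm (cgradx phi z) ^+ 2)%:E)%E.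
Proof.
move=> CF0 lphi; have mphi : measurable_fun setT phi by apply: smooth_measurable_QT; case: lphi.
have m1 : measurable_fun QT (fun z => (phi z ^+ 2)%:E).
  by apply/measurable_EFinP; apply: measurable_funX; exact: measurable_funTS.
have m2 : measurable_fun QT (fun z => (enorm (cgradx phi z) ^+ 2)%:E).
  apply/measurable_EFinP; apply: measurable_funX; apply: measurable_enorm => i.
  by apply: measurable_funTS; exact: measurable_cgradx.
have mT : measurable `]0, T[%classic by exact: measurable_itv.
have [_ mB1 _ e1] := tonelli_rect (lebesgue_rV_sigma_finite R n) leb mO mT m1
  (fun z _ => sqr_ge0 _).
have [_ mB2 _ e2] := tonelli_rect (lebesgue_rV_sigma_finite R n) leb mO mT m2
  (fun z _ => sqr_ge0 _).
rewrite [leLHS]e1 [X in (_ <= _ * X)%E]e2 -ge0_integralZl//; last 2 first.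
- by move=> t _; apply: integral_ge0 => x _; rewrite lee_fin sqr_ge0.
- by rewrite lee_fin sqr_ge0.
apply: ge0_le_integral => //.
- by move=> t _; apply: integral_ge0 => x _; rewrite lee_fin sqr_ge0.
- by apply: measurable_funeM.
move=> t _; have [tphi gE] := lateral_test_slice t lphi.
have := friedrichs_test oO bO friedrichs CF0 tphi.
have pL := test_function_L2 oO bO tphi.
have gL : L2 mu Omega (fun x => enorm (cgrad (fun x => phi (x, t)) x)).
  by apply: L2_enorm => // i; exact: cgrad_L2.
rewrite -lee_fin EFinM /sqn /Rintegral !fineK.
- by under [X in (_ <= _ * X)%E -> _]eq_integral do rewrite gE.
- by apply: integrable_fin_num => //; exact: L2_sq_integrable.
- by apply: integrable_fin_num => //; exact: L2_sq_integrable.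
Qed.

End space_time.

(** * Fourier coefficients over a period *)

Section Fourier.
Variables (R : realType) (T : R).
Hypothesis T0 : 0 < T.
Local Notation leb := (@lebesgue_measure R).
Local Notation I := (`]0, T[%classic : set (measurableTypeR R)).
Local Notation w := (omega T).
Implicit Types f g h : measurableTypeR R -> R.

Lemma omega_gt0 : 0 < w.
Proof. by rewrite /omega divr_gt0// mulr_gt0// pi_gt0. Qed.

Lemma measurable_I : measurable I. Proof. exact: measurable_itv. Qed.
Local Notation mI := measurable_I.

Lemma leb_I : leb I = T%:E.
Proof.
transitivity (lebesgue_measure (`]0, T[%classic : set R)) => //.
by rewrite lebesgue_measure_itv/= lte_fin T0 -EFinB subr0.
Qed.

Lemma finite_I : (leb I < +oo)%E. Proof. by rewrite leb_I ltry. Qed.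

Lemma bounded_L2_I f C : measurable_fun I f -> (forall x, I x -> `|f x| <= C) ->
  L2 leb I f.
Proof. by apply: L2_bounded; [exact: mI|exact: finite_I]. Qed.

Lemma L2_cst_I (c : R) : L2 leb I (fun=> c).
Proof. by apply: (@bounded_L2_I _ `|c|) => //; exact: measurable_cst. Qed.

Lemma L2_integrable_I f : L2 leb I f -> leb.-integrable I (EFin \o f).
Proof.
move=> fL; have := L2M_integrable mI fL (L2_cst_I 1); apply: eq_integrable; first exact: mI.
by move=> x _ /=; rewrite mulr1.
Qed.

Definition fc (k : nat) (t : measurableTypeR R) : R := cos (k%:R * w * t).
Definition fs (k : nat) (t : measurableTypeR R) : R := sin (k%:R * w * t).

Lemma continuous_cosM (c : R) : continuous (fun t : R => cos (c * t)).
Proof.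
move=> t; apply: continuous_comp; last exact: continuous_cos.
exact: mulrl_continuous.
Qed.

Lemma continuous_sinM (c : R) : continuous (fun t : R => sin (c * t)).
Proof.
move=> t; apply: continuous_comp; last exact: continuous_sin.
exact: mulrl_continuous.
Qed.

Lemma L2_cos (c : R) : L2 leb I (fun t => cos (c * t)).
Proof.
apply: (@bounded_L2_I _ 1); last by move=> x _; exact: cos_max.
by apply: measurable_funTS; apply: continuous_measurable_fun; exact: continuous_cosM.
Qed.

Lemma L2_sin (c : R) : L2 leb I (fun t => sin (c * t)).
Proof.
apply: (@bounded_L2_I _ 1); last by move=> x _; exact: sin_max.
by apply: measurable_funTS; apply: continuous_measurable_fun; exact: continuous_sinM.
Qed.

Lemma L2_fc k : L2 leb I (fc k). Proof. exact: L2_cos. Qed.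

Lemma L2_fs k : L2 leb I (fs k). Proof. exact: L2_sin. Qed.

Lemma period k : cos (k%:R * w * T) = 1 /\ sin (k%:R * w * T) = 0.
Proof.
have E : k%:R * w * T = 0 + (pi *+ 2) *+ k.
  rewrite add0r /omega -[pi *+ 2]mulr_natl -[RHS]mulr_natl.
    by field; rewrite gt_eqF.
by rewrite E (periodicn (@cosD2pi R)) (periodicn (@sinD2pi R)) cos0 sin0.
Qed.

Lemma integral_I (F f : R -> R) : continuous f -> (forall x : R, is_derive x 1 F (f x)) ->
  \int[leb]_(t in I) f t = F T - F 0.
Proof.
move=> cf dF.
have fi : leb.-integrable `[0, T]%classic (EFin \o f).
  apply: continuous_compact_integrable; first exact: segment_compact.
  exact: continuous_subspaceT.
have cF : continuous F.
  move=> x; have [/derivable1_diffP/differentiable_continuous + _] := dF x; exact.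
rewrite Rintegral_itv_bndo_bndc; last first.
  apply: integrableS fi; [exact: measurable_itv|exact: measurable_itv|].
  by move=> x; rewrite /= !in_itv/= => /andP[/ltW -> /ltW ->].
rewrite Rintegral_itv_obnd_cbnd; last first.
  apply: integrableS fi; [exact: measurable_itv|exact: measurable_itv|].
  by move=> x; rewrite /= !in_itv/= => /andP[/ltW -> ->].
rewrite /Rintegral (@continuous_FTC2 _ _ F)//.
- exact: continuous_subspaceT.
- split.
  + by move=> x _; have [] := dF x.
  + by apply: cvg_at_right_filter; exact: cF.
  + by apply: cvg_at_left_filter; exact: cF.
- by move=> x _; rewrite derive1E; have [_ ->] := dF x.
Qed.

Lemma integral_cos_sin (c : R) : c != 0 -> cos (c * T) = 1 -> sin (c * T) = 0 ->
  \int[leb]_(t in I) cos (c * t) = 0 /\ \int[leb]_(t in I) sin (c * t) = 0.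
Proof.
move=> c0 c1 s0; split.
  have D (x : R) : is_derive x 1 (fun t => 0 * cos (c * t) + c^-1 * sin (c * t)) (cos (c * x)).
    apply: is_derive_eq (is_derive_trig _ _ _ _) _.
    by rewrite mulVf// mul0r oppr0 mul0r addr0 mul1r.
  rewrite (integral_I (@continuous_cosM c) D).
  by rewrite s0 !mulr0 sin0 !mul0r mulr0 subrr.
have D (x : R) : is_derive x 1 (fun t => - c^-1 * cos (c * t) + 0 * sin (c * t)) (sin (c * x)).
  apply: is_derive_eq (is_derive_trig _ _ _ _) _.
  by rewrite !mul0r add0r (mulNr c^-1) mulVf// opprK mul1r.
by rewrite (integral_I (@continuous_sinM c) D) c1 mulr0 cos0 !mul0r subrr.
Qed.

(** Over a period the constant mode has squared norm [T] and the others [T / 2]: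
    with the common normalization by [2 / T], the constant mode has weight one
    half. *)
Definition kap (k : nat) : R := if k == 0%N then 2^-1 else 1.

Lemma kap_gt0 k : 0 < kap k. Proof. by rewrite /kap; case: ifP => _; lra. Qed.

(** These frequencies arise from the product-to-sum formulas. *)
Lemma integral_modes_pm (r : R) k l : (r = k%:R + l%:R \/ r = k%:R - l%:R) ->
  r != 0 -> \int[leb]_(t in I) cos (r * w * t) = 0 /\ \int[leb]_(t in I) sin (r * w * t) = 0.
Proof.
move=> rE r0; have [ck sk] := period k; have [cl sl] := period l.
have rw0 : r * w != 0 by rewrite mulf_neq0// gt_eqF// omega_gt0.
apply: (integral_cos_sin rw0).
  by case: rE => ->; rewrite mulrDl mulrDl ?mulNr ?cosB ?cosD ck cl sk sl; ring.
by case: rE => ->; rewrite mulrDl mulrDl ?mulNr ?sinB ?sinD ck cl sk sl; ring.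
Qed.

Let cint r := \int[leb]_(t in I) cos (r * w * t).
Let sint r := \int[leb]_(t in I) sin (r * w * t).

Let prod_sum (f g h : measurableTypeR R -> R) : L2 leb I f -> L2 leb I g ->
  (forall t, h t = 2^-1 * (f t + g t)) ->
  \int[leb]_(t in I) h t = 2^-1 * (\int[leb]_(t in I) f t + \int[leb]_(t in I) g t).
Proof.
move=> fL gL hE; under eq_Rintegral do rewrite hE.
rewrite RintegralZl//.
  by rewrite RintegralD//; exact: L2_integrable_I.
by apply: L2_integrable_I; exact: (L2D mI).
Qed.

Let cint0 : cint 0 = T.
Proof.
rewrite /cint; under eq_Rintegral do rewrite !mul0r cos0.
transitivity (1 * fine (leb I)); first by rewrite Rintegral_cst.
by rewrite leb_I mul1r.
Qed.

Let natDN (k l : nat) : (k != l)%N -> (k%:R - l%:R : R) != 0.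
Proof. by rewrite subr_eq0 eqr_nat. Qed.

Lemma fc_fc k l : \int[leb]_(t in I) (fc k t * fc l t) =
  if k == l then T / 2 / kap k else 0.
Proof.
rewrite (@prod_sum (fun t => cos ((k%:R + l%:R) * w * t)) (fun t => cos ((k%:R - l%:R) * w * t))
  _ (L2_cos _) (L2_cos _)); last first.
  move=> t; rewrite /fc 2!(mulrDl k%:R) 2!(mulrDl (k%:R * w)) !mulNr cosB cosD.
  by field.
rewrite -/(cint _) -/(cint (_ - _)).
case: eqP => [<-|/eqP kl].
  rewrite subrr cint0 /kap; case: eqP => [->|/eqP k0].
    by rewrite addr0 cint0; field.
  rewrite /cint (integral_modes_pm (or_introl erefl) _).1; first by field.
  by rewrite -natrD pnatr_eq0 addn_eq0 (negbTE k0).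
rewrite /cint (integral_modes_pm (or_intror erefl) (natDN kl)).1.
rewrite (integral_modes_pm (or_introl erefl) _).1; first by field.
rewrite -natrD pnatr_eq0 addn_eq0; apply: contra kl => /andP[/eqP -> /eqP ->].
by [].
Qed.

Lemma fs_fs k l : (0 < l)%N -> \int[leb]_(t in I) (fs k t * fs l t) =
  if k == l then T / 2 else 0.
Proof.
move=> l0.
rewrite (@prod_sum (fun t => cos ((k%:R - l%:R) * w * t)) (fun t => - cos ((k%:R + l%:R) * w * t))
  _ (L2_cos _) (L2N mI (L2_cos _))); last first.
  move=> t; rewrite /fs 2!(mulrDl k%:R) 2!(mulrDl (k%:R * w)) !mulNr cosB cosD.
  by field.
rewrite (_ : \int[leb]_(t in I) - cos _ = - cint (k%:R + l%:R)); last first.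
  under eq_Rintegral do rewrite -mulN1r.
  by rewrite (RintegralZl _ mI (L2_integrable_I (L2_cos _))) mulN1r.
rewrite -/(cint (_ - _)) {2}/cint (integral_modes_pm (or_introl erefl) _).1; last first.
  by rewrite -natrD pnatr_eq0 addn_eq0 negb_and (gtn_eqF l0) orbT.
case: eqP => [<-|/eqP kl].
  by rewrite subrr cint0; field.
by rewrite /cint (integral_modes_pm (or_intror erefl) (natDN kl)).1; field.
Qed.

Lemma fs_fc k l : \int[leb]_(t in I) (fs k t * fc l t) = 0.
Proof.
have sint0 r : (r = k%:R + l%:R \/ r = k%:R - l%:R) -> sint r = 0.
  move=> h; have [->|r0] := eqVneq r 0; last by rewrite /sint (integral_modes_pm h r0).2.
  rewrite /sint; under eq_Rintegral do rewrite !mul0r sin0.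
  by rewrite Rintegral_cst// mul0r.
rewrite (@prod_sum (fun t => sin ((k%:R + l%:R) * w * t)) (fun t => sin ((k%:R - l%:R) * w * t))
  _ (L2_sin _) (L2_sin _)); last first.
  move=> t; rewrite /fs /fc 2!(mulrDl k%:R) 2!(mulrDl (k%:R * w)) !mulNr sinB sinD.
  by field.
rewrite -/(sint _) -/(sint (_ - _)) sint0; last by left.
by rewrite sint0 ?addr0 ?mulr0//; right.
Qed.

Definition ac f k : R := 2 / T * \int[leb]_(t in I) (f t * fc k t).
Definition as_ f k : R := 2 / T * \int[leb]_(t in I) (f t * fs k t).

Definition trig N (a b : nat -> R) (t : measurableTypeR R) : R :=
  \sum_(k < N) (a k * fc k t + b k * fs k t).

(** Partial sum of order [N] of the Fourier series. *)
Definition fpart N f := trig N.+1 (fun k => kap k * ac f k) (fun k => kap k * as_ f k).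

(** Inner product of the partial Fourier sums of [f] and [h]. *)
Definition fenergy N f h : R :=
  T / 2 * \sum_(k < N.+1) kap k * (ac f k * ac h k + as_ f k * as_ h k).

Lemma L2_trig N a b : L2 leb I (trig N a b).
Proof.
rewrite /trig; apply: (@L2_sum _ _ _ _ _ mI _ (fun (k : 'I_N) t => a k * fc k t + b k * fs k t)).
move=> k; apply: (L2D mI); apply: (L2Z mI); [exact: L2_fc|exact: L2_fs].
Qed.

Lemma Rintegral_sum_ord N (F : nat -> measurableTypeR R -> R) :
  (forall k, leb.-integrable I (EFin \o F k)) ->
  \int[leb]_(t in I) (\sum_(k < N) F k t) = \sum_(k < N) \int[leb]_(t in I) F k t.
Proof.
move=> Fi; have [_] := Rintegral_sum_nat mI 0 N Fi.
by rewrite big_mkord => <-; apply: eq_Rintegral => t _; rewrite big_mkord.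
Qed.

Lemma integral_trig f N a b : L2 leb I f -> \int[leb]_(t in I) (f t * trig N a b t) =
  T / 2 * \sum_(k < N) (a k * ac f k + b k * as_ f k).
Proof.
move=> fL; under eq_Rintegral do rewrite mulr_sumr.
have fcI k : leb.-integrable I (EFin \o (fun t => f t * fc k t)).
  by apply: (L2M_integrable mI) => //; exact: L2_fc.
have fsI k : leb.-integrable I (EFin \o (fun t => f t * fs k t)).
  by apply: (L2M_integrable mI) => //; exact: L2_fs.
have E k t : f t * (a k * fc k t + b k * fs k t) =
    a k * (f t * fc k t) + b k * (f t * fs k t) by ring.
rewrite (Rintegral_sum_ord N (F := fun k t => f t * (a k * fc k t + b k * fs k t))); last first.
  move=> k; apply: (L2M_integrable mI) => //.
  by apply: (L2D mI); apply: (L2Z mI); [exact: L2_fc|exact: L2_fs].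
rewrite mulr_sumr; apply: eq_bigr => k _.
under eq_Rintegral do rewrite E.
rewrite RintegralD; [|exact: mI|exact: (integrableEFinZ mI)|exact: (integrableEFinZ mI)].
rewrite !RintegralZl//; try exact: mI.
by rewrite /ac /as_; field; rewrite gt_eqF.
Qed.

Lemma ac_trig N a b l : ac (trig N a b) l = if (l < N)%N then a l / kap l else 0.
Proof.
rewrite /ac; under eq_Rintegral do rewrite mulrC.
rewrite integral_trig; last exact: L2_fc.
have acfc k : ac (fc l) k = if k == l then (kap l)^-1 else 0.
  rewrite /ac fc_fc eq_sym; case: eqP => [_|_]; rewrite ?mulr0//.
  by field; rewrite !gt_eqF// kap_gt0.
have asfc k : as_ (fc l) k = 0.
  by rewrite /as_; under eq_Rintegral do rewrite mulrC; rewrite fs_fc mulr0.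
under eq_bigr => k _ do rewrite acfc asfc mulr0 addr0.
case: ltnP => lN.
  rewrite (bigD1 (Ordinal lN))//= eqxx big1 ?addr0.
    by field; rewrite !gt_eqF// kap_gt0.
  by move=> k /eqP kl; case: eqP => [kl'|_]; [case: kl; exact: val_inj|rewrite mulr0].
rewrite big1 ?mulr0// => k _; case: eqP => [kl|_]; last by rewrite mulr0.
by have := ltn_ord k; rewrite kl ltnNge lN.
Qed.

Lemma as_trig N a b l : (0 < l)%N -> as_ (trig N a b) l = if (l < N)%N then b l else 0.
Proof.
move=> l0; rewrite /as_; under eq_Rintegral do rewrite mulrC.
rewrite integral_trig; last exact: L2_fs.
have acfs k : ac (fs l) k = 0 by rewrite /ac fs_fc mulr0.
have asfs k : as_ (fs l) k = if k == l then 1 else 0.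
  rewrite /as_; under eq_Rintegral do rewrite mulrC.
  by rewrite fs_fs//; case: eqP => _; rewrite ?mulr0//; field; rewrite gt_eqF.
under eq_bigr => k _ do rewrite acfs asfs mulr0 add0r.
case: ltnP => lN.
  rewrite (bigD1 (Ordinal lN))//= eqxx big1 ?addr0.
    by field; rewrite !gt_eqF.
  by move=> k /eqP kl; case: eqP => [kl'|_]; [case: kl; exact: val_inj|rewrite mulr0].
rewrite big1 ?mulr0// => k _; case: eqP => [kl|_]; last by rewrite mulr0.
by have := ltn_ord k; rewrite kl ltnNge lN.
Qed.

Lemma as_0 f : as_ f 0 = 0.
Proof.
rewrite /as_ /fs; under eq_Rintegral do rewrite !mul0r sin0 mulr0.
by rewrite Rintegral_cst// mul0r mulr0.
Qed.

Lemma integral_fpart f N h : L2 leb I f -> L2 leb I h ->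
  \int[leb]_(t in I) (f t * fpart N h t) = fenergy N f h.
Proof.
move=> fL hL; rewrite /fpart integral_trig//; congr (_ * _).
by apply: eq_bigr => k _; ring.
Qed.

Lemma fpart_orth f N a b : L2 leb I f ->
  \int[leb]_(t in I) (fpart N f t * trig N.+1 a b t) = \int[leb]_(t in I) (f t * trig N.+1 a b t).
Proof.
move=> fL; rewrite !integral_trig//; last exact: L2_trig.
congr (_ * _); apply: eq_bigr => k _; congr (_ + _).
  by rewrite ac_trig ltn_ord; congr (_ * _); field; rewrite gt_eqF// kap_gt0.
case: (posnP k) => [->|k0]; first by rewrite !as_0.
by rewrite as_trig// ltn_ord /kap gtn_eqF ?mul1r.
Qed.

(** The partial Fourier sum of order [N] is an orthogonal projection, hence the
    best approximation by trigonometric polynomials of that order. *)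
Lemma fenergy_best f N a b : L2 leb I f ->
  sqn leb I f - fenergy N f f <= sqn leb I (fun t => f t - trig N.+1 a b t).
Proof.
move=> fL; have pL := L2_trig N.+1 a b; have PL : L2 leb I (fpart N f) by exact: L2_trig.
have E1 : sqn leb I (fun t => f t - trig N.+1 a b t) =
    sqn leb I f - 2 * \int[leb]_(t in I) (f t * trig N.+1 a b t) + sqn leb I (trig N.+1 a b).
  have := integral_sq_quad mI (-1) fL pL.
  rewrite (_ : (fun t => _ + -1 * _) = (fun t => f t - trig N.+1 a b t)); last first.
    by apply/funext => t; rewrite mulN1r.
  by move=> ->; ring.
have E2 : sqn leb I (fpart N f) = fenergy N f f.
  by rewrite -[RHS]integral_fpart// -[RHS]fpart_orth.
have := integral_sq_quad mI (-1) pL PL.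
have := sqn_ge0 leb I (fun t => trig N.+1 a b t + -1 * fpart N f t).
under [X in 2 * -1 * X]eq_Rintegral do rewrite mulrC.
rewrite fpart_orth// E1 E2; lra.
Qed.

Lemma fenergy_ge0 f N : 0 <= fenergy N f f.
Proof.
apply: mulr_ge0; first by rewrite divr_ge0// ltW.
apply: sumr_ge0 => k _; apply: mulr_ge0; first exact: ltW (kap_gt0 k).
by rewrite addr_ge0// -expr2 sqr_ge0.
Qed.

(** The squared distance from [f] to its partial sum is nonnegative. *)
Lemma bessel f N : L2 leb I f -> fenergy N f f <= sqn leb I f.
Proof.
move=> fL; have := fenergy_best N (fun k => kap k * ac f k) (fun k => kap k * as_ f k) fL.
have PL : L2 leb I (fpart N f) by exact: L2_trig.
have := integral_sq_quad mI (-1) fL PL.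
have := sqn_ge0 leb I (fun t => f t + -1 * fpart N f t).
have E2 : sqn leb I (fpart N f) = fenergy N f f.
  by rewrite -[RHS]integral_fpart// -[RHS]fpart_orth.
rewrite E2 integral_fpart//; lra.
Qed.

End Fourier.

(** * Density of trigonometric polynomials and Parseval's identity *)

Section clip.
Variable R : realType.
Implicit Types M x y : R.

(** Truncation at height [M]; in this form its Lipschitz bound is a case
    analysis on signs. *)
Definition clip M x : R := 2^-1 * (`|x + M| - `|x - M|).

Lemma clip_id M x : `|x| <= M -> clip M x = x.
Proof.
rewrite ler_norml /clip => /andP[h1 h2].
by rewrite ger0_norm; [rewrite ler0_norm; lra|lra].
Qed.

Lemma clip_le M x : 0 <= M -> `|clip M x| <= M.
Proof.
move=> M0; rewrite ler_norml /clip.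
by case: (ger0P (x + M)); case: (ger0P (x - M)); move=> ? ?; apply/andP; split; lra.
Qed.

Lemma clip_lip M x y : `|clip M x - clip M y| <= `|x - y|.
Proof.
rewrite ler_norml /clip.
by case: (ger0P (x + M)); case: (ger0P (x - M)); case: (ger0P (y + M));
  case: (ger0P (y - M)); case: (ger0P (x - y)); move=> *; apply/andP; split; lra.
Qed.

Lemma clip_cont M : continuous (clip M).
Proof.
move=> x; apply: cvgM; first exact: cvg_cst.
by apply: cvgB; apply: cvg_norm; apply: cvgD; try exact: cvg_cst; exact: cvg_id.
Qed.

End clip.

Section cosine_polynomials.
Variable R : realType.

Definition cospoly (f : R -> R) : Prop :=
  exists N (al : nat -> R), forall x, f x = \sum_(k < N) al k * cos (k%:R * x).

Lemma cospolyD f g : cospoly f -> cospoly g -> cospoly (fun x => f x + g x).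
Proof.
move=> [N [a fE]] [M [b gE]]; exists (maxn N M).
exists (fun k => (if (k < N)%N then a k else 0) + (if (k < M)%N then b k else 0)) => x.
under eq_bigr do rewrite mulrDl; rewrite big_split/= fE gE.
rewrite (big_ord_widen _ (fun k => a k * cos (k%:R * x)) (leq_maxl N M)).
rewrite (big_ord_widen _ (fun k => b k * cos (k%:R * x)) (leq_maxr N M)).
by rewrite big_mkcond [X in _ + X = _]big_mkcond; congr (_ + _); apply: eq_bigr => i _;
  case: ifP => _; rewrite ?mul0r.
Qed.

Lemma cospoly_mono k (c : R) : cospoly (fun x => c * cos (k%:R * x)).
Proof.
exists k.+1, (fun j => if j == k then c else 0) => x.
rewrite big_ord_recr/= eqxx big1 ?add0r// => i _.
by rewrite ltn_eqF ?mul0r.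
Qed.

Lemma cospoly_sum N (F : nat -> R -> R) : (forall k, cospoly (F k)) ->
  cospoly (fun x => \sum_(k < N) F k x).
Proof.
move=> h; elim: N => [|N IH].
  by exists 0%N, (fun=> 0) => x; rewrite !big_ord0.
under eq_fun do rewrite big_ord_recr/=; exact: cospolyD.
Qed.

(** Product-to-sum formula; the frequency [k - 1] is negative when [k = 0],
    whence the absolute value. *)
Lemma cospolyM f : cospoly f -> cospoly (fun x => f x * ((1 + cos x) / 2)).
Proof.
move=> [N [a fE]]; under eq_fun do rewrite fE mulr_suml.
apply: (@cospoly_sum N (fun k x => a k * cos (k%:R * x) * ((1 + cos x) / 2))) => k.
have E x : a k * cos (k%:R * x) * ((1 + cos x) / 2) =
    a k / 2 * cos (k%:R * x) + (a k / 4 * cos (k.+1%:R * x) + a k / 4 * cos (`|k%:R - 1| * x)).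
  have -> : cos (`|k%:R - 1 : R| * x) = cos (k%:R * x - x).
    rewrite -[LHS]cos_norm normrM normr_id -normrM cos_norm.
    by rewrite mulrBl mul1r.
  have -> : k.+1%:R * x = k%:R * x + x by rewrite -natr1 mulrDl mul1r.
  by rewrite cosB cosD; field.
under eq_fun do rewrite E.
have k1 : `|k%:R - 1 : R| = (if k is k'.+1 then k' else 1%N)%:R.
  case: k {E} => [|k]; first by rewrite sub0r normrN normr1.
  by rewrite -natr1 addrK normr_nat.
rewrite k1; apply: cospolyD; first exact: cospoly_mono.
by apply: cospolyD; exact: cospoly_mono.
Qed.

Lemma cospoly_kernel n : cospoly (fun x => ((1 + cos x) / 2) ^+ n).
Proof.
elim: n => [|n IH].
  exists 1%N, (fun=> 1) => x; by rewrite big_ord1 !mul0r cos0 mulr1.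
by under eq_fun do rewrite exprSr; exact: cospolyM.
Qed.

End cosine_polynomials.

Section trigonometric_density.
Variables (R : realType) (T : R).
Hypothesis T0 : 0 < T.
Local Notation leb := (@lebesgue_measure R).
Local Notation I := (`]0, T[%classic : set (measurableTypeR R)).
Local Notation w := (omega T).
Local Notation mI := (measurable_I T).
Implicit Types f g h : measurableTypeR R -> R.

(** Powers of [(1 + cos) / 2] are trigonometric polynomials that concentrate
    at the multiples of the period. *)
Definition kern n (x : R) : R := ((1 + cos (w * x)) / 2) ^+ n.

Lemma kern_ge0 n x : 0 <= kern n x.
Proof. by rewrite exprn_ge0// divr_ge0//; have := cos_geN1 (w * x); lra. Qed.

Lemma kern_le1 n x : kern n x <= 1.
Proof.
rewrite exprn_ile1//; have := cos_geN1 (w * x); have := cos_le1 (w * x); lra.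
Qed.

Lemma kern_continuous n : continuous (kern n).
Proof.
move=> x; apply: (@continuous_comp _ _ _ (fun x => (1 + cos (w * x)) / 2) (fun y => y ^+ n)).
  apply: cvgM; last exact: cvg_cst.
  apply: cvgD; first exact: cvg_cst.
  apply: continuous_comp; last exact: continuous_cos.
  exact: mulrl_continuous.
exact: exprn_continuous.
Qed.

Lemma L2_kern n (t : R) : L2 leb I (fun s => kern n (t - s)).
Proof.
apply: (@bounded_L2_I _ _ T0 _ 1).
  apply: measurable_funTS; apply: continuous_measurable_fun => s.
  apply: (@continuous_comp _ _ _ (fun s => t - s) (kern n)).
    by apply: cvgB; [exact: cvg_cst|exact: cvg_id].
  exact: kern_continuous.
by move=> x _; rewrite ger0_norm ?kern_ge0// kern_le1.
Qed.

(** The addition formula of the cosine separates [t] from [s]. *)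
Lemma kern_conv n : exists N al, forall g, L2 leb I g -> forall t,
  \int[leb]_(s in I) (g s * kern n (t - s)) =
  trig T N (fun k => al k * \int[leb]_(s in I) (g s * fc T k s))
           (fun k => al k * \int[leb]_(s in I) (g s * fs T k s)) t.
Proof.
have [N [al E]] := @cospoly_kernel R n; exists N, al => g gL t.
have gc k : leb.-integrable I (EFin \o (fun s => g s * fc T k s)).
  by apply: (L2M_integrable mI) => //; exact: L2_fc.
have gs k : leb.-integrable I (EFin \o (fun s => g s * fs T k s)).
  by apply: (L2M_integrable mI) => //; exact: L2_fs.
have e s : g s * kern n (t - s) = \sum_(k < N)
    (al k * fc T k t * (g s * fc T k s) + al k * fs T k t * (g s * fs T k s)).
  rewrite /kern E mulr_sumr; apply: eq_bigr => k _.
  have -> : k%:R * (w * (t - s)) = k%:R * w * t - k%:R * w * s by ring.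
  by rewrite cosB /fc /fs; ring.
under eq_Rintegral do rewrite e.
rewrite (Rintegral_sum_ord N (F := fun k s =>
  al k * fc T k t * (g s * fc T k s) + al k * fs T k t * (g s * fs T k s))); last first.
  by move=> k; apply: (integrableEFinD mI); exact: (integrableEFinZ mI).
apply: eq_bigr => k _.
rewrite RintegralD//; [|exact: (integrableEFinZ mI)..].
by rewrite !RintegralZl//; ring.
Qed.

Definition kmass n : R := \int[leb]_(s in I) kern n (- s).

(** Oscillating modes integrate to 0 over a period, so that the constant mode of
    the kernel alone contributes. *)
Lemma kern_mass n t : \int[leb]_(s in I) kern n (t - s) = kmass n.
Proof.
have [N [al E]] := kern_conv n; have := E _ (L2_cst_I T0 1).
have c0 k : (0 < k)%N -> \int[leb]_(s in I) (1 * fc T k s) = 0.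
  move=> k0; have := fc_fc T0 0 k; rewrite ltn_eqF// => h; rewrite -[RHS]h.
  by apply: eq_Rintegral => s _; rewrite /fc !mul0r cos0.
have s0 k : \int[leb]_(s in I) (1 * fs T k s) = 0.
  rewrite -[RHS](fs_fc T0 k 0); apply: eq_Rintegral => s _.
  by rewrite /fc !mul0r cos0 mulrC.
have h t' : \int[leb]_(s in I) kern n (t' - s) =
    trig T N (fun k => al k * \int[leb]_(s in I) (1 * fc T k s)) (fun=> 0) t'.
  transitivity (\int[leb]_(s in I) (1 * kern n (t' - s))).
    by apply: eq_Rintegral => s _; rewrite mul1r.
  rewrite E; last exact: L2_cst_I.
  by apply: eq_bigr => k _; rewrite s0 mulr0.
move=> _; rewrite h /kmass; under [RHS]eq_Rintegral do rewrite -sub0r.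
rewrite h; apply: eq_bigr => k _; rewrite !mul0r !addr0.
case: (posnP k) => [->|k0]; first by rewrite /fc !mul0r.
by rewrite c0// mulr0 !mul0r.
Qed.

Lemma omegaT : w * T = pi *+ 2.
Proof. by rewrite /omega -mulr_natr; field; rewrite gt_eqF. Qed.

Lemma kern_mono n (r s : R) : 0 <= s -> s <= r -> r <= T / 2 -> kern n r <= kern n s.
Proof.
move=> s0 sr rT; have w0 := omega_gt0 T0.
have h (x : R) : 0 <= x -> x <= T / 2 -> w * x \in `[0, pi].
  move=> x0 xT; rewrite in_itv/= mulr_ge0 ?(ltW w0)//=.
  have -> : pi = w * (T / 2) by rewrite mulrA omegaT -mulr_natr; field.
  by rewrite ler_wpM2l// ltW.
apply: lerXn2r; rewrite ?nnegrE.
- by rewrite divr_ge0//; have := cos_geN1 (w * r); lra.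
- by rewrite divr_ge0//; have := cos_geN1 (w * s); lra.
rewrite ler_pM2r ?invr_gt0// lerD2l leNgt ltr_cos ?h//; try lra.
by rewrite ltr_pM2l// -leNgt.
Qed.

Lemma kern_norm n (r : R) : kern n `|r| = kern n r.
Proof.
have w0 := omega_gt0 T0.
rewrite /kern -[cos (w * r)]cos_norm normrM (gtr0_norm w0) //.
Qed.

Lemma kern_far n (r d : R) : d <= `|r| -> `|r| <= T - d -> 0 <= d -> kern n r <= kern n d.
Proof.
move=> dr rT d0; rewrite -kern_norm; have [h|h] := leP `|r| (T / 2).
  exact: kern_mono.
have -> : kern n `|r| = kern n (T - `|r|).
  rewrite /kern mulrBr omegaT cosB.
  by rewrite cos2pi sin2pi mul0r addr0 mul1r.
by apply: kern_mono; lra.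
Qed.

(** The kernel decreases on the first half-period, so it is at least [kern n d]
    on an interval of length [d]. *)
Lemma kmass_ge n (d : R) : 0 < d -> d <= T / 2 -> d * kern n d <= kmass n.
Proof.
move=> d0 dT; rewrite /kmass.
have kL : L2 leb I (fun s => kern n (- s)).
  by have := L2_kern n 0; under [X in L2 _ _ X -> _]eq_fun do rewrite sub0r.
have dI : (`]0, d[%classic : set (measurableTypeR R)) `<=` I.
  by move=> x; rewrite /= !in_itv/= => /andP[-> /= xd]; lra.
have -> : d * kern n d = \int[leb]_(s in I) ((fun=> kern n d) \_ (`]0, d[%classic : set (measurableTypeR R))) s.
  rewrite -Rintegral_mkcondr (setIidr dI) Rintegral_cst// mulrC; congr (_ * _).
  transitivity (fine (lebesgue_measure (`]0, d[%classic : set R))) => //.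
  by rewrite lebesgue_measure_itv/= lte_fin d0 -EFinB subr0.
apply: le_Rintegral => //.
- rewrite -restrict_EFin; apply/integrable_restrict => //.
  apply: integrableEFin_cst; first exact: measurableI.
  rewrite (le_lt_trans _ (finite_I T0))// le_measure ?inE//; exact: measurableI.
- exact: L2_integrable_I.
- move=> s sI; rewrite /patch; case: ifPn => [|_]; last exact: kern_ge0.
  rewrite inE/= in_itv/= => /andP[s0 sd].
  rewrite -[leRHS]kern_norm normrN (gtr0_norm s0).
  by apply: kern_mono; lra.
Qed.

Lemma kern_gt0 n (d : R) : 0 <= d -> d < T / 2 -> 0 < kern n d.
Proof.
move=> d0 dT; have w0 := omega_gt0 T0.
apply: exprn_gt0; rewrite divr_gt0//.
have : cos pi < cos (w * d) :> R.
  have pE : pi = w * (T / 2) :> R by rewrite mulrA omegaT -mulr_natr; field.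
  rewrite ltr_cos.
  - by rewrite pE ltr_pM2l.
  - by rewrite in_itv/= mulr_ge0 ?(ltW w0)//= pE ler_pM2l// ltW.
  - by rewrite in_itv/= pi_ge0 lexx.
by rewrite cospi; lra.
Qed.

Lemma kmass_gt0 n : 0 < kmass n.
Proof.
have h : 0 < T / 4 by rewrite divr_gt0.
apply: lt_le_trans (@kmass_ge n (T / 4) h _); last lra.
by rewrite mulr_gt0// kern_gt0; lra.
Qed.

(** The ratio is a geometric sequence. *)
Lemma kern_ratio_cvg (d : R) : 0 < d -> d <= T / 2 ->
  kern n d / kern n (d / 2) @[n --> \oo] --> (0 : R).
Proof.
move=> d0 dT; have w0 := omega_gt0 T0.
pose q := kern 1 d / kern 1 (d / 2).
have k20 : 0 < kern 1 (d / 2) by apply: kern_gt0; lra.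
have -> : (fun n => kern n d / kern n (d / 2)) = (fun n => q ^+ n).
  by apply/funext => n; rewrite /q expr_div_n /kern !expr1.
apply: cvg_expr; rewrite ger0_norm; last by rewrite divr_ge0 ?kern_ge0.
rewrite ltr_pdivrMr// mul1r /kern !expr1 ltr_pM2r ?invr_gt0// ltrD2l.
have h (x : R) : 0 <= x -> x <= T / 2 -> w * x \in `[0, pi].
  move=> x0 xT; rewrite in_itv/= mulr_ge0 ?(ltW w0)//=.
  have -> : pi = w * (T / 2) by rewrite mulrA omegaT -mulr_natr; field.
  by rewrite ler_wpM2l// ltW.
by rewrite ltr_cos ?h//; try lra; rewrite ltr_pM2l//; lra.
Qed.

Section approximate_identity.
Variables (g : measurableTypeR R -> R) (M : R).
Hypotheses (cg : continuous (g : R -> R)) (M0 : 0 <= M) (gM : forall t, `|g t| <= M).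

Let mg : measurable_fun setT g. Proof. exact: continuous_measurable_fun. Qed.

Let gL : L2 leb I g.
Proof. by apply: (@bounded_L2_I _ _ T0 _ M) => //; exact: measurable_funTS. Qed.

Definition smoothed n (t : measurableTypeR R) : R :=
  (kmass n)^-1 * \int[leb]_(s in I) (g s * kern n (t - s)).

Let gkI n t : leb.-integrable I (EFin \o (fun s => g s * kern n (t - s))).
Proof. by apply: (L2M_integrable mI) => //; exact: L2_kern. Qed.

Let kI n t : leb.-integrable I (EFin \o (fun s => kern n (t - s))).
Proof. by apply: (L2_integrable_I T0); exact: L2_kern. Qed.

Lemma smoothed_trig n : exists N a b, smoothed n = trig T N a b.
Proof.
have [N [al E]] := kern_conv n.
exists N, (fun k => (kmass n)^-1 * (al k * \int[leb]_(s in I) (g s * fc T k s))),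
  (fun k => (kmass n)^-1 * (al k * \int[leb]_(s in I) (g s * fs T k s))).
apply/funext => t; rewrite /smoothed (E _ gL) /trig mulr_sumr.
by apply: eq_bigr => k _; ring.
Qed.

Lemma smoothed_le n t : `|smoothed n t| <= M.
Proof.
rewrite /smoothed normrM normfV (gtr0_norm (kmass_gt0 n)).
rewrite mulrC ler_pdivrMr ?kmass_gt0// -(kern_mass n t) -RintegralZl//.
apply: le_trans (le_normr_Rintegral mI (gkI n t)) _.
apply: le_Rintegral => //.
- exact: (integrable_abse (gkI n t)).
- exact: (integrableEFinZ mI).
- by move=> s _; rewrite normrM (ger0_norm (kern_ge0 _ _)) ler_wpM2r ?kern_ge0.
Qed.

(** At distance less than [d] from [t], continuity controls [g s - g t]. Farther
    away the kernel is at most [kern n d], negligible when compared with its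
    mass, which is at least [d / 2 * kern n (d / 2)]. *)
Lemma smoothed_cvg t : I t -> smoothed n t @[n --> \oo] --> g t.
Proof.
rewrite /= in_itv/= => /andP[t0 tT].
apply/cvgrPdist_le => e e0.
have e20 : 0 < e / 2 by rewrite divr_gt0.
have /cvgrPdist_le/(_ _ e20)/nbhs_ballP[d0 /= d00 hd0] := @cg t.
pose d := Num.min d0 (Num.min t (T - t)).
have dd : 0 < d by rewrite /d !lt_min d00 t0 subr_gt0 tT.
have [dd0 [dt dT]] : d <= d0 /\ d <= t /\ d <= T - t.
  by rewrite /d !ge_min !lexx /= !orbT.
have dT2 : d <= T / 2 by lra.
have key n : `|g t - smoothed n t| <= e / 2 + 4 * M * T / d * (kern n d / kern n (d / 2)).
  have kn0 := kmass_gt0 n.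
  have E : smoothed n t - g t = (kmass n)^-1 * \int[leb]_(s in I) ((g s - g t) * kern n (t - s)).
    under eq_Rintegral do rewrite mulrBl.
    rewrite RintegralB//; last exact: (integrableEFinZ mI).
    rewrite RintegralZl// kern_mass mulrBr -/(smoothed n t); congr (_ - _).
    by field; rewrite gt_eqF.
  rewrite distrC E normrM normfV (gtr0_norm kn0) mulrC ler_pdivrMr//.
  have gdI : leb.-integrable I (EFin \o (fun s => (g s - g t) * kern n (t - s))).
    apply: (L2M_integrable mI); last exact: L2_kern.
    by apply: (L2B mI) => //; exact: L2_cst_I.
  apply: le_trans (le_normr_Rintegral mI gdI) _.
  apply: (@le_trans _ _ (\int[leb]_(s in I) (e / 2 * kern n (t - s) + 2 * M * kern n d))).
    apply: le_Rintegral => //.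
    - exact: (integrable_abse gdI).
    - apply: (integrableEFinD mI); first exact: (integrableEFinZ mI).
      by apply: (L2_integrable_I T0); exact: L2_cst_I.
    - move=> s; rewrite /= in_itv/= => /andP[s0 sT].
      rewrite normrM (ger0_norm (kern_ge0 _ _)).
      have [ts|ts] := ltP `|t - s| d.
        apply: ler_wpDr; first by rewrite !mulr_ge0 ?kern_ge0.
        rewrite ler_wpM2r ?kern_ge0// distrC; apply: hd0.
        exact: lt_le_trans ts dd0.
      apply: ler_wpDl; first by rewrite mulr_ge0 ?kern_ge0// ltW.
      apply: ler_pM; rewrite ?kern_ge0//.
        by rewrite (le_trans (ler_normB _ _))//; have := gM s; have := gM t; lra.
      apply: kern_far => //; last exact: ltW.
      by rewrite ler_norml; apply/andP; split; lra.
  rewrite RintegralD//; [|exact: (integrableEFinZ mI)|by apply: (L2_integrable_I T0); exact: L2_cst_I].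
  have -> : \int[leb]_(s in I) (e / 2 * kern n (t - s)) = e / 2 * kmass n.
    by rewrite RintegralZl// kern_mass.
  rewrite [leRHS]mulrDl lerD2l.
  rewrite (_ : \int[leb]_(s in I) (2 * M * kern n d) = 2 * M * kern n d * T); last first.
    transitivity (2 * M * kern n d * fine (leb I)); first by rewrite Rintegral_cst.
    by rewrite leb_I.
  have k20 : 0 < kern n (d / 2) by apply: kern_gt0; lra.
  have := @kmass_ge n (d / 2) ltac:(lra) ltac:(lra).
  have C0 : 0 <= 4 * M * T / d * (kern n d / kern n (d / 2)).
    by rewrite !mulr_ge0 ?invr_ge0 ?kern_ge0// ltW.
  move=> /(ler_wpM2l C0); apply: le_trans; rewrite le_eqVlt; apply/orP; left; apply/eqP.
  by field; rewrite !gt_eqF.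
have lim : e / 2 + 4 * M * T / d * (kern n d / kern n (d / 2)) @[n --> \oo] --> e / 2 + 4 * M * T / d * 0.
  apply: cvgD; first exact: cvg_cst.
  by apply: cvgM; [exact: cvg_cst|exact: kern_ratio_cvg].
near=> n; apply: le_trans (key n) _; apply: ltW; near: n.
apply: (cvgr_lt _ lim).
by rewrite mulr0 addr0; lra.
Unshelve. all: by end_near. Qed.

Lemma smoothed_L2_cvg (e : R) : 0 < e ->
  exists N a b, sqn leb I (fun t => g t - trig T N a b t) < e.
Proof.
move=> e0.
have sL n : L2 leb I (smoothed n).
  by have [N [a [b ->]]] := smoothed_trig n; exact: L2_trig.
have [_ lim] : leb.-integrable I (EFin \o cst (0 : R)) /\
    \int[leb]_(t in I) (g t - smoothed n t) ^+ 2 @[n --> \oo] --> \int[leb]_(t in I) (0 : R).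
  apply: (dominated_cvg_real mI (g := fun=> (2 * M) ^+ 2)).
  - move=> n; apply: measurable_funX; have [m _] := sL n.
    by apply: measurable_funB => //; exact: measurable_funTS.
  - exact: measurable_cst.
  - apply: aeW => t It; rewrite -[X in _ --> X](expr0n _ 2).
    rewrite expr2; under eq_fun do rewrite expr2.
    have h : g t - smoothed n t @[n --> \oo] --> (0 : R).
      rewrite -(subrr (g t)); apply: cvgB; first exact: cvg_cst.
      exact: smoothed_cvg.
    exact: cvgM.
  - by apply: (L2_integrable_I T0); exact: L2_cst_I.
  - apply: aeW => t n It; rewrite ger0_norm ?sqr_ge0// -[leLHS]real_normK ?num_real//.
    rewrite ler_pXn2r ?nnegrE ?mulr_ge0//.
    rewrite (le_trans (ler_normB _ _))//; have := gM t; have := smoothed_le n t; lra.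
rewrite [X in _ --> X]/Rintegral integral0 /= in lim.
have : \forall n \near \oo, \int[leb]_(t in I) (g t - smoothed n t) ^+ 2 < e.
  exact: (cvgr_lt _ lim).
move=> [n _ /(_ n (leqnn n))] /= h.
by have [N [a [b E]]] := smoothed_trig n; exists N, a, b; rewrite -E.
Qed.

End approximate_identity.

(** Truncate [f]; approximate the truncation by a continuous function in the
    L1 sense, hence in the L2 sense as both are bounded; then smooth the latter.
    Each step costs [e / 16]. *)
Lemma trig_dense f (e : R) : L2 leb I f -> 0 < e ->
  exists N a b, sqn leb I (fun t => f t - trig T N a b t) < e.
Proof.
move=> fL e0; have mf := L2_measurable fL.
have mclip M : measurable_fun I (fun t => clip M (f t)).
  apply: (@measurableT_comp _ _ _ _ _ _ (clip M)) => //.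
  by apply: continuous_measurable_fun; exact: clip_cont.
have clipL (m : nat) : L2 leb I (fun t => clip m%:R (f t)).
  by apply: (@bounded_L2_I _ _ T0 _ m%:R) => // t _; exact: clip_le.
have e160 : 0 < e / 16 by rewrite divr_gt0.
have [m hm] : exists m : nat, sqn leb I (fun t => f t - clip m%:R (f t)) < e / 16.
  have [_ lim] : leb.-integrable I (EFin \o cst (0 : R)) /\
      \int[leb]_(t in I) (f t - clip m%:R (f t)) ^+ 2 @[m --> \oo] --> \int[leb]_(t in I) (0 : R).
    apply: (dominated_cvg_real mI (g := fun t => 4 * f t ^+ 2)).
    - by move=> n; apply: measurable_funX; exact: measurable_funB.
    - exact: measurable_cst.
    - apply: aeW => t _; apply: cvg_near_cst; near=> n.
      rewrite clip_id ?subrr ?expr0n//.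
      rewrite (le_trans (ltW (truncnS_gt _)))// ler_nat.
      by near: n; exact: nbhs_infty_ge.
    - by apply: (integrableEFinZ mI); exact: L2_sq_integrable.
    - apply: aeW => t n _; rewrite ger0_norm ?sqr_ge0// -[leLHS]real_normK ?num_real//.
      have -> : 4 * f t ^+ 2 = (2 * `|f t|) ^+ 2 by rewrite exprMn real_normK ?num_real//; ring.
      rewrite ler_pXn2r ?nnegrE ?mulr_ge0//.
      have c0 : clip n%:R 0 = 0 :> R by rewrite /clip add0r sub0r normrN subrr mulr0.
      have := clip_lip n%:R (f t) 0; rewrite c0 !subr0 => h.
      by rewrite (le_trans (ler_normB _ _))//; lra.
  rewrite [X in _ --> X]/Rintegral integral0 /= in lim.
  have : \forall m \near \oo, \int[leb]_(t in I) (f t - clip m%:R (f t)) ^+ 2 < e / 16.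
    exact: (cvgr_lt _ lim).
  by move=> [m _ /(_ m (leqnn m))]; exists m.
pose M : R := m%:R.
have M0 : 0 <= M by rewrite /M ler0n.
have [g [cg gM hg]] : exists g : measurableTypeR R -> R,
    [/\ continuous (g : R -> R), forall t, `|g t| <= M &
    sqn leb I (fun t => clip M (f t) - g t) < e / 16].
  have [g_ [cg_ ig_ lim]] := @approximation_continuous_integrable R I (fun t => clip M (f t)) mI (finite_I T0) (L2_integrable_I T0 (clipL m)).
  have /cvge0P lim' := lim.
  have c0 : 0 < e / 16 / (2 * M + 1) by rewrite divr_gt0//; lra.
  have [j _ /(_ j (leqnn j)) hj] := lim' (fun k => integral_ge0 _ (fun t _ => abse_ge0 _)) _ c0.
  exists (fun t => clip M (g_ j t)); split.
  - move=> t; apply: (@continuous_comp _ _ _ (g_ j) (clip M)); first exact: cg_.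
    exact: clip_cont.
  - by move=> t; exact: clip_le.
  - have mg : measurable_fun I (g_ j).
      by apply: measurable_funTS; exact: continuous_measurable_fun.
    have mcg : measurable_fun I (fun t => clip M (g_ j t)).
      apply: (@measurableT_comp _ _ _ _ _ _ (clip M)) => //.
      by apply: continuous_measurable_fun; exact: clip_cont.
    have cgL : L2 leb I (fun t => clip M (g_ j t)).
      by apply: (@bounded_L2_I _ _ T0 _ M) => // t _; exact: clip_le.
    have dI : leb.-integrable I (EFin \o (fun t => `|clip M (f t) - g_ j t|)).
      apply: (@integrable_abse _ _ _ _ I (EFin \o (fun t => clip M (f t) - g_ j t))).
      by apply: (integrableEFinB mI); [exact: (L2_integrable_I T0 (clipL m))|exact: ig_].
    apply: (@le_lt_trans _ _ (2 * M * \int[leb]_(t in I) `|clip M (f t) - g_ j t|)).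
      rewrite -RintegralZl//; apply: le_Rintegral => //.
      + exact: (L2_sq_integrable (L2B mI (clipL m) cgL)).
      + exact: (integrableEFinZ mI).
      + move=> t _; rewrite -real_normK ?num_real// expr2.
        have h1 : `|clip M (f t) - clip M (g_ j t)| <= `|clip M (f t) - g_ j t|.
          rewrite -{1}(@clip_id _ M (clip M (f t))); first exact: clip_lip.
          exact: clip_le.
        have h2 : `|clip M (f t) - clip M (g_ j t)| <= 2 * M.
          rewrite (le_trans (ler_normB _ _))//.
          by have := clip_le (f t) M0; have := clip_le (g_ j t) M0; lra.
        exact: ler_pM.
    have {}hj : \int[leb]_(t in I) `|clip M (f t) - g_ j t| < e / 16 / (2 * M + 1).
      by rewrite -lte_fin /Rintegral fineK//; apply: integrable_fin_num.
    have I0 : 0 <= \int[leb]_(t in I) `|clip M (f t) - g_ j t| by apply: Rintegral_ge0.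
    rewrite ltr_pdivlMr in hj; last lra.
    by apply: le_lt_trans hj; rewrite mulrC ler_wpM2l//; lra.
have gL : L2 leb I g.
  apply: (@bounded_L2_I _ _ T0 _ M) => //.
  by apply: measurable_funTS; exact: continuous_measurable_fun.
have [N [a [b hp]]] := smoothed_L2_cvg cg M0 gM e160.
exists N, a, b; have tL := L2_trig T0 N a b.
have -> : (fun t => f t - trig T N a b t) =
    (fun t => (f t - clip M (f t)) + ((clip M (f t) - g t) + (g t - trig T N a b t))).
  by apply/funext => t; ring.
have d1 : L2 leb I (fun t => f t - clip M (f t)) by apply: (L2B mI) => //; exact: (clipL m).
have d2 : L2 leb I (fun t => clip M (f t) - g t) by apply: (L2B mI) => //; exact: (clipL m).
have d3 : L2 leb I (fun t => g t - trig T N a b t) by apply: (L2B mI).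
apply: le_lt_trans (sqnD_le mI d1 (L2D mI d2 d3)) _.
apply: (@le_lt_trans _ _ (2 * (e / 16 + 2 * (e / 16 + e / 16)))); last lra.
rewrite ler_pM2l// lerD ?(ltW hm)//.
by apply: le_trans (sqnD_le mI d2 d3) _; rewrite ler_pM2l// lerD ?ltW.
Unshelve. all: by end_near. Qed.

Lemma trig_widen N M a b : (N <= M)%N ->
  trig T N a b = trig T M (fun k => if (k < N)%N then a k else 0)
                          (fun k => if (k < N)%N then b k else 0).
Proof.
move=> NM; apply/funext => t; rewrite /trig.
rewrite (big_ord_widen _ (fun k => a k * fc T k t + b k * fs T k t) NM) big_mkcond.
by apply: eq_bigr => k _; case: ifP => _; rewrite ?mul0r ?addr0.
Qed.

(** Partial sums are best approximations and, by density, good approximations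
    exist. *)
Lemma fenergy_cvg f : L2 leb I f -> fenergy T N f f @[N --> \oo] --> sqn leb I f.
Proof.
move=> fL; apply/cvgrPdist_lt => e e0.
have [N [a [b h]]] := trig_dense fL e0.
near=> M; have NM : (N <= M.+1)%N.
  by apply: leqW; near: M; exact: nbhs_infty_ge.
rewrite (trig_widen a b NM) in h.
rewrite ger0_norm ?subr_ge0; last exact: bessel.
exact: le_lt_trans (fenergy_best T0 _ _ _ fL) h.
Unshelve. all: by end_near. Qed.

Lemma coef_linear (e : measurableTypeR R -> R) (c : R) f h :
  L2 leb I e -> L2 leb I f -> L2 leb I h ->
  2 / T * \int[leb]_(t in I) ((f t + c * h t) * e t) =
  2 / T * \int[leb]_(t in I) (f t * e t) + c * (2 / T * \int[leb]_(t in I) (h t * e t)).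
Proof.
move=> eL fL hL; have fi := L2M_integrable mI fL eL; have hi := L2M_integrable mI hL eL.
rewrite [X in _ = _ + X]mulrCA -mulrDr -(RintegralZl _ mI hi).
rewrite -(RintegralD mI fi (integrableEFinZ mI c hi)).
by congr (_ * _); apply: eq_Rintegral => t _; ring.
Qed.

Lemma ac_linear c f h k : L2 leb I f -> L2 leb I h ->
  ac T (fun t => f t + c * h t) k = ac T f k + c * ac T h k.
Proof. by apply: coef_linear; exact: L2_fc. Qed.

Lemma as_linear c f h k : L2 leb I f -> L2 leb I h ->
  as_ T (fun t => f t + c * h t) k = as_ T f k + c * as_ T h k.
Proof. by apply: coef_linear; exact: L2_fs. Qed.

Lemma fenergy_quad N c f h : L2 leb I f -> L2 leb I h ->
  fenergy T N (fun t => f t + c * h t) (fun t => f t + c * h t) =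
  fenergy T N f f + 2 * c * fenergy T N f h + c ^+ 2 * fenergy T N h h.
Proof.
move=> fL hL; rewrite /fenergy [X in _ + X + _]mulrCA [X in _ + _ + X]mulrCA -!mulrDr; congr (_ * _).
rewrite !mulr_sumr -!big_split/=; apply: eq_bigr => k _.
by rewrite ac_linear// as_linear//; ring.
Qed.

(** Polarization of [fenergy_cvg]. *)
Lemma parseval f h : L2 leb I f -> L2 leb I h ->
  fenergy T N f h @[N --> \oo] --> \int[leb]_(t in I) (f t * h t).
Proof.
move=> fL hL; have fhL := L2D mI fL (L2Z mI 1 hL).
have -> : (fun N => fenergy T N f h) = (fun N => 2^-1 *
    (fenergy T N (fun t => f t + 1 * h t) (fun t => f t + 1 * h t) -
     fenergy T N f f - fenergy T N h h)).
  by apply/funext => N; rewrite fenergy_quad//; field.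
rewrite (_ : Rintegral _ _ _ = 2^-1 * (sqn leb I (fun t => f t + 1 * h t) - sqn leb I f - sqn leb I h)).
  apply: cvgM; first exact: cvg_cst.
  by apply: cvgB; [apply: cvgB|]; exact: fenergy_cvg.
by rewrite integral_sq_quad//; field.
Qed.

(** The energy is a nonnegative quadratic form satisfying Bessel's inequality.
    This uniform bound is what allows to integrate Parseval's identity in
    space. *)
Lemma fenergy_le N f h : L2 leb I f -> L2 leb I h ->
  `|fenergy T N f h| <= 2^-1 * (sqn leb I f + sqn leb I h).
Proof.
move=> fL hL.
have h1 := fenergy_quad N 1 fL hL; have h2 := fenergy_quad N (-1) fL hL.
have := fenergy_ge0 T0 (fun t => f t + 1 * h t) N; rewrite h1.
have := fenergy_ge0 T0 (fun t => f t + -1 * h t) N; rewrite h2.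
have := bessel T0 N fL; have := bessel T0 N hL.
by rewrite ler_norml => *; apply/andP; split; lra.
Qed.

End trigonometric_density.

(** * Cut-off functions in time *)

Section cutoff.
Variables (R : realType) (T : R).
Hypothesis T0 : 0 < T.
Local Notation leb := (@lebesgue_measure R).
Local Notation I := (`]0, T[%classic : set (measurableTypeR R)).
Local Notation mI := (measurable_I T).

Definition ramp (N : R) (t : R) : R := step (N * t - 1).
(** It vanishes within [1 / N] of the end points of the time interval and
    equals 1 farther than [2 / N] from them. *)
Definition cutoff (N : R) (t : R) : R := ramp N t * ramp N (T - t).

Lemma smooth_ramp N : smooth (ramp N).
Proof.
move=> k; apply: (@Ck_affine R R R k (fun t : R => N * t - 1) (fun v : R => N * v) (@step R)) => [t|h v x|].
- apply: (@CkD R R 0%N); last exact: (@Ck_cst R R 0%N).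
  by apply: (@CkZ R R 0%N) => x; exact: cvg_id.
- by rewrite /GRing.scale/=; ring.
- exact: smooth_step.
Qed.

Lemma smooth_rampR N : smooth (fun t => ramp N (T - t)).
Proof.
move=> k; apply: (@Ck_affine R R R k (fun t : R => T - t) (fun v : R => - v) (ramp N)) => [t|h v x|].
- apply: (@CkD R R 0%N); first exact: (@Ck_cst R R 0%N).
  by apply: (@CkN R R 0%N) => x; exact: cvg_id.
- by rewrite /GRing.scale/=; ring.
- exact: smooth_ramp.
Qed.

Lemma cutoff_test N : 0 < N -> test_function (`]0, T[%classic : set R) (cutoff N).
Proof.
move=> N0; have N1 : 0 < N^-1 by rewrite invr_gt0.
have [|h1 h2] := @closure_sub_compact R R [set t | cutoff N t != 0] `[N^-1, T - N^-1]%classic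
  (@segment_compact R _ _).
  move=> t /=; rewrite /cutoff /ramp mulf_eq0 negb_or => /andP[/step_gt0 a /step_gt0 b].
  rewrite in_itv/=; rewrite subr_gt0 -ltr_pdivrMl// mulr1 in a.
  by rewrite subr_gt0 -ltr_pdivrMl// mulr1 in b; apply/andP; split; lra.
split; [|exact: h2|].
  by move=> k; apply: CkM; [exact: smooth_ramp|exact: smooth_rampR].
by apply: subset_trans h1 _ => t; rewrite /= !in_itv/= => /andP[a b]; apply/andP; split; lra.
Qed.

Lemma cutoff_ge0 N t : 0 <= cutoff N t.
Proof. by rewrite mulr_ge0 ?step_ge0. Qed.

Lemma cutoff_le1 N t : cutoff N t <= 1.
Proof. by rewrite mulr_ile1 ?step_ge0 ?step_le1. Qed.

Lemma cutoff_cvg t : 0 < t < T -> cutoff n.+1%:R t @[n --> \oo] --> (1 : R).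
Proof.
move=> /andP[t0 tT]; apply: cvg_near_cst.
have h (c : R) : 0 < c -> \forall n \near \oo, ramp n.+1%:R c = 1.
  move=> c0; near=> n; apply: step1.
  rewrite lerBrDr -ler_pdivrMr// (le_trans (ltW (truncnS_gt _)))// ler_nat ltnS.
  by near: n; exact: nbhs_infty_ge.
have tT' : 0 < T - t by rewrite subr_gt0.
by near=> n; rewrite /cutoff (near (h _ t0) n)// (near (h _ tT') n)// mulr1.
Unshelve. all: by end_near. Qed.

Lemma derivable_ramp N t : derivable (ramp N) t 1.
Proof. exact: (((@smooth_ramp N 1%N).2 1).1 t). Qed.

Lemma derive_ramp N t : 'D_1 (ramp N) t = N * 'D_1 (@step R) (N * t - 1).
Proof.
rewrite /ramp (@derive_affine R R R (fun t : R => N * t - 1) (fun v : R => N * v) (@step R)).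
  by have [_ ->] := derivable_scale (N * 1) (@derivable_step R (N * t - 1)); rewrite mulr1.
by move=> h v x; rewrite /GRing.scale/=; ring.
Qed.

Lemma derive_rampR N t : 'D_1 (fun t => ramp N (T - t)) t = - (N * 'D_1 (@step R) (N * (T - t) - 1)).
Proof.
rewrite (@derive_affine R R R (fun t : R => T - t) (fun v : R => - v) (ramp N)).
  by have [_ ->] := derivable_scale (- 1) (@derivable_ramp N (T - t)); rewrite derive_ramp mulN1r.
by move=> h v x; rewrite /GRing.scale/=; ring.
Qed.

Lemma derive_cutoff N t : 'D_1 (cutoff N) t =
  ramp N (T - t) * (N * 'D_1 (@step R) (N * t - 1)) - ramp N t * (N * 'D_1 (@step R) (N * (T - t) - 1)).
Proof.
have d2 : derivable (fun t => ramp N (T - t)) t 1.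
  exact: (((@smooth_rampR N 1%N).2 1).1 t).
rewrite /cutoff (deriveM (@derivable_ramp N t) d2) derive_rampR derive_ramp.
by rewrite /GRing.scale/= addrC mulrN.
Qed.

Lemma derive_cutoff_le (C N t : R) : (forall x : R, `|'D_1 (@step R) x| <= C) -> 0 < N ->
  `|'D_1 (cutoff N) t| <= 2 * N * C.
Proof.
move=> hC N0; rewrite derive_cutoff; have C0 : 0 <= C by apply: le_trans (hC 0).
have key s r : `|ramp N r * (N * 'D_1 (@step R) s)| <= N * C.
  rewrite normrM ger0_norm ?step_ge0// normrM gtr0_norm//.
  rewrite -[leRHS]mul1r ler_pM ?step_ge0 ?step_le1 ?mulr_ge0 ?(ltW N0)//.
  by rewrite ler_pM2l.
by rewrite (le_trans (ler_normB _ _))// (le_trans (lerD (key _ _) (key _ _)))//; lra.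
Qed.

Lemma derive_cutoff_eq0 (N t : R) : 0 < N -> 2 / N < t -> 2 / N < T - t ->
  'D_1 (cutoff N) t = 0.
Proof.
move=> N0; rewrite !ltr_pdivrMr// => a b.
by rewrite derive_cutoff !derive_step_eq0 ?mulr0 ?subr0//; right; nra.
Qed.

(** The derivative of the cut-off is at most of order [N], on two intervals of
    length of order [1 / N] at the ends: its total mass is bounded and it only
    sees the values of [g] near the ends. *)
Lemma derive_cutoff_cvg0 (g : measurableTypeR R -> R) : leb.-integrable I (EFin \o g) ->
  (forall e, 0 < e -> exists2 d, 0 < d &
     {ae leb, forall t, I t -> t <= d \/ T - t <= d -> `|g t| <= e}) ->
  \int[leb]_(t in I) ('D_1 (cutoff n.+1%:R) t * g t) @[n --> \oo] --> 0.
Proof.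
move=> gi gsmall; have [C C0 hC] := @derive_step_bounded R.
have mg : measurable_fun I g by have /measurable_int/measurable_EFinP := gi.
have mcut N : 0 < N -> measurable_fun I ('D_1 (cutoff N) : measurableTypeR R -> R).
  move=> N0; apply: measurable_funTS; apply: continuous_measurable_fun.
  by have [/(_ 1%N)[_ /(_ 1)[_ +]] _ _] := cutoff_test N0.
apply/cvgr0Pnorm_le => e e0.
have e1 : 0 < e / (8 * C) by rewrite divr_gt0// mulr_gt0.
have [d d0 hd] := gsmall _ e1.
near=> n; set N : R := n.+1%:R; have N0 : 0 < N by rewrite ltr0n.
have Nd : 2 / N <= d.
  rewrite ler_pdivrMr// -ler_pdivrMl//.
  rewrite (le_trans (ltW (truncnS_gt _)))// ler_nat ltnS.
  by near: n; exact: nbhs_infty_ge.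
pose A : set (measurableTypeR R) := `[0, 2 / N]%classic.
pose B : set (measurableTypeR R) := `[T - 2 / N, T]%classic.
have mA : measurable A by exact: measurable_itv.
have mB : measurable B by exact: measurable_itv.
pose K := 2 * N * C * (e / (8 * C)).
have K0 : 0 <= K.
  by rewrite /K; apply: mulr_ge0; [apply: mulr_ge0; [apply: mulr_ge0|]|]; rewrite ltW.
have ind_int (S : set (measurableTypeR R)) : measurable S ->
    leb.-integrable I (EFin \o (\1_S : _ -> R)).
  move=> mS; apply: L2_integrable_I => //; apply: (@bounded_L2_I _ _ T0 _ 1).
    by apply: measurable_funTS; exact: measurable_indic.
  by move=> x _; rewrite indicE; case: (_ \in _); rewrite ?normr1 ?normr0.
have ind_le (S : set (measurableTypeR R)) : measurable S -> (leb S = (2 / N)%:E)%E ->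
    \int[leb]_(t in I) (\1_S t : R) <= 2 / N.
  move=> mS lS; rewrite -lee_fin /Rintegral fineK; last first.
    by apply: integrable_fin_num; [exact: mI|exact: ind_int].
  by rewrite integral_indic// -lS; apply: le_measure; rewrite ?inE //; try exact: measurableI; exact: subIsetl.
have lA : (leb A = (2 / N)%:E)%E.
  transitivity (lebesgue_measure (`[0, 2 / N]%classic : set R)) => //.
  by rewrite lebesgue_measure_itv/= lte_fin divr_gt0// -EFinB subr0.
have lB : (leb B = (2 / N)%:E)%E.
  transitivity (lebesgue_measure (`[T - 2 / N, T]%classic : set R)) => //.
  by rewrite lebesgue_measure_itv/= lte_fin gtrBl divr_gt0// -EFinB subKr.
have di : leb.-integrable I (EFin \o (fun t => 'D_1 (cutoff N) t * g t)).
  apply: (le_integrable mI _ _ (integrableEFinZ mI (2 * N * C) gi)).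
    by apply/measurable_EFinP; apply: measurable_funM => //; exact: mcut.
  move=> t _ /=; rewrite lee_fin !normrM.
  by rewrite ler_wpM2r// (le_trans (derive_cutoff_le _ hC N0))// -!normrM ler_norm.
apply: (le_trans (le_normr_Rintegral mI di)).
apply: (@le_trans _ _ (\int[leb]_(t in I) (K * (\1_A t + \1_B t)))).
  apply: (ae_le_Rintegral mI).
  - have := integrable_norm di; apply: eq_integrable; first exact: mI.
    by move=> t _ /=.
  - by apply: (integrableEFinZ mI); apply: (integrableEFinD mI); exact: ind_int.
  apply: filterS hd => t hd It; have /= := It; rewrite in_itv/= => /andP[t0 tT].
  have [ht|ht] := pselect (A t \/ B t).
    rewrite normrM -[leLHS]mulr1 ler_pM ?mulr_ge0//.
      rewrite /K ler_pM//; first exact: derive_cutoff_le.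
      apply: hd => //; case: ht => /=; rewrite /A /B/= in_itv/= => /andP[a b].
        by left; exact: le_trans b Nd.
      by right; rewrite lerBlDr (le_trans _ (lerD Nd a))// addrC subrK.
    by rewrite !indicE; case: ht => /mem_set ->; rewrite ?lerDl ?lerDr.
  have d0' : 'D_1 (cutoff N) t = 0.
    apply: derive_cutoff_eq0 => //; rewrite ltNge; apply/negP => h; apply: ht.
      by left; rewrite /A/= in_itv/= h ltW.
    by right; rewrite /B/= in_itv/= (ltW tT) andbT lerBlDr addrC -lerBlDr.
  by rewrite d0' mul0r normr0 mulr_ge0// addr_ge0// indicE.
have iAB := integrableEFinD mI (ind_int _ mA) (ind_int _ mB).
rewrite (RintegralZl _ mI iAB) (RintegralD mI (ind_int _ mA) (ind_int _ mB)).
rewrite (le_trans (ler_wpM2l K0 (lerD (ind_le _ mA lA) (ind_le _ mB lB))))//.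
by rewrite /K le_eqVlt; apply/orP; left; apply/eqP; field; rewrite !gt_eqF.
Unshelve. all: by end_near. Qed.

End cutoff.

(** * Fourier coefficients of the time derivative *)

Section slices.
Variables (R : realType) (n : nat) (Omega : set 'rV[R]_n) (T : R).
Local Notation X := ('rV[R]_n * measurableTypeR R)%type.
Local Notation X' := ('rV[R]_n * R)%type.
Local Notation mu := (lebesgue_rV R n).
Local Notation leb := (@lebesgue_measure R).
Local Notation st := (lebesgue_st R n).
Local Notation I := (`]0, T[%classic : set (measurableTypeR R)).
Local Notation QT := (QT Omega T).
Hypotheses (oO : open Omega) (bO : bounded_set Omega) (T0 : 0 < T).
Let mO := measurable_Omega oO.
Let mI := measurable_I T.
Local Notation sf := (lebesgue_rV_sigma_finite R n).

Lemma fubini_QT (f : X -> R) : st.-integrable QT (EFin \o f) ->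
  [/\ mu.-integrable Omega (EFin \o (fun x => \int[leb]_(t in I) f (x, t))),
     leb.-integrable I (EFin \o (fun t => \int[mu]_(x in Omega) f (x, t))),
     \int[st]_(z in QT) f z = \int[mu]_(x in Omega) \int[leb]_(t in I) f (x, t) &
     \int[st]_(z in QT) f z = \int[leb]_(t in I) \int[mu]_(x in Omega) f (x, t)].
Proof. by move=> fi; have [[_ _ h1 h2] [h3 h4]] := fubini_rect sf mO mI fi. Qed.

(** Fubini's theorem for the square. *)
Lemma L2_slice_space (f : X -> R) : L2 st QT f ->
  {ae mu, forall x, Omega x -> L2 leb I (fun t => f (x, t))}.
Proof.
move=> fL; have mf := L2_measurable fL.
have [[h _ _ _] _] := fubini_rect sf mO mI (L2_sq_integrable fL).
apply: filterS h => x h Ox; apply/L2P; split; last exact: h.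
exact: measurable_slice2 mf Ox.
Qed.

Lemma L2_slice_time (f : X -> R) : L2 st QT f ->
  {ae leb, forall t, I t -> L2 mu Omega (fun x => f (x, t))}.
Proof.
move=> fL; have mf := L2_measurable fL.
have [[_ h _ _] _] := fubini_rect sf mO mI (L2_sq_integrable fL).
apply: filterS h => x h Ox; apply/L2P; split; last exact: h.
exact: measurable_slice1 mf Ox.
Qed.

Lemma tensor_test (phi : 'rV[R]_n -> R) (c : R -> R) : test_function Omega phi ->
  test_function (`]0, T[%classic : set R) c ->
  test_function (QT : set X') (fun z => phi z.1 * c z.2) /\
  forall z, cdt (fun z => phi z.1 * c z.2) z = phi z.1 * 'D_1 c z.2.
Proof.
move=> tphi tc; have [sphi cphi Dphi] := tphi; have [sc cc Dc] := tc; split.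
  have [|h1 h2] := @closure_sub_compact R X' [set z | phi z.1 * c z.2 != 0] _
    (compact_setX cphi cc).
    move=> z /=; rewrite mulf_eq0 negb_or => /andP[a b]; split; exact: subset_closure.
  split; [|exact: h2|by apply: subset_trans h1 _ => z [a b]; split; [exact: Dphi|exact: Dc]].
  move=> k; apply: (@CkM R X').
    apply: (@Ck_affine R X' 'rV[R]_n k fst fst phi) => //.
    by move=> z; exact: cvg_fst.
  apply: (@Ck_affine R X' R k snd snd c) => //.
  by move=> z; exact: cvg_snd.
move=> [x t]; rewrite /cdt -(@derive_affine R R X' (fun t => (x, t)) (fun v => (0, v)) _ t 1).
  by rewrite [LHS](@deriveZ _ _ _ c (phi x) t 1)//; exact: ((sc 1%N).2 1).1.
by move=> h v y; congr pair; rewrite /= scaler0 add0r.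
Qed.

Lemma smooth_bounded_I (c : R -> R) : smooth c ->
  exists C, forall t, I t -> `|c t| <= C.
Proof.
move=> sc; have cc : compact (c @` `[0, T]%classic).
  apply: continuous_compact; last exact: (@segment_compact R).
  by apply: continuous_subspaceT; exact: (sc 0%N).
have [M [_ hM]] := compact_bounded cc.
exists (`|M| + 1) => t It; apply: (hM (`|M| + 1)).
  by rewrite (le_lt_trans (ler_norm M))// ltrDl.
exists t => //; move: It; rewrite /= !in_itv/= => /andP[a b].
by rewrite !ltW.
Qed.

Lemma L2_timeM (c : R -> R) (w : X -> R) : smooth c -> L2 st QT w ->
  L2 st QT (fun z => c z.2 * w z).
Proof.
move=> sc wL; have [C hC] := smooth_bounded_I sc.
apply: (@L2bM _ _ _ st QT (measurable_QT T oO) (fun z => c z.2) w C) => //.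
  apply: measurable_funTS; apply: (measurableT_comp _ measurable_snd).
  by apply: continuous_measurable_fun; exact: (sc 0%N).
by move=> z [_ z2]; exact: hC.
Qed.

Lemma L2_tensorM (phi : 'rV[R]_n -> R) (c : R -> R) (w : X -> R) :
  test_function Omega phi -> smooth c -> L2 st QT w ->
  L2 st QT (fun z => phi z.1 * c z.2 * w z).
Proof.
move=> tphi sc wL; have [B B0 hB] := test_function_bounded tphi.
under eq_fun do rewrite -mulrA.
apply: (@L2bM _ _ _ st QT (measurable_QT T oO) (fun z => phi z.1) _ B) => //.
  apply: measurable_funTS.
  by apply: (measurableT_comp (test_function_measurable tphi) measurable_fst).
exact: L2_timeM.
Qed.

End slices.

Section dt_coefficients.
Variables (R : realType) (n : nat) (Omega : set 'rV[R]_n) (T : R).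
Local Notation X := ('rV[R]_n * measurableTypeR R)%type.
Local Notation X' := ('rV[R]_n * R)%type.
Local Notation mu := (lebesgue_rV R n).
Local Notation leb := (@lebesgue_measure R).
Local Notation st := (lebesgue_st R n).
Local Notation I := (`]0, T[%classic : set (measurableTypeR R)).
Local Notation QT := (QT Omega T).
Hypotheses (oO : open Omega) (bO : bounded_set Omega) (T0 : 0 < T).
Let mO := measurable_Omega oO.
Let mI := measurable_I T.
Let mQ := measurable_QT T oO.
Local Notation sf := (lebesgue_rV_sigma_finite R n).

Variables eta g : X -> R.
Hypotheses (etaL : L2 st QT eta) (gL : L2 st QT g) (dtg : is_dt Omega T eta g).

Lemma integral_derive_cutoff (N : R) : 0 < N ->
  \int[leb]_(t in I) 'D_1 (cutoff T N) t = 0.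
Proof.
move=> N0; have tc := @cutoff_test R T N N0.
have td := test_function_derive (1 : R) tc.
rewrite -[RHS](integral_deriveR (test_functionT tc)).
rewrite Rintegral_mkcond; apply: eq_Rintegral => t _; rewrite /patch.
case: ifPn => // /negP tI; rewrite (test_function_out td)// => h; apply: tI.
by rewrite inE.
Qed.

(** By Cauchy-Schwarz, the strong continuity of the traces passes to their
    pairings with a fixed function. *)
Lemma trace_cvg (W : X -> R) phi s : L2 mu Omega phi -> 0 <= s <= T ->
  (forall t, 0 <= t <= T -> L2 mu Omega (fun x => W (x, t))) ->
  (L2norm mu Omega (fun x => (W (x, t) - W (x, s))%R)
     @[t --> within `[0%R, T]%classic (nbhs s)] --> 0)%E ->
  \int[mu]_(x in Omega) (W (x, t) * phi x) @[t --> within `[0, T]%classic (nbhs s)] -->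
  \int[mu]_(x in Omega) (W (x, s) * phi x).
Proof.
move=> phiL s0T WL /fine_cvgP[Wf Wc]; apply/cvgrPdist_le => e e0.
set K := Num.sqrt (sqn mu Omega phi).
have K0 : 0 < K + 1 by rewrite ltr_wpDl// sqrtr_ge0.
have e1 : 0 < e / (K + 1) by rewrite divr_gt0.
move/cvgrPdist_lt : Wc => /(_ _ e1) Wc.
have : \forall t \near within `[0, T]%classic (nbhs s), `[0, T]%classic t.
  exact: withinT.
apply: filterS3 Wf Wc => t tf tc t0T.
have WtL : L2 mu Omega (fun x => W (x, t)) by apply: WL; move: t0T; rewrite /= in_itv.
have WsL := WL _ s0T.
have dL := L2B mO WtL WsL.
rewrite distrC -RintegralB//; [|exact: L2M_integrable..].
under eq_Rintegral do rewrite -mulrBl.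
apply: le_trans (cauchy_schwarz mO dL phiL) _.
have : Num.sqrt (sqn mu Omega (fun x => W (x, t) - W (x, s))) <= e / (K + 1).
  move: tc; rewrite /= (L2norm_sqrt mO dL)/= sub0r normrN => /ltW.
  by apply: le_trans; exact: ler_norm.
move=> /(ler_wpM2r (sqrtr_ge0 (sqn mu Omega phi))) /le_trans; apply.
by rewrite -/K mulrAC ler_pdivrMr// ler_wpM2l ?(ltW e0)// lerDl.
Qed.

Hypothesis per : time_periodic Omega T eta.

(** Integration by parts in time against a periodic factor [c]: the cut-off
    functions make the test function admissible, and their derivatives only
    see the two equal traces of [eta]. *)
Lemma dt_test (c : R -> R) (phi : 'rV[R]_n -> R) : smooth c -> c 0 = c T ->
  test_function Omega phi ->
  \int[st]_(z in QT) (phi z.1 * c z.2 * g z + phi z.1 * 'D_1 c z.2 * eta z) = 0.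
Proof.
move=> sc c0T tphi; have [W [Weta WL Wc W0T]] := per.
have phiL := test_function_L2 oO bO tphi.
have sc' : smooth ('D_1 c) by exact: smooth_derive.
have FL : L2 st QT (fun z => phi z.1 * c z.2 * g z + phi z.1 * 'D_1 c z.2 * eta z).
  exact: (L2D mQ (L2_tensorM oO tphi sc gL) (L2_tensorM oO tphi sc' etaL)).
set F := fun z => _ in FL.
pose m t := \int[mu]_(x in Omega) (phi x * c t * eta (x, t)).
pose mW t := \int[mu]_(x in Omega) (W (x, t) * phi x).
have mE : {ae leb, forall t, I t -> m t = mW t * c t}.
  have := ae_slice1 sf Weta; have := L2_slice_time oO etaL.
  apply: filterS2 => t etaLt Wt It; rewrite /m /mW.
  have t0T : 0 <= t <= T by move: It; rewrite /= in_itv/= => /andP[a b]; rewrite !ltW.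
  rewrite [RHS]mulrC -(RintegralZl (c t) mO (L2M_integrable mO (WL _ t0T) phiL)).
  apply: ae_eq_Rintegral => //.
  - apply: measurable_funM; last exact: (L2_measurable (etaLt It)).
    by apply: measurable_funM => //; exact: (L2_measurable phiL).
  - apply: measurable_funM => //; apply: measurable_funM; last exact: (L2_measurable phiL).
    exact: (L2_measurable (WL _ t0T)).
  - by apply: filterS Wt => x Wx Ox; rewrite -(Wx (conj Ox It)); ring.
have T00 : 0 <= (0 : R) <= T by rewrite lexx ltW.
have TT : 0 <= T <= T by rewrite lexx ltW.
have mW0T : mW 0 = mW T.
  apply: ae_eq_Rintegral => //.
  - apply: measurable_funM; last exact: (L2_measurable phiL).
    exact: (L2_measurable (WL _ T00)).
  - apply: measurable_funM; last exact: (L2_measurable phiL).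
    exact: (L2_measurable (WL _ TT)).
  - by apply: filterS W0T => x Wx Ox; rewrite Wx.
pose G := mW 0 * c 0.
have near_end s : 0 <= s <= T -> mW s * c s = G -> forall e, 0 < e -> exists2 d, 0 < d &
    forall t, I t -> `|t - s| <= d -> `|mW t * c t - G| <= e.
  move=> s0T sG e e0.
  have cts : mW t * c t @[t --> within `[0, T]%classic (nbhs s)] --> mW s * c s.
    apply: cvgM; first exact: (trace_cvg phiL s0T WL (Wc _ s0T)).
    by apply: cvg_within_filter; exact: (sc 0%N).
  move/cvgrPdist_le : cts => /(_ _ e0); rewrite /prop_near1 /= nbhs_nearE near_withinE => /nbhs_ballP[d /= d0 hd].
  exists (d / 2); first by rewrite divr_gt0.
  move=> t It ts; rewrite distrC -sG; apply: hd.
    by rewrite /ball/= distrC (le_lt_trans ts)// gtr_pMr// invf_lt1// ltr1n.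
  by move: It; rewrite /= !in_itv/= => /andP[a b]; rewrite !ltW.
have hi : leb.-integrable I (EFin \o (fun t => m t - G)).
  apply: (integrableEFinB mI); last exact: integrableEFin_cst mI _ (finite_I T0).
  by have [] := fubini_QT oO (L2_integrable_QT oO bO (L2_tensorM oO tphi sc etaL)).
have b0 : \int[leb]_(t in I) ('D_1 (cutoff T k.+1%:R) t * (m t - G)) @[k --> \oo] --> 0.
  apply: derive_cutoff_cvg0 => // e e0.
  have [d1 d10 h1] := near_end 0 T00 erefl _ e0.
  have [d2 d20 h2] := near_end T TT ltac:(by rewrite -mW0T -c0T) _ e0.
  exists (Num.min d1 d2); first by rewrite lt_min d10.
  apply: filterS mE => t mt It; rewrite mt//.
  have := It; rewrite /= in_itv/= => /andP[t0 tT] [h|h].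
    apply: h1 => //; rewrite subr0 gtr0_norm//.
    by move: h; rewrite le_min => /andP[].
  apply: h2 => //; rewrite distrC gtr0_norm ?subr_gt0//.
  by move: h; rewrite le_min => /andP[].
(* The derivative of the cut-off has mean zero, hence the end value [G] common
   to both ends may be subtracted for free. *)
have aE k : \int[st]_(z in QT) (F z * cutoff T k.+1%:R z.2) =
    - \int[leb]_(t in I) ('D_1 (cutoff T k.+1%:R) t * (m t - G)).
  set N : R := k.+1%:R; have N0 : 0 < N by rewrite ltr0n.
  have tN := @cutoff_test R T N N0.
  have tcN := test_functionM_smooth tN sc.
  have [sN _ _] := tN.
  have sN' : smooth ('D_1 (cutoff T N)) by exact: smooth_derive.
  have [tpsi cdtE] := tensor_test tphi tcN.
  have dE t : 'D_1 (fun t => cutoff T N t * c t) t = cutoff T N t * 'D_1 c t + c t * 'D_1 (cutoff T N) t.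
    by rewrite (deriveM (((sN 1%N).2 1).1 t) (((sc 1%N).2 1).1 t)).
  have sM (f h : R -> R) : smooth f -> smooth h -> smooth (fun t => f t * h t).
    by move=> sf' sh l; exact: CkM.
  have L1 := L2_integrable_QT oO bO (L2_tensorM oO tphi (sM _ _ sN sc) gL).
  have L2' := L2_integrable_QT oO bO (L2_tensorM oO tphi (sM _ _ sN sc') etaL).
  have L3 := L2_integrable_QT oO bO (L2_tensorM oO tphi (sM _ _ sc sN') etaL).
  have := dtg tpsi; under eq_Rintegral do rewrite cdtE dE.
  have -> : \int[st]_(z in QT) (eta z * (phi z.1 * (cutoff T N z.2 * 'D_1 c z.2 +
      c z.2 * 'D_1 (cutoff T N) z.2))) =
    \int[st]_(z in QT) (phi z.1 * (cutoff T N z.2 * 'D_1 c z.2) * eta z) +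
    \int[st]_(z in QT) (phi z.1 * (c z.2 * 'D_1 (cutoff T N) z.2) * eta z).
    by rewrite -RintegralD//; apply: eq_Rintegral => z _; ring.
  have -> : \int[st]_(z in QT) (g z * (phi z.1 * (cutoff T N z.2 * c z.2))) =
     \int[st]_(z in QT) (phi z.1 * (cutoff T N z.2 * c z.2) * g z).
    by apply: eq_Rintegral => z _; ring.
  have -> : \int[st]_(z in QT) (F z * cutoff T N z.2) =
    \int[st]_(z in QT) (phi z.1 * (cutoff T N z.2 * c z.2) * g z) +
    \int[st]_(z in QT) (phi z.1 * (cutoff T N z.2 * 'D_1 c z.2) * eta z).
    by rewrite -RintegralD//; apply: eq_Rintegral => z _; rewrite /F; ring.
  have [_ _ _ ->] := fubini_QT oO L3.
  have -> : \int[leb]_(t in I) \int[mu]_(x in Omega) (phi x * (c t * 'D_1 (cutoff T N) t) * eta (x, t)) =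
      \int[leb]_(t in I) ('D_1 (cutoff T N) t * (m t - G)).
    have [_ Hi _ _] := fubini_QT oO L3.
    have [C hC] := smooth_bounded_I T sN'.
    have mcN : measurable_fun I ('D_1 (cutoff T N) : measurableTypeR R -> R).
      by apply: measurable_funTS; apply: continuous_measurable_fun; exact: (sN' 0%N).
    have ci : leb.-integrable I (EFin \o (fun t => G * 'D_1 (cutoff T N) t)).
      apply: (integrableEFinZ mI); apply: (L2_integrable_I T0).
      exact: (bounded_L2_I T0 mcN hC).
    have mh : measurable_fun I (fun t => m t - G) by have /measurable_int/measurable_EFinP := hi.
    have E0 : \int[leb]_(t in I) (G * 'D_1 (cutoff T N) t) = 0.
      rewrite (RintegralZl _ mI (L2_integrable_I T0 (bounded_L2_I T0 mcN hC))).
      by rewrite integral_derive_cutoff// mulr0.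
    have subE (a b : R) : b = 0 -> a = a - b by move=> ->; rewrite subr0.
    rewrite [LHS](subE _ _ E0) -RintegralB//; apply: ae_eq_Rintegral.
    - exact: mI.
    - by have /measurable_int/measurable_EFinP := integrableEFinB mI Hi ci.
    - exact: measurable_funM.
    have := L2_slice_time oO etaL; apply: filterS => t etaLt It.
    rewrite mulrBr [in X in _ - X = _]mulrC; congr (_ - _).
    rewrite /m -RintegralZl//; last first.
      have := integrableEFinZ mO (c t) (L2M_integrable mO phiL (etaLt It)).
      by apply: eq_integrable => // x _ /=; congr EFin; ring.
    by apply: eq_Rintegral => x _; ring.
  have gen (p q r : R) : p + q = - r -> r + p = - q by move=> h; lra.
  exact: gen.
have a1 : \int[st]_(z in QT) (F z * cutoff T k.+1%:R z.2) @[k --> \oo] --> \int[st]_(z in QT) F z.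
  apply: (@dominated_cvg_real _ _ _ st QT mQ (fun k z => F z * cutoff T k.+1%:R z.2) F (fun z => `|F z|) _ _ _ _ _).2.
  - move=> j; apply: measurable_funM; first exact: (L2_measurable FL).
    apply: measurable_funTS; apply: (measurableT_comp _ measurable_snd).
    apply: continuous_measurable_fun.
    by have [/(_ 0%N)] := @cutoff_test R T j.+1%:R ltac:(by rewrite ltr0n).
  - exact: (L2_measurable FL).
  - apply: aeW => z [_ z2]; rewrite -[X in _ --> X](mulr1 (F z)); apply: cvgM; first exact: cvg_cst.
    by apply: cutoff_cvg; move: z2; rewrite /= in_itv.
  - by have := integrable_norm (L2_integrable_QT oO bO FL); apply: eq_integrable.
  - apply: aeW => z j _; rewrite normrM -[leRHS]mulr1 ler_wpM2l//.
    by rewrite ger0_norm ?cutoff_ge0 ?cutoff_le1.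
have a2 : \int[st]_(z in QT) (F z * cutoff T k.+1%:R z.2) @[k --> \oo] --> (0 : R).
  rewrite (funext aE : (fun k => \int[st]_(z in QT) (F z * cutoff T k.+1%:R z.2)) = _).
  by rewrite -[X in _ --> X]oppr0; exact: (cvgN b0).
exact: (cvg_unique _ a1 a2).
Qed.

(** Fubini's theorem and the fundamental lemma in space turn [dt_test], valid
    for all [phi], into an identity on almost every time line. *)
Lemma dt_test_ae (c : R -> R) : smooth c -> c 0 = c T ->
  {ae mu, forall x, Omega x ->
    \int[leb]_(t in I) (c t * g (x, t)) + \int[leb]_(t in I) ('D_1 c t * eta (x, t)) = 0}.
Proof.
move=> sc c0T.
have sc' : smooth ('D_1 c) by exact: smooth_derive.
have i1 := L2_integrable_QT oO bO (L2_timeM oO sc gL).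
have i2 := L2_integrable_QT oO bO (L2_timeM oO sc' etaL).
have [I1 _ _ _] := fubini_QT oO i1; have [I2 _ _ _] := fubini_QT oO i2.
apply: (fundamental_lemma oO (integrableEFinD mO I1 I2)) => phi tphi.
have j1 := L2_integrable_QT oO bO (L2_tensorM oO tphi sc gL).
have j2 := L2_integrable_QT oO bO (L2_tensorM oO tphi sc' etaL).
have J := integrableEFinD mQ j1 j2.
have [J1 _ JE _] := fubini_QT oO J.
rewrite -[RHS](dt_test sc c0T tphi) [RHS]JE.
apply: ae_eq_Rintegral => //.
- apply: measurable_funM; last by apply: measurable_funTS; exact: test_function_measurable tphi.
  by have /measurable_int/measurable_EFinP := integrableEFinD mO I1 I2.
- by have /measurable_int/measurable_EFinP := J1.
have [C hC] := smooth_bounded_I T sc; have [C' hC'] := smooth_bounded_I T sc'.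
have bM (d : R -> R) D f : smooth d -> (forall t, I t -> `|d t| <= D) -> L2 leb I f ->
    leb.-integrable I (EFin \o (fun t => d t * f t)).
  move=> sd hD fL; apply: (L2M_integrable mI) => //.
  apply: (bounded_L2_I T0 _ hD); apply: measurable_funTS.
  by apply: continuous_measurable_fun; exact: (sd 0%N).
have := L2_slice_space oO gL; have := L2_slice_space oO etaL.
apply: filterS2 => x eL xL Ox.
have k1 := bM c C _ sc hC (xL Ox); have k2 := bM ('D_1 c) C' _ sc' hC' (eL Ox).
rewrite /= -RintegralD// mulrC -RintegralZl//; last exact: (integrableEFinD mI).
by apply: eq_Rintegral => t _; ring.
Qed.

(** Take the cosine, then the sine of frequency [k] for [c]. *)
Lemma dt_fourier (k : nat) : {ae mu, forall x, Omega x ->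
  ac T (fun t => g (x, t)) k = k%:R * omega T * as_ T (fun t => eta (x, t)) k /\
  as_ T (fun t => g (x, t)) k = - (k%:R * omega T * ac T (fun t => eta (x, t)) k)}.
Proof.
set w := k%:R * omega T; have [c1 s0] := period T0 k.
have hT a b : a * cos (w * 0) + b * sin (w * 0) = a * cos (w * T) + b * sin (w * T).
  by rewrite mulr0 cos0 sin0 c1 s0.
have h a b := @dt_test_ae (fun t => a * cos (w * t) + b * sin (w * t))
  (fun l => @Ck_trig R l w a b) (hT a b).
have dE a b t : 'D_1 (fun t => a * cos (w * t) + b * sin (w * t)) t =
    b * w * cos (w * t) + (- (a * w)) * sin (w * t).
  by have [_ ->] := is_derive_trig w a b t.
have := L2_slice_space oO etaL.
apply: filterS3 (h 1 0) (h 0 1) => x hc hs eL Ox.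
have k1 := L2M_integrable mI (eL Ox) (L2_fc T0 k); have k2 := L2M_integrable mI (eL Ox) (L2_fs T0 k).
have solve (p q r : R) : p + - w * q = 0 -> r * p = w * (r * q) by move=> /eqP; rewrite mulNr subr_eq0 => /eqP ->; ring.
have solve' (p q r : R) : p + w * q = 0 -> r * p = - (w * (r * q)) by move=> /eqP; rewrite addr_eq0 => /eqP ->; ring.
split; [apply: solve; rewrite -[RHS](hc Ox)|apply: solve'; rewrite -[RHS](hs Ox)].
- congr (_ + _); first by apply: eq_Rintegral => t _; rewrite /fc -/w; ring.
  by rewrite -(RintegralZl _ mI k2); apply: eq_Rintegral => t _; rewrite dE /fs -/w; ring.
- congr (_ + _); first by apply: eq_Rintegral => t _; rewrite /fs -/w; ring.
  by rewrite -(RintegralZl _ mI k1); apply: eq_Rintegral => t _; rewrite dE /fc -/w; ring.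
Qed.

End dt_coefficients.

(** * The energy of order one half in time *)

Section space_time_energy.
Variables (R : realType) (n : nat) (Omega : set 'rV[R]_n) (T : R).
Local Notation X := ('rV[R]_n * measurableTypeR R)%type.
Local Notation mu := (lebesgue_rV R n).
Local Notation leb := (@lebesgue_measure R).
Local Notation st := (lebesgue_st R n).
Local Notation I := (`]0, T[%classic : set (measurableTypeR R)).
Local Notation QT := (QT Omega T).
Hypotheses (oO : open Omega) (bO : bounded_set Omega) (T0 : 0 < T).
Let mO := measurable_Omega oO.
Let mI := measurable_I T.
Let mQ := measurable_QT T oO.
Local Notation sf := (lebesgue_rV_sigma_finite R n).

Lemma ae_st_fst (P : 'rV[R]_n -> Prop) : {ae mu, forall x, Omega x -> P x} ->
  {ae st, forall z, QT z -> P z.1}.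
Proof.
move=> [N [mN N0 PN]]; exists (N `*` setT); split.
- exact: measurableX.
- rewrite /lebesgue_st/= product_measure1E//.
  by rewrite N0 mul0e.
- by move=> z /= h; split => //; apply: PN => /= h'; apply: h => -[Oz _]; exact: h'.
Qed.

Lemma fcosE (w : X -> R) k x : fcos T w k x = ac T (fun t => w (x, t)) k.
Proof. by []. Qed.

Lemma fsinE (w : X -> R) k x : fsin T w k x = as_ T (fun t => w (x, t)) k.
Proof. by []. Qed.

Lemma sqn_slices (w : X -> R) : L2 st QT w ->
  mu.-integrable Omega (EFin \o (fun x => sqn leb I (fun t => w (x, t)))) /\
  \int[mu]_(x in Omega) sqn leb I (fun t => w (x, t)) = sqn st QT w.
Proof.
by move=> wL; have [h1 _ h2 _] := fubini_QT oO (L2_sq_integrable wL).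
Qed.

Lemma coef_sq_le (f : measurableTypeR R -> R) k : L2 leb I f ->
  ac T f k ^+ 2 + as_ T f k ^+ 2 <= 4 / T * sqn leb I f.
Proof.
move=> fL; have := bessel T0 k fL; rewrite /fenergy big_ord_recr/=.
set S := \sum_(_ < k) _; have S0 : 0 <= S.
  apply: sumr_ge0 => i _; apply: mulr_ge0; first exact: ltW (kap_gt0 R i).
  by rewrite addr_ge0// -expr2 sqr_ge0.
have : 2^-1 <= kap R k by rewrite /kap; case: ifP => _; lra.
rewrite -!expr2; set q := _ + _ ^+ 2; have q0 : 0 <= q by rewrite addr_ge0 ?sqr_ge0.
move=> k2 h; have : T / 2 * (2^-1 * q) <= T / 2 * (S + kap R k * q).
  rewrite ler_wpM2l ?divr_ge0 ?(ltW T0)// (le_trans (ler_wpM2r q0 k2))// lerDr//.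
by move=> /le_trans/(_ h) h'; rewrite mulrAC ler_pdivlMr//; lra.
Qed.

(** Bessel's inequality on almost every time line. *)
Lemma fcoef_L2 (w : X -> R) k : L2 st QT w ->
  L2 mu Omega (fcos T w k) /\ L2 mu Omega (fsin T w k).
Proof.
move=> wL; have [si _] := sqn_slices wL.
have mt a b : measurable_fun Omega (fun x => 2 / T * \int[leb]_(t in I)
    ((a * cos (k%:R * omega T * t) + b * sin (k%:R * omega T * t)) * w (x, t))).
  apply: measurable_funM; first exact: measurable_cst.
  have [h _ _ _] := fubini_QT oO (L2_integrable_QT oO bO
    (L2_timeM oO (fun l => Ck_trig l (k%:R * omega T) a b) wL)).
  by have /measurable_int/measurable_EFinP := h.
have mc : measurable_fun Omega (fcos T w k).
  apply: eq_measurable_fun (mt 1 0) => x _; congr (_ * _).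
  by apply: eq_Rintegral => t _; rewrite mul1r mul0r addr0 mulrC.
have ms : measurable_fun Omega (fsin T w k).
  apply: eq_measurable_fun (mt 0 1) => x _; congr (_ * _).
  by apply: eq_Rintegral => t _; rewrite mul1r mul0r add0r mulrC.
have gi := integrableEFinZ mO (4 / T) si.
have := L2_slice_space oO wL => sl; split; apply: (L2_ae_le _ _ gi) => //.
- apply: filterS sl => x wx Ox; rewrite (le_trans _ (coef_sq_le k (wx Ox)))//.
  by rewrite lerDl sqr_ge0.
- apply: filterS sl => x wx Ox; rewrite (le_trans _ (coef_sq_le k (wx Ox)))//.
  by rewrite lerDr sqr_ge0.
Qed.

(** Partial sums of the squared seminorm of order one half in time, up to the
    factor [T / 2]. *)
Definition half_norm (w : X -> R) (N : nat) : R := \sum_(1 <= k < N.+1)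
  k%:R * omega T * (sqn mu Omega (fcos T w k) + sqn mu Omega (fsin T w k)).

(** A bound on partial sums, unlike the extended-real series, is readily
    transferred to a difference of functions. *)
Lemma half_seriesP (w : X -> R) : L2 st QT w ->
  ((T / 2)%:E * \sum_(1 <= k <oo) (k%:R * omega T)%:E *
     (L2norm mu Omega (fcos T w k) ^+ 2 + L2norm mu Omega (fsin T w k) ^+ 2)
       < +oo)%E <-> exists M, forall N, half_norm w N <= M.
Proof.
move=> wL.
have T2 : 0 < T / 2 by rewrite divr_gt0.
pose u k := k%:R * omega T * (sqn mu Omega (fcos T w k) + sqn mu Omega (fsin T w k)).
have u0 k : 0 <= u k.
  apply: mulr_ge0; last by apply: addr_ge0; exact: sqn_ge0.
  by apply: mulr_ge0; rewrite ?ler0n// ltW// omega_gt0.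
have uE : (\sum_(1 <= k <oo) (k%:R * omega T)%:E *
     (L2norm mu Omega (fcos T w k) ^+ 2 + L2norm mu Omega (fsin T w k) ^+ 2) =
   \sum_(1 <= k <oo) (u k)%:E)%E.
  apply: eq_eseriesr => k _; have [h1 h2] := fcoef_L2 k wL.
  by rewrite !L2norm_sqn.
rewrite uE; have S0 : (0 <= \sum_(1 <= k <oo) (u k)%:E)%E.
  by apply: nneseries_ge0 => k _ _; rewrite lee_fin.
split.
  move=> h; have Sf : (\sum_(1 <= k <oo) (u k)%:E)%E \is a fin_num.
    rewrite ge0_fin_numE// ltNge leye_eq; apply/negP => /eqP Soo.
    by move: h; rewrite Soo gt0_muley ?lte_fin// ltxx.
  exists (fine (\sum_(1 <= k <oo) (u k)%:E)%E) => N.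
  rewrite -lee_fin fineK// -[half_norm w N]/(\sum_(1 <= k < N.+1) u k) -sumEFin.
  by apply: nneseries_lim_ge => k _ _; rewrite lee_fin.
move=> [M hM]; apply: (@le_lt_trans _ _ ((T / 2)%:E * M%:E)%E); last by rewrite -EFinM ltry.
apply: lee_wpmul2l; first by rewrite lee_fin ltW.
apply: lime_le; first by apply: is_cvg_nneseries => k _ _; rewrite lee_fin.
apply: nearW => N; rewrite sumEFin lee_fin; case: N => [|N]; last exact: hM.
by rewrite big_geq// (le_trans _ (hM 0%N))// /half_norm big_geq.
Qed.

Lemma fcoefB (y eta : X -> R) : L2 st QT y -> L2 st QT eta ->
  {ae mu, forall x, Omega x -> forall k,
    fcos T (fun z => y z - eta z) k x = fcos T y k x - fcos T eta k x /\
    fsin T (fun z => y z - eta z) k x = fsin T y k x - fsin T eta k x}.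
Proof.
move=> yL eL; have := L2_slice_space oO yL; have := L2_slice_space oO eL.
apply: filterS2 => x ex yx Ox k.
have E (f h : measurableTypeR R -> R) : (fun t => f t - h t) = (fun t => f t + - 1 * h t).
  by apply/funext => t; rewrite mulN1r.
rewrite !fcosE !fsinE !(E (fun t => y (x, t))).
by rewrite (ac_linear T0 (-1) k (yx Ox) (ex Ox)) (as_linear T0 (-1) k (yx Ox) (ex Ox)) !mulN1r.
Qed.

Lemma half_normB (y eta : X -> R) N : L2 st QT y -> L2 st QT eta ->
  half_norm (fun z => y z - eta z) N <= 2 * (half_norm y N + half_norm eta N).
Proof.
have gen (W a b c d p q : R) : 0 <= W -> p <= 2 * (a + b) -> q <= 2 * (c + d) ->
    W * (p + q) <= 2 * (W * (a + c) + W * (b + d)).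
  by move=> W0 hp hq; rewrite -mulrDr [leRHS]mulrCA; apply: ler_wpM2l => //; lra.
move=> yL eL; rewrite /half_norm -big_split/= mulr_sumr; apply: ler_sum => k _.
have [yc ys] := fcoef_L2 k yL; have [ec es] := fcoef_L2 k eL.
have [dc ds] := fcoef_L2 k (L2B mQ yL eL).
have B := fcoefB yL eL.
have Bc : sqn mu Omega (fcos T (fun z => y z - eta z) k) =
    sqn mu Omega (fun x => fcos T y k x - fcos T eta k x).
  apply: ae_eq_sqn => //; [exact: L2_measurable dc|exact: (L2_measurable (L2B mO yc ec))|].
  by apply: filterS B => x h Ox; have [] := h Ox k.
have Bs : sqn mu Omega (fsin T (fun z => y z - eta z) k) =
    sqn mu Omega (fun x => fsin T y k x - fsin T eta k x).
  apply: ae_eq_sqn => //; [exact: L2_measurable ds|exact: (L2_measurable (L2B mO ys es))|].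
  by apply: filterS B => x h Ox; have [] := h Ox k.
have := sqnB_le mO yc ec; have := sqnB_le mO ys es; rewrite -Bc -Bs => hs hc.
have w0 : 0 <= k%:R * omega T by rewrite mulr_ge0 ?ler0n// ltW// omega_gt0.
exact: gen.
Qed.

Lemma fenergyE N (f h : measurableTypeR R -> R) : fenergy T N f h =
  T / 2 * (kap R 0 * (ac T f 0 * ac T h 0) +
           \sum_(1 <= k < N.+1) (ac T f k * ac T h k + as_ T f k * as_ T h k)).
Proof.
rewrite /fenergy -(big_mkord xpredT (fun k => kap R k * (ac T f k * ac T h k + as_ T f k * as_ T h k))).
rewrite big_ltn// as_0 mul0r addr0; congr (_ * (_ + _)).
by apply: eq_big_nat => -[|k]// _; rewrite /kap/= mul1r.
Qed.

Lemma measurable_energy (g e : X -> R) N : L2 st QT g -> L2 st QT e ->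
  measurable_fun Omega (fun x => fenergy T N (fun t => g (x, t)) (fun t => e (x, t))).
Proof.
move=> gL eL; under eq_fun do rewrite fenergyE.
have hk k : mu.-integrable Omega (EFin \o (fun x => fcos T g k x * fcos T e k x + fsin T g k x * fsin T e k x)).
  have [gc gs] := fcoef_L2 k gL; have [ec es] := fcoef_L2 k eL.
  by apply: (integrableEFinD mO); exact: L2M_integrable.
have [hi _] := Rintegral_sum_nat mO 1 N.+1 hk.
have [gc _] := fcoef_L2 0 gL; have [ec _] := fcoef_L2 0 eL.
have := integrableEFinZ mO (T / 2) (integrableEFinD mO
  (integrableEFinZ mO (kap R 0) (L2M_integrable mO gc ec)) hi).
by move=> /measurable_int/measurable_EFinP.
Qed.

Section time_derivative.
Variables eta g : X -> R.
Hypotheses (etaL : L2 st QT eta) (gL : L2 st QT g) (dtg : is_dt Omega T eta g).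
Hypothesis per : time_periodic Omega T eta.

Lemma dt_fourier_all : {ae mu, forall x, Omega x -> forall k,
  fcos T g k x = k%:R * omega T * fsin T eta k x /\
  fsin T g k x = - (k%:R * omega T * fcos T eta k x)}.
Proof.
have : {ae mu, forall x k, Omega x -> fcos T g k x = k%:R * omega T * fsin T eta k x /\
  fsin T g k x = - (k%:R * omega T * fcos T eta k x)}.
  by apply: ae_foralln => k; exact: dt_fourier.
by apply: filterS => x h Ox k; exact: h.
Qed.

(** The coefficients of [g] are those of [eta] times [k * omega], up to a
    quarter turn, and [k <= k ^ 2]: this is Bessel's inequality for [g]. *)
Lemma half_norm_dt : exists M, forall N, half_norm eta N <= M.
Proof.
have w0 := omega_gt0 T0; set w := omega T in w0.
have [gi gE] := sqn_slices gL.
exists (w^-1 * (2 / T) * sqn st QT g) => N.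
pose F k x := k%:R * w * (fcos T eta k x ^+ 2 + fsin T eta k x ^+ 2).
have Fi k : mu.-integrable Omega (EFin \o F k).
  have [hc hs] := fcoef_L2 k etaL.
  apply: (integrableEFinZ mO); apply: (integrableEFinD mO); exact: L2_sq_integrable.
have [Si SE] := Rintegral_sum_nat mO 1 N.+1 Fi.
have -> : half_norm eta N = \int[mu]_(x in Omega) \sum_(1 <= k < N.+1) F k x.
  rewrite SE; apply: eq_bigr => k _; have [hc hs] := fcoef_L2 k etaL.
  have i1 := L2_sq_integrable hc; have i2 := L2_sq_integrable hs.
  by rewrite /F (RintegralZl _ mO (integrableEFinD mO i1 i2)) (RintegralD mO i1 i2).
rewrite -gE -(RintegralZl _ mO gi); apply: (ae_le_Rintegral mO Si).
  exact: (integrableEFinZ mO).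
have := L2_slice_space oO gL; have := dt_fourier_all.
apply: filterS2 => x gx gxL Ox.
have := bessel T0 N (gxL Ox); rewrite fenergyE -!expr2.
set S := \sum_(_ <= _ < _) _ => h.
have : \sum_(1 <= k < N.+1) F k x <= w^-1 * S.
  rewrite mulr_sumr; apply: ler_sum_nat => k /andP[k1 _].
  have [h1 h2] := gx Ox k; rewrite -[ac T _ k]fcosE -[as_ T _ k]fsinE h1 h2 -/w.
  have gen (K W a b : R) : 1 <= K -> 0 < W ->
      K * W * (a ^+ 2 + b ^+ 2) <= W^-1 * ((K * W * b) ^+ 2 + (- (K * W * a)) ^+ 2).
    move=> K1 W0; have -> : W^-1 * ((K * W * b) ^+ 2 + (- (K * W * a)) ^+ 2) =
        K * (K * W * (a ^+ 2 + b ^+ 2)) by field; rewrite gt_eqF.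
    have K0 : 0 <= K by rewrite (le_trans _ K1).
    by rewrite ler_peMl// mulr_ge0 ?addr_ge0 ?sqr_ge0// mulr_ge0// ltW.
  by apply: gen => //; rewrite ler1n.
move=> /le_trans; apply; rewrite -mulrA ler_wpM2l ?invr_ge0 ?(ltW w0)//.
have : T / 2 * S <= sqn leb I (fun t => g (x, t)).
  apply: le_trans h; rewrite ler_wpM2l ?divr_ge0 ?(ltW T0)// lerDr.
  by apply: mulr_ge0; [exact: ltW (kap_gt0 R 0)|exact: sqr_ge0].
rewrite mulrAC ler_pdivrMr// mulrC => h'.
by rewrite mulrAC ler_pdivlMr// [leRHS]mulrC.
Qed.

Variables (sigma : 'rV[R]_n -> R) (s_hi : R).
Hypothesis msigma : measurable_fun Omega sigma.
Hypothesis hsigma : {ae mu, forall x, Omega x -> `|sigma x| <= s_hi}.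

(** The pairing vanishes when both arguments are [e = y - eta], so that only the
    summand [eta] of [y] contributes; its coefficients, once multiplied by
    [k * omega], are those of [g]. *)
Lemma fourier_perp_energy (y : X -> R) N : L2 st QT y ->
  let e := fun z => y z - eta z in
  T / 2 * (\sum_(1 <= k < N.+1) k%:R * omega T * fourier_perp Omega T sigma y e k) =
  \int[mu]_(x in Omega)
    (sigma x * fenergy T N (fun t => g (x, t)) (fun t => e (x, t))).
Proof.
move=> yL e; have eL : L2 st QT e := L2B mQ yL etaL.
have sbM f : L2 mu Omega f -> L2 mu Omega (fun x => sigma x * f x) := L2_ae_bM mO msigma hsigma.
pose F k x := sigma x * (fcos T y k x * - fsin T e k x + fsin T y k x * fcos T e k x).
have Fi k : mu.-integrable Omega (EFin \o F k).
  have [yc ys] := fcoef_L2 k yL; have [ec es] := fcoef_L2 k eL.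
  have := integrableEFinB mO (L2M_integrable mO (sbM _ ys) ec) (L2M_integrable mO (sbM _ yc) es).
  by apply: eq_integrable => // x _; rewrite /F/=; congr EFin; ring.
have Fi' k := integrableEFinZ mO (k%:R * omega T) (Fi k).
have [Si SE] := Rintegral_sum_nat mO 1 N.+1 Fi'.
have -> : \sum_(1 <= k < N.+1) k%:R * omega T * fourier_perp Omega T sigma y e k =
    \int[mu]_(x in Omega) \sum_(1 <= k < N.+1) k%:R * omega T * F k x.
  by rewrite SE; apply: eq_bigr => k _; rewrite (RintegralZl _ mO (Fi k)).
rewrite -(RintegralZl _ mO Si); apply: ae_eq_Rintegral => //.
- by have /measurable_int/measurable_EFinP := integrableEFinZ mO (T / 2) Si.
- by apply: measurable_funM => //; exact: measurable_energy.
have := fcoefB yL etaL; have := dt_fourier_all.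
apply: filterS2 => x gx ex Ox; rewrite fenergyE.
have [g0 _] := gx Ox 0%N; rewrite -[ac T _ 0]fcosE g0 !mul0r mulr0 add0r.
rewrite [RHS]mulrCA; congr (_ * _); rewrite mulr_sumr; apply: eq_bigr => k _.
have [h1 h2] := gx Ox k; have [h3 h4] := ex Ox k.
rewrite -!fcosE -!fsinE h1 h2 /F -/e.
have -> : fcos T y k x = fcos T e k x + fcos T eta k x by rewrite h3 subrK.
have -> : fsin T y k x = fsin T e k x + fsin T eta k x by rewrite h4 subrK.
by rewrite /e; ring.
Qed.

Lemma measurable_fst_QT : measurable_fun QT (fun z => sigma z.1).
Proof.
apply: (measurable_comp mO _ msigma); last exact: measurable_funTS measurable_fst.
by move=> _ [z [Oz _] <-].
Qed.

(** Parseval's identity holds on almost every time line, and [fenergy_le]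
    provides a dominating function. *)
Lemma energy_cvg (e : X -> R) : L2 st QT e ->
  \int[mu]_(x in Omega)
    (sigma x * fenergy T N (fun t => g (x, t)) (fun t => e (x, t))) @[N --> \oo] -->
  \int[st]_(z in QT) (sigma z.1 * g z * e z).
Proof.
move=> eL; have sgL : L2 st QT (fun z => sigma z.1 * g z).
  apply: (L2_ae_bM mQ (C := s_hi)) => //; first exact: measurable_fst_QT.
  exact: ae_st_fst hsigma.
have [Ii _ -> _] := fubini_QT oO (L2M_integrable mQ sgL eL).
have [gi _] := sqn_slices gL; have [ei _] := sqn_slices eL.
apply: (dominated_cvg_real mO (g := fun x => s_hi * (2^-1 * (sqn leb I (fun t => g (x, t)) +
   sqn leb I (fun t => e (x, t)))))  _ _ _ _ _).2.
- by move=> N; apply: measurable_funM => //; exact: measurable_energy.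
- by have /measurable_int/measurable_EFinP := Ii.
- have := L2_slice_space oO gL; have := L2_slice_space oO eL.
  apply: filterS2 => x exL gxL Ox.
  have -> : \int[leb]_(t in I) (sigma x * g (x, t) * e (x, t)) =
     sigma x * \int[leb]_(t in I) (g (x, t) * e (x, t)).
    rewrite -(RintegralZl _ mI (L2M_integrable mI (gxL Ox) (exL Ox))).
    by apply: eq_Rintegral => t _; rewrite mulrA.
  by apply: cvgM; [exact: cvg_cst|exact: (parseval T0 (gxL Ox) (exL Ox))].
- by do 2!apply: (integrableEFinZ mO); exact: (integrableEFinD mO).
have := L2_slice_space oO gL; have := L2_slice_space oO eL.
apply: filterS3 hsigma => x sx exL gxL N Ox; rewrite normrM ler_pM//; first exact: sx.
exact: (fenergy_le T0 N (gxL Ox) (exL Ox)).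
Qed.

End time_derivative.

End space_time_energy.

(** * Functions vanishing on the lateral boundary *)

Section real_inequalities.
Variable R : realType.

Lemma quarter_sum (a b c e : R) : a < e / 4 -> b < e / 4 -> c <= 2 * (a + b) -> c < e.
Proof. lra. Qed.

Lemma approx_chain (w dw p gp gw C d : R) : w <= dw + p -> dw <= d -> p <= C * gp ->
  C * gp <= C * (gw + d) -> w <= C * gw + (d + C * d).
Proof. by rewrite mulrDr; lra. Qed.

End real_inequalities.

Section lateral.
Variables (R : realType) (n : nat) (Omega : set 'rV[R]_n) (T : R).
Local Notation X := ('rV[R]_n * measurableTypeR R)%type.
Local Notation X' := ('rV[R]_n * R)%type.
Local Notation mu := (lebesgue_rV R n).
Local Notation leb := (@lebesgue_measure R).
Local Notation st := (lebesgue_st R n).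
Local Notation I := (`]0, T[%classic : set (measurableTypeR R)).
Local Notation QT := (QT Omega T).
Local Notation gx := (gradx Omega T).
Hypotheses (oO : open Omega) (bO : bounded_set Omega) (T0 : 0 < T).
Let mO := measurable_Omega oO.
Let mI := measurable_I T.
Let mQ := measurable_QT T oO.

Lemma cgradxB (phi psi : X -> R) z : smooth (phi : X' -> R) -> smooth (psi : X' -> R) ->
  cgradx (fun z => phi z - psi z) z = cgradx phi z - cgradx psi z.
Proof.
move=> sphi spsi; apply/rowP => i; rewrite !mxE.
have := @deriveB R X' R phi psi z (delta_mx 0 i, 0)
  (((sphi 1%N).2 _).1 z) (((spsi 1%N).2 _).1 z).
exact.
Qed.

Lemma gradxB (y eta : X -> R) : H1_x Omega T y -> H1_x Omega T eta ->
  H1_x Omega T (fun z => y z - eta z) /\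
  {ae st, forall z, QT z -> gx (fun z => y z - eta z) z = gx y z - gx eta z}.
Proof.
move=> yH eH; have [_ gy] := gradxP yH; have [_ ge] := gradxP eH.
have [yL _] := yH; have [eL _] := eH.
have gyL i := gradx_L2 oO i yH; have geL i := gradx_L2 oO i eH.
have gL i : L2 st QT (fun z => (gx y z - gx eta z) 0 i).
  by under eq_fun do rewrite rowBE; exact: (L2B mQ).
have dL := L2B mQ yL eL.
have gB : is_gradx Omega T (fun z => y z - eta z) (fun z => gx y z - gx eta z).
  move=> phi tphi i; have pL := test_function_L2_QT oO bO tphi.
  have cL : L2 st QT (fun z => cgradx phi z 0 i).
    under eq_fun do rewrite mxE.
    exact: (test_function_L2_QT oO bO (test_function_derive _ tphi)).
  under eq_Rintegral do rewrite mulrBl.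
  under [in RHS]eq_Rintegral do rewrite rowBE mulrBl.
  rewrite !RintegralB//; try exact: (L2M_integrable mQ).
  by rewrite (gy _ tphi) (ge _ tphi) opprB opprK addrC.
have H : H1_x Omega T (fun z => y z - eta z).
  by split=> //; exists (fun z => gx y z - gx eta z); split=> //; apply/(L2vP st mQ).
split=> //; apply: (is_gradx_unique oO bO _ gL (gradxP H).2 gB).
by move=> i; exact: gradx_L2.
Qed.

Lemma lateral_measurable phi : lateral_test Omega phi -> measurable_fun QT phi.
Proof. by move=> [sphi _]; apply: measurable_funTS; exact: smooth_measurable_QT. Qed.

Lemma lateral_vmeasurable phi i : lateral_test Omega phi ->
  measurable_fun QT (fun z => cgradx phi z 0 i).
Proof. by move=> lphi; apply: measurable_funTS; exact: measurable_cgradx lphi. Qed.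

(** Both parts of the H^{1,0} distance between [w] and [phi] are small. *)
Definition lateral_close (w phi : X -> R) (e : R) : Prop :=
  [/\ L2 st QT phi, forall i, L2 st QT (fun z => cgradx phi z 0 i),
      sqn st QT (fun z => w z - phi z) < e &
      sqn st QT (fun z => enorm (gx w z - cgradx phi z)) < e].

(** An approximant at finite distance from a square-integrable function is
    itself square integrable. *)
Lemma lateral_cvgP (w : X -> R) (phi : nat -> X -> R) : H1_x Omega T w ->
  (forall k, lateral_test Omega (phi k)) ->
  ((L2norm st QT (fun z => (w z - phi k z)%R) @[k --> \oo] --> 0)%E /\
   (L2vnorm st QT (fun z => (gx w z - cgradx (phi k) z)%R) @[k --> \oo] --> 0)%E) <->
  (forall e, 0 < e -> \forall k \near \oo, lateral_close w (phi k) e).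
Proof.
move=> wH lphi; have [wL _] := wH; have gwL i := gradx_L2 oO i wH.
have mB k : measurable_fun QT (fun z => w z - phi k z).
  by apply: measurable_funB; [exact: L2_measurable wL|exact: lateral_measurable].
have mg k i : measurable_fun QT (fun z => (gx w z - cgradx (phi k) z) 0 i).
  under eq_fun do rewrite rowBE; apply: measurable_funB; last exact: lateral_vmeasurable.
  exact: L2_measurable (gwL i).
rewrite /L2vnorm !(L2norm_cvg0P st QT); split.
  move=> [h1 h2] e e0; apply: filterS2 (h1 _ e0) (h2 _ e0) => k k1 k2.
  have [L1 s1] := sqn_lt mQ (mB k) k1.
  have [L2' s2] := sqn_lt mQ (measurable_enorm (mg k)) k2.
  have gL i : L2 st QT (fun z => (gx w z - cgradx (phi k) z) 0 i).
    exact: (L2_le mQ (mg k i) (L2_sq_integrable L2') (fun z _ => coord_enorm _ i)).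
  split=> //.
    have := L2B mQ wL L1; congr L2; apply/funext => z; ring.
  move=> i; have := L2B mQ (gwL i) (gL i); congr L2; apply/funext => z.
  by rewrite rowBE; ring.
move=> h; split=> e e0; apply: filterS (h _ e0) => k [pL gL s1 s2].
  by rewrite integral_sqn ?lte_fin//; exact: (L2B mQ).
rewrite integral_sqn ?lte_fin//; apply: (L2_enorm mQ) => i.
by under eq_fun do rewrite rowBE; exact: (L2B mQ).
Qed.

Lemma lateral_approx (w : X -> R) (e : R) : H1_x Omega T w -> zero_lateral Omega T w ->
  0 < e -> exists phi, lateral_test Omega phi /\ lateral_close w phi e.
Proof.
move=> wH [phi [lphi h1 h2]] e0.
have [/(_ (conj h1 h2) _ e0) h _] := lateral_cvgP wH lphi.
have [k hk] := filter_ex h; exists (phi k); split; [exact: lphi|exact: hk].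
Qed.

Lemma zero_lateralB (y eta : X -> R) : H1_x Omega T y -> H1_x Omega T eta ->
  zero_lateral Omega T y -> zero_lateral Omega T eta ->
  zero_lateral Omega T (fun z => y z - eta z).
Proof.
move=> yH eH [phi [lphi p1 p2]] [psi [lpsi q1 q2]].
have [dH dg] := gradxB yH eH.
have lB k : lateral_test Omega (fun z => phi k z - psi k z).
  have [sphi [K [cK KO Kphi]]] := lphi k; have [spsi [K' [cK' KO' Kpsi]]] := lpsi k.
  split.
    by move=> l; apply: (@CkD R X'); [exact: sphi|apply: (@CkN R X'); exact: spsi].
  exists (K `|` K'); split; first exact: compactU.
    by move=> x [/KO|/KO'].
  by move=> x t /not_orP[a b]; rewrite Kphi// Kpsi// subrr.
have [_ hB] := lateral_cvgP dH lB; have {hB}[] : (L2norm st QT (fun z => (y z - eta z - (phi k z - psi k z))%R) @[k --> \oo] --> 0)%E /\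
   (L2vnorm st QT (fun z => (gx (fun z => y z - eta z) z - cgradx (fun z => phi k z - psi k z) z)%R) @[k --> \oo] --> 0)%E.
  apply: hB => e e0; have e4 : 0 < e / 4 by rewrite divr_gt0.
  have [/(_ (conj p1 p2) _ e4) hy _] := lateral_cvgP yH lphi.
  have [/(_ (conj q1 q2) _ e4) he _] := lateral_cvgP eH lpsi.
  apply: filterS2 hy he => k [pL gpL s1 s2] [qL gqL t1 t2].
  have [yL _] := yH; have [eL _] := eH.
  have gyL i := gradx_L2 oO i yH; have geL i := gradx_L2 oO i eH.
  have gdL i := gradx_L2 oO i dH.
  have cE z : cgradx (fun z => phi k z - psi k z) z = cgradx (phi k) z - cgradx (psi k) z.
    by apply: cgradxB; [have [] := lphi k|have [] := lpsi k].
  have sum4 a b c := @quarter_sum R a b c e.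
  have cL i : L2 st QT (fun z => cgradx (fun z => phi k z - psi k z) z 0 i).
    by under eq_fun do rewrite cE rowBE; exact: (L2B mQ).
  split=> //; first exact: (L2B mQ).
    apply: (sum4 _ _ _ s1 t1); 
    have -> : (fun z => y z - eta z - (phi k z - psi k z)) =
        (fun z => (y z - phi k z) - (eta z - psi k z)).
      apply/funext => z; rewrite !opprB addrACA [RHS]addrACA.
      by congr (_ + _); rewrite addrC.
    by apply: (sqnB_le mQ); exact: (L2B mQ).
  apply: (sum4 _ _ _ s2 t2).
  have LB (f g : X -> 'rV[R]_n) : (forall i, L2 st QT (fun z => f z 0 i)) ->
      (forall i, L2 st QT (fun z => g z 0 i)) -> L2 st QT (fun z => enorm (f z - g z)).
    move=> fL gL; apply: (L2_enorm mQ) => i.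
    by under eq_fun do rewrite rowBE; exact: (L2B mQ).
  have A1 := L2_sq_integrable (LB _ _ gyL gpL).
  have A2 := L2_sq_integrable (LB _ _ geL gqL).
  rewrite -(RintegralD mQ A1 A2) -(RintegralZl _ mQ (integrableEFinD mQ A1 A2)).
  apply: (ae_le_Rintegral mQ).
  - exact: (L2_sq_integrable (LB _ _ gdL cL)).
  - exact: (integrableEFinZ mQ _ (integrableEFinD mQ A1 A2)).
  apply: filterS dg => z gz Qz; rewrite gz// cE.
  rewrite (_ : _ - _ = (gx y z - cgradx (phi k) z) - (gx eta z - cgradx (psi k) z)).
    exact: enormB_sq_le.
  by rewrite !opprB addrACA [in RHS]addrACA; congr (_ + _); rewrite addrC.
by move=> h1 h2; exists (fun k z => phi k z - psi k z); split.
Qed.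

Variable CF : R.
Hypothesis friedrichs : forall w, H10 Omega w ->
  (L2norm mu Omega w <= CF%:E * L2vnorm mu Omega (grad Omega w))%E.
Hypothesis CF0 : 0 < CF.

Lemma le_sqrt_lt (a e : R) : 0 < e -> a < e ^+ 2 -> Num.sqrt a <= e.
Proof.
move=> e0 ae; rewrite -[e]gtr0_norm// -sqrtr_sqr ler_wsqrtr// ltW//.
Qed.

(** Pass to the limit in [poincare_test]. *)
Lemma poincare (w : X -> R) : H1_x Omega T w -> zero_lateral Omega T w ->
  Num.sqrt (sqn st QT w) <= CF * Num.sqrt (sqn st QT (fun z => enorm (gx w z))).
Proof.
move=> wH w0; have [wL _] := wH; have gwL i := gradx_L2 oO i wH.
apply/ler_addgt0Pr => e e0.
set d := e / (1 + CF); have d0 : 0 < d by rewrite divr_gt0// addr_gt0.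
have d20 : 0 < d ^+ 2 by rewrite exprn_gt0.
have [phi [lphi [pL gpL s1 s2]]] := lateral_approx wH w0 d20.
have {}s1 := le_sqrt_lt d0 s1; have {}s2 := le_sqrt_lt d0 s2.
have dL := L2B mQ wL pL.
have eL : L2 st QT (fun z => enorm (gx w z)) by exact: L2_enorm.
have cL : L2 st QT (fun z => enorm (cgradx phi z)) by exact: L2_enorm.
have edL : L2 st QT (fun z => enorm (gx w z - cgradx phi z)).
  by apply: (L2_enorm mQ) => i; under eq_fun do rewrite rowBE; exact: (L2B mQ).
have t1 : Num.sqrt (sqn st QT w) <= Num.sqrt (sqn st QT (fun z => w z - phi z)) +
    Num.sqrt (sqn st QT phi).
  rewrite -{1}(_ : (fun z => (w z - phi z) + phi z) = w); first exact: sqrt_sqnD.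
  by apply/funext => z; rewrite subrK.
have t2 : Num.sqrt (sqn st QT phi) <= CF * Num.sqrt (sqn st QT (fun z => enorm (cgradx phi z))).
  rewrite -[CF]gtr0_norm// -sqrtr_sqr -sqrtrM ?sqr_ge0// ler_wsqrtr//.
  by have := poincare_test T oO bO friedrichs CF0 lphi; rewrite !integral_sqn// -EFinM lee_fin.
have t3 : Num.sqrt (sqn st QT (fun z => enorm (cgradx phi z))) <=
    Num.sqrt (sqn st QT (fun z => enorm (gx w z))) + d.
  apply: (@le_trans _ _ (Num.sqrt (sqn st QT (fun z => enorm (gx w z) + enorm (gx w z - cgradx phi z))))).
    apply: ler_wsqrtr; apply: (sqn_ae_le mQ) => //; first exact: (L2D mQ).
    apply: aeW => z _; rewrite ler_sqr ?nnegrE ?addr_ge0 ?sqrtr_ge0//.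
    by rewrite enormB_sym (le_trans _ (enormD _ _))// addrC subrK.
  by apply: le_trans (sqrt_sqnD mQ eL edL) _; rewrite lerD2l.
have : CF * Num.sqrt (sqn st QT (fun z => enorm (cgradx phi z))) <=
   CF * (Num.sqrt (sqn st QT (fun z => enorm (gx w z))) + d) by rewrite ler_pM2l.
have dE : e = d + CF * d by rewrite /d; field; rewrite gt_eqF// addr_gt0.
by move=> t4; rewrite dE; exact: approx_chain t1 s1 t2 t4.
Qed.

(** For smooth functions vanishing near the lateral boundary, the identity holds
    on almost every time slice and is integrated in time. Both sides are
    continuous in the H^{1,0} norm. *)
Lemma div_by_parts (tau : X -> 'rV[R]_n) (g w : X -> R) :
  (forall i, L2 st QT (fun z => tau z 0 i)) -> is_divx Omega T tau g -> L2 st QT g ->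
  H1_x Omega T w -> zero_lateral Omega T w ->
  \int[st]_(z in QT) dotv (tau z) (gx w z) = - \int[st]_(z in QT) (g z * w z).
Proof.
move=> tL [mg hdiv] gL wH w0; have [wL _] := wH; have gwL i := gradx_L2 oO i wH.
have smoothE phi : lateral_test Omega phi -> L2 st QT phi ->
    (forall i, L2 st QT (fun z => cgradx phi z 0 i)) ->
    \int[st]_(z in QT) dotv (tau z) (cgradx phi z) = - \int[st]_(z in QT) (g z * phi z).
  move=> lphi pL gpL.
  have [_ J1 _ ->] := fubini_QT oO (dotv_integrable mQ tL gpL).
  have [_ J2 _ ->] := fubini_QT oO (L2M_integrable mQ gL pL).
  rewrite -mulN1r -(RintegralZl _ mI J2); apply: (ae_eq_Rintegral mI).
  - by have /measurable_int/measurable_EFinP := J1.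
  - by have /measurable_int/measurable_EFinP := integrableEFinZ mI (- 1) J2.
  have hdiv' : {ae leb, forall t : measurableTypeR R, I t -> L2 mu Omega (fun x => g (x, t)) /\
      is_div Omega (fun x => tau (x, t)) (fun x => g (x, t))} := hdiv.
  apply: filterS hdiv' => t ht It; have [_ dt] := ht It.
  have [tphi gE] := lateral_test_slice t lphi.
  by rewrite mulN1r -(dt _ tphi); apply: eq_Rintegral => x _; rewrite gE.
apply/eqP; rewrite -subr_eq0 opprK -normr_le0; apply/ler_addgt0Pr => e e0; rewrite add0r.
set A := Num.sqrt (sqn st QT (fun z => enorm (tau z))).
set B := Num.sqrt (sqn st QT g).
have AB : 0 < A + B + 1 by rewrite ltr_wpDl// addr_ge0// sqrtr_ge0.
set d := e / (A + B + 1); have d0 : 0 < d by rewrite divr_gt0.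
have d20 : 0 < d ^+ 2 by rewrite exprn_gt0.
have [phi [lphi [pL gpL s1 s2]]] := lateral_approx wH w0 d20.
have {}s1 := le_sqrt_lt d0 s1; have {}s2 := le_sqrt_lt d0 s2.
have dL := L2B mQ wL pL.
have gdL i : L2 st QT (fun z => (gx w z - cgradx phi z) 0 i).
  by under eq_fun do rewrite rowBE; exact: (L2B mQ).
have -> : \int[st]_(z in QT) dotv (tau z) (gx w z) + \int[st]_(z in QT) (g z * w z) =
    \int[st]_(z in QT) dotv (tau z) (gx w z - cgradx phi z) +
    \int[st]_(z in QT) (g z * (w z - phi z)).
  under [in RHS]eq_Rintegral do rewrite dotvBr.
  rewrite RintegralB//; try exact: (dotv_integrable mQ).
  under [X in _ = _ + X]eq_Rintegral do rewrite mulrBr.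
  rewrite RintegralB//; try exact: (L2M_integrable mQ).
  by rewrite (smoothE _ lphi pL gpL); ring.
rewrite (le_trans (ler_normD _ _))//.
have t1 : `|\int[st]_(z in QT) dotv (tau z) (gx w z - cgradx phi z)| <= A * d.
  by apply: le_trans (cauchy_schwarz_dotv mQ tL gdL) _; rewrite ler_wpM2l// sqrtr_ge0.
have t2 : `|\int[st]_(z in QT) (g z * (w z - phi z))| <= B * d.
  by apply: le_trans (cauchy_schwarz mQ gL dL) _; rewrite ler_wpM2l// sqrtr_ge0.
rewrite (le_trans (lerD t1 t2))// -mulrDl /d mulrCA ger_pMr// ler_pdivrMr// mul1r.
by rewrite lerDl.
Qed.

End lateral.

(** * The error estimate and the majorant *)

Section real_arithmetic.
Variable R : realType.

(** Divide by [G], the norm of the gradient of the error, unless it is 0. *)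
Lemma energy_le (nu_lo C a b ee G : R) : 0 < nu_lo -> 0 < C -> 0 <= a -> 0 <= b ->
  0 <= G -> ee <= C * G -> nu_lo * G ^+ 2 <= b * ee + a * G ->
  nu_lo * ee <= C * (a + C * b).
Proof.
move=> n0 C0 a0 b0 G0 eG h.
have hG : nu_lo * G <= a + C * b.
  move: G0; rewrite le_eqVlt => /predU1P[<-|G0].
    by rewrite mulr0 addr_ge0// mulr_ge0// ltW.
  rewrite -(ler_pM2r G0) -mulrA -expr2 (le_trans h)// mulrDl addrC lerD2l.
  by rewrite (le_trans (ler_wpM2l b0 eG))// mulrA [b * C]mulrC.
rewrite (le_trans (ler_wpM2l (ltW n0) eG))// mulrCA ler_wpM2l// ltW//.
Qed.

Lemma young_sq (a p q : R) : 0 < a ->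
  (p + q) ^+ 2 <= (1 + a) * p ^+ 2 + (1 + a) / a * q ^+ 2.
Proof.
move=> a0; rewrite -subr_ge0.
have -> : (1 + a) * p ^+ 2 + (1 + a) / a * q ^+ 2 - (p + q) ^+ 2 =
    a^-1 * (a * p - q) ^+ 2 by field; rewrite gt_eqF.
by rewrite mulr_ge0 ?sqr_ge0// invr_ge0 ltW.
Qed.

(** Young's inequality, with parameter [al] for the distance to the desired state
    and with parameter [be] between both residuals. *)
Lemma majorant_le (al be C m nu_lo p a b ee z : R) : 0 < al -> 0 < be -> 0 < C ->
  0 < m -> m <= nu_lo -> 0 <= p -> 0 <= a -> 0 <= b -> 0 <= ee -> 0 <= z ->
  nu_lo * ee <= C * (a + C * b) -> z <= p + ee ->
  2^-1 * z ^+ 2 <= (1 + al) / 2 * p ^+ 2 +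
    (1 + al) * (1 + be) * C ^+ 2 / (2 * al * m ^+ 2) * a ^+ 2 +
    (1 + al) * (1 + be) * C ^+ 4 / (2 * al * be * m ^+ 2) * b ^+ 2.
Proof.
move=> al0 be0 C0 m0 mn p0 a0 b0 e0 z0 he hz.
have e2 : ee ^+ 2 <= C ^+ 2 / m ^+ 2 * (a + C * b) ^+ 2.
  rewrite -exprVn -!exprMn ler_sqr ?nnegrE//; last first.
    by rewrite !mulr_ge0 ?invr_ge0 ?addr_ge0 ?mulr_ge0// ltW.
  rewrite mulrAC ler_pdivlMr//.
  by rewrite (le_trans _ he)// mulrC ler_wpM2r.
have z2 : z ^+ 2 <= (p + ee) ^+ 2 by rewrite ler_sqr ?nnegrE ?addr_ge0.
have y1 := young_sq p ee al0; have y2 := young_sq a (C * b) be0.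
have k1 : 0 <= (1 + al) / al by rewrite divr_ge0 ?addr_ge0// ltW.
have k2 : 0 <= C ^+ 2 / m ^+ 2 by rewrite divr_ge0 ?sqr_ge0.
have h1 := ler_wpM2l k1 (le_trans e2 (ler_wpM2l k2 y2)).
have -> : (1 + al) / 2 * p ^+ 2 +
    (1 + al) * (1 + be) * C ^+ 2 / (2 * al * m ^+ 2) * a ^+ 2 +
    (1 + al) * (1 + be) * C ^+ 4 / (2 * al * be * m ^+ 2) * b ^+ 2 =
  2^-1 * ((1 + al) * p ^+ 2 + (1 + al) / al * (C ^+ 2 / m ^+ 2 *
     ((1 + be) * a ^+ 2 + (1 + be) / be * (C * b) ^+ 2))).
  by field; rewrite !gt_eqF.
rewrite ler_wpM2l ?invr_ge0// (le_trans z2)// (le_trans y1)// lerD2l.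
exact: h1.
Qed.

Lemma coef_gt0 (al be C d m : R) (k : nat) : 0 < al -> 0 < be -> 0 < C -> 0 < d -> 0 < m ->
  0 < (1 + al) * (1 + be) * C ^+ k / (d * m ^+ 2).
Proof.
move=> *; apply: divr_gt0; last by rewrite mulr_gt0// exprn_gt0.
by apply: mulr_gt0; [rewrite mulr_gt0 ?addr_gt0|exact: exprn_gt0].
Qed.

Lemma energy_algebra (a1 a2 a3 a4 a5 : R) :
  a1 - a2 = - a3 - a2 - (a4 - a3 - (a1 + a4)).
Proof. ring. Qed.

Lemma mu1_gt0 (a b : R) : 0 < a -> 0 < b -> 0 < mu1 a b.
Proof. by move=> a0 b0; rewrite /mu1 mulr_gt0 ?invr_gt0 ?sqrtr_gt0// lt_min a0. Qed.

Lemma mu1_le (a b : R) : 0 < a -> 0 < b -> mu1 a b <= a.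
Proof.
move=> a0 b0; rewrite /mu1 ler_pdivrMl ?sqrtr_gt0//.
rewrite (@le_trans _ _ a) ?ge_min ?lexx// ler_peMl ?(ltW a0)//.
by rewrite -[leLHS]sqrtr1 ler_wsqrtr// ler1n.
Qed.

End real_arithmetic.

Section error_estimate.
Variables (R : realType) (n : nat) (Omega : set 'rV[R]_n) (T : R).
Local Notation X := ('rV[R]_n * measurableTypeR R)%type.
Local Notation mu := (lebesgue_rV R n).
Local Notation st := (lebesgue_st R n).
Local Notation QT := (QT Omega T).
Local Notation gx := (gradx Omega T).
Hypotheses (oO : open Omega) (bO : bounded_set Omega) (T0 : 0 < T).
Let mO := measurable_Omega oO.
Let mQ := measurable_QT T oO.
Variables (sigma nu : 'rV[R]_n -> R) (sigma_lo sigma_hi nu_lo nu_hi CF : R).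
Hypotheses (msigma : measurable_fun Omega sigma) (mnu : measurable_fun Omega nu).
Hypotheses (hsigma_lo : 0 < sigma_lo) (hnu_lo : 0 < nu_lo) (CF0 : 0 < CF).
Hypothesis hsigma : {ae mu, forall x, Omega x -> sigma_lo <= sigma x <= sigma_hi}.
Hypothesis hnu : {ae mu, forall x, Omega x -> nu_lo <= nu x <= nu_hi}.
Hypothesis friedrichs : forall w, H10 Omega w ->
  (L2norm mu Omega w <= CF%:E * L2vnorm mu Omega (grad Omega w))%E.
Variables (v y eta : X -> R) (tau : X -> 'rV[R]_n).
Hypotheses (vL : L2 st QT v) (ysol : weak_solution Omega T sigma nu v y).
Hypothesis etaH : H11_0per Omega T eta.
Let e z := y z - eta z.
Let g := dt Omega T eta.

Lemma H11_half : H1half_0per Omega T eta.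
Proof.
have [eH /dtP[gL dtg] e0 ep] := etaH; split=> //.
by apply/(half_seriesP oO bO T0 eH.1); exact: (half_norm_dt oO bO T0 eH.1 gL dtg ep).
Qed.

Lemma error_half : H1half_0per Omega T e.
Proof.
have [[yH /(half_seriesP oO bO T0 yH.1)[M hM] y0] _] := ysol.
have [eH /(half_seriesP oO bO T0 eH.1)[M' hM'] e0] := H11_half.
have [dH _] := gradxB oO bO yH eH.
split; [exact: dH| |exact: zero_lateralB].
apply/(half_seriesP oO bO T0 dH.1); exists (2 * (M + M')) => N.
by rewrite (le_trans (half_normB oO bO T0 N yH.1 eH.1))// ler_wpM2l// lerD.
Qed.

Lemma abs_sigma : {ae mu, forall x, Omega x -> `|sigma x| <= sigma_hi}.
Proof.
apply: filterS hsigma => x h /h/andP[a b].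
by rewrite ger0_norm// (le_trans _ a)// ltW.
Qed.

Lemma abs_nu : {ae mu, forall x, Omega x -> `|nu x| <= nu_hi}.
Proof.
apply: filterS hnu => x h /h/andP[a b].
by rewrite ger0_norm// (le_trans _ a)// ltW.
Qed.

Lemma sigma_dt_L2 : L2 st QT (fun z => sigma z.1 * g z).
Proof.
have [eH /dtP[gL dtg] _ _] := etaH.
apply: (L2_ae_bM mQ (C := sigma_hi)) => //; first exact: measurable_fst_QT.
exact: ae_st_fst abs_sigma.
Qed.

Lemma nu_grad_L2 (w : X -> R) i : H1_x Omega T w ->
  L2 st QT (fun z => (nu z.1 *: gx w z) 0 i).
Proof.
move=> wH; under eq_fun do rewrite mxE.
apply: (L2_ae_bM mQ (C := nu_hi)); first exact: measurable_fst_QT.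
  exact: ae_st_fst abs_nu.
exact: gradx_L2.
Qed.

(** The unknown time derivative of [y] disappears: in the pairing of order one
    half, [eta] alone contributes when the error is the test function, and
    [energy_cvg] identifies the limit. *)
Lemma weak_error : \int[st]_(z in QT) (nu z.1 * dotv (gx y z) (gx e z)) +
  \int[st]_(z in QT) (sigma z.1 * g z * e z) = \int[st]_(z in QT) (v z * e z).
Proof.
have [[yH _ _] weak] := ysol; have [eH /dtP[gL dtg] _ ep] := etaH.
have eL := L2B mQ yH.1 eH.1.
have := weak _ error_half; set A := \int[st]_(z in QT) (nu _ * _) => h.
pose S N := T / 2 * (\sum_(1 <= k < N.+1) k%:R * omega T * fourier_perp Omega T sigma y e k).
have SE : S = (fun N => \int[mu]_(x in Omega) (sigma x *
    fenergy T N (fun t => g (x, t)) (fun t => e (x, t)))).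
  apply/funext => N.
  exact: (fourier_perp_energy oO bO T0 eH.1 gL dtg ep msigma abs_sigma N yH.1).
have h' : A + S N @[N --> \oo] --> A + \int[st]_(z in QT) (sigma z.1 * g z * e z).
  rewrite SE; apply: cvgD; first exact: cvg_cst.
  exact: (energy_cvg oO bO T0 gL msigma abs_sigma eL).
exact: (cvg_unique _ h' h).
Qed.

Hypothesis tauL : forall i, L2 st QT (fun z => tau z 0 i).
Hypothesis tdiv : is_divx Omega T tau (divx Omega T tau).
Let r z := sigma z.1 * g z - divx Omega T tau z - v z.
Hypothesis rL : L2 st QT r.

Lemma flux_L2 i : L2 st QT (fun z => (tau z - nu z.1 *: gx eta z) 0 i).
Proof.
have [eH _ _ _] := etaH; under eq_fun do rewrite rowBE.
by apply: (L2B mQ); [exact: tauL|exact: nu_grad_L2].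
Qed.

(** Move the contribution of [eta] to the right-hand side, then insert [tau] by
    means of [div_by_parts]. *)
Lemma error_energy :
  \int[st]_(z in QT) (nu z.1 * dotv (gx e z) (gx e z)) =
  \int[st]_(z in QT) dotv (tau z - nu z.1 *: gx eta z) (gx e z) -
  \int[st]_(z in QT) (r z * e z).
Proof.
have [[yH _ _] _] := ysol; have [eH /dtP[gL dtg] _ ep] := etaH.
have [dH _ d0] := error_half; have [_ dg] := gradxB oO bO yH eH.
have eL := L2B mQ yH.1 eH.1.
have divL : L2 st QT (divx Omega T tau).
  have := L2B mQ (L2B mQ sigma_dt_L2 vL) rL; congr L2; apply/funext => z.
  by rewrite /r; ring.
have dL i := gradx_L2 oO i dH.
have nyL i := nu_grad_L2 i yH; have neL i := nu_grad_L2 i eH.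
have ndL i := nu_grad_L2 i dH.
have E1 : \int[st]_(z in QT) (nu z.1 * dotv (gx e z) (gx e z)) =
    \int[st]_(z in QT) (nu z.1 * dotv (gx y z) (gx e z)) -
    \int[st]_(z in QT) dotv (nu z.1 *: gx eta z) (gx e z).
  under [X in _ = X - _]eq_Rintegral do rewrite -dotvZl.
  have i1 := dotv_integrable mQ nyL dL; have i2 := dotv_integrable mQ neL dL.
  rewrite -(RintegralB mQ i1 i2); apply: (ae_eq_Rintegral mQ).
  - under eq_fun do rewrite -dotvZl.
    by have /measurable_int/measurable_EFinP := dotv_integrable mQ ndL dL.
  - by have /measurable_int/measurable_EFinP := integrableEFinB mQ i1 i2.
  by apply: filterS dg => z gz Qz; rewrite {1}/e gz// !dotvZl dotvBl mulrBr.
have E2 : \int[st]_(z in QT) dotv (tau z - nu z.1 *: gx eta z) (gx e z) =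
    \int[st]_(z in QT) dotv (tau z) (gx e z) -
    \int[st]_(z in QT) dotv (nu z.1 *: gx eta z) (gx e z).
  under eq_Rintegral do rewrite dotvBl.
  exact: (RintegralB mQ (dotv_integrable mQ tauL dL) (dotv_integrable mQ neL dL)).
have E3 : \int[st]_(z in QT) (r z * e z) =
    \int[st]_(z in QT) (sigma z.1 * g z * e z) -
    \int[st]_(z in QT) (divx Omega T tau z * e z) - \int[st]_(z in QT) (v z * e z).
  have i1 := L2M_integrable mQ sigma_dt_L2 eL; have i2 := L2M_integrable mQ divL eL.
  have i3 := L2M_integrable mQ vL eL.
  rewrite -(RintegralB mQ i1 i2) -(RintegralB mQ (integrableEFinB mQ i1 i2) i3).
  by apply: eq_Rintegral => z _; rewrite /r !mulrBl.
have E4 := div_by_parts oO tauL tdiv divL dH d0.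
rewrite E1 E2 E3 E4 -weak_error.
set A1 := \int[st]_(z in QT) (nu z.1 * _); set A2 := \int[st]_(z in QT) dotv _ _.
set A3 := \int[st]_(z in QT) (divx _ _ _ _ * _); set A4 := \int[st]_(z in QT) (sigma z.1 * _ * _).
exact: energy_algebra.
Qed.

(** Cauchy-Schwarz for both residuals, Friedrichs' inequality for the error and
    the lower bound of [nu] for the energy. *)
Lemma error_estimate :
  nu_lo * Num.sqrt (sqn st QT e) <=
  CF * (Num.sqrt (sqn st QT (fun z => enorm (tau z - nu z.1 *: gx eta z))) +
        CF * Num.sqrt (sqn st QT r)).
Proof.
have [[yH _ _] _] := ysol; have [eH _ _ _] := etaH.
have [dH _ d0] := error_half; have dL i := gradx_L2 oO i dH.
have eL := L2B mQ yH.1 eH.1; have ndL i := nu_grad_L2 i dH.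
apply: (energy_le hnu_lo CF0 _ _ _ (poincare oO bO friedrichs CF0 dH d0)); try exact: sqrtr_ge0.
rewrite sqr_sqrtr ?sqn_ge0//.
have gi := enorm2_integrable mQ dL.
apply: (@le_trans _ _ (\int[st]_(z in QT) (nu z.1 * dotv (gx e z) (gx e z)))).
  rewrite /sqn -(RintegralZl _ mQ gi); apply: (ae_le_Rintegral mQ).
  - exact: (integrableEFinZ mQ).
  - under eq_fun do rewrite -dotvZl; exact: (dotv_integrable mQ).
  apply: filterS (ae_st_fst T hnu) => z h Qz.
  rewrite enorm_sq ler_wpM2r ?dotvv_ge0//.
  by have /andP[] := h Qz.
rewrite error_energy addrC lerD//.
  by apply: le_trans (ler_norm _) _; rewrite normrN; exact: cauchy_schwarz.
exact: (le_trans (ler_norm _) (cauchy_schwarz_dotv mQ flux_L2 dL)).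
Qed.

End error_estimate.

Theorem corollary2 (R : realType) (d : nat) (hd : (1 <= d <= 3)%N)
  (Omega : set 'rV[R]_d) (hOb : bounded_set Omega) (hOl : lipschitz_domain Omega)
  (T : R) (hT : 0 < T)
  (sigma nu : 'rV[R]_d -> R) (sigma_lo sigma_hi nu_lo nu_hi : R)
  (msigma : measurable_fun Omega sigma) (mnu : measurable_fun Omega nu)
  (hsigma_lo : 0 < sigma_lo) (hnu_lo : 0 < nu_lo)
  (hsigma : {ae lebesgue_rV R d,
     forall x, Omega x -> sigma_lo <= sigma x <= sigma_hi})
  (hnu : {ae lebesgue_rV R d, forall x, Omega x -> nu_lo <= nu x <= nu_hi})
  (CF : R) (hCF : 0 < CF)
  (friedrichs : forall w, H10 Omega w ->
     (L2norm (lebesgue_rV R d) Omega w <=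
      CF%:E * L2vnorm (lebesgue_rV R d) Omega (grad Omega w))%E)
  (lam : R) (hlam : 0 < lam)
  (yd : 'rV[R]_d * measurableTypeR R -> R)
  (hyd : L2 (lebesgue_st R d) (QT Omega T) yd)
  (y : ('rV[R]_d * measurableTypeR R -> R) -> 'rV[R]_d * measurableTypeR R -> R)
  (hy : forall v, L2 (lebesgue_st R d) (QT Omega T) v ->
     weak_solution Omega T sigma nu v (y v))
  (u : 'rV[R]_d * measurableTypeR R -> R)
  (hu : optimal_control Omega T lam yd y u) :
  forall (eta : 'rV[R]_d * measurableTypeR R -> R)
    (tau : 'rV[R]_d * measurableTypeR R -> 'rV[R]_d)
    (v : 'rV[R]_d * measurableTypeR R -> R) (alpha beta : R),
    H11_0per Omega T eta -> Hdiv Omega T tau ->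
    L2 (lebesgue_st R d) (QT Omega T) v -> 0 < alpha -> 0 < beta ->
    (cost Omega T lam yd (y u) u <=
     majorant Omega T sigma nu nu_lo sigma_lo CF lam yd alpha beta eta tau v)%E.
Proof.
move=> eta tau v al be etaH tauH vL al0 be0.
have [oO _ _ _] := hOl.
apply: (le_trans (hu.2 v vL)); have ysol := hy v vL; have [[yH _ _] _] := ysol.
have mQ := measurable_QT T oO.
have [eH dtH _ _] := etaH; have [/(L2vP _ mQ) tauL /divxP tdiv] := tauH.
have m0 := mu1_gt0 hnu_lo hsigma_lo; have mle := mu1_le hnu_lo hsigma_lo.
have pL := L2B mQ eH.1 hyd; have zL := L2B mQ yH.1 hyd; have eL := L2B mQ yH.1 eH.1.
have sgL := sigma_dt_L2 oO msigma hsigma_lo hsigma etaH.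
have fluxL := L2_enorm mQ (flux_L2 oO mnu hnu_lo hnu etaH tauL).
pose r z := sigma z.1 * dt Omega T eta z - divx Omega T tau z - v z.
have mr : measurable_fun (QT Omega T) r.
  apply: measurable_funB; last exact: L2_measurable vL.
  by apply: measurable_funB; [exact: L2_measurable sgL|exact: tdiv.1].
have c2 : 0 <= (1 + al) * (1 + be) * CF ^+ 2 / (2 * al * mu1 nu_lo sigma_lo ^+ 2).
  by apply/ltW/coef_gt0 => //; exact: mulr_gt0.
have c3 : 0 < (1 + al) * (1 + be) * CF ^+ 4 / (2 * al * be * mu1 nu_lo sigma_lo ^+ 2).
  by apply: coef_gt0 => //; rewrite !mulr_gt0.
rewrite /cost /majorant -/r; apply: leeD => //.
(* An infinite residual makes the majorant infinite. *)
have [rfin|] := boolP (L2norm (lebesgue_st R d) (QT Omega T) r < +oo)%E; last first.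
  have oo2 : ((+oo : \bar R) ^+ 2 = +oo)%E by rewrite expe2 mulyy.
  rewrite -leNgt leye_eq => /eqP ->; rewrite oo2 gt0_muley ?lte_fin// addey ?leey//.
  by rewrite !L2norm_sqn// [X in (_ + _ * X)%E](L2norm_sqn mQ fluxL).
have rL : L2 (lebesgue_st R d) (QT Omega T) r by [].
have est := error_estimate oO hOb hT msigma mnu hsigma_lo hnu_lo hCF hsigma hnu
  friedrichs vL ysol etaH tauL tdiv rL.
rewrite (L2norm_sqn mQ zL) (L2norm_sqn mQ pL) (L2norm_sqn mQ rL) [X in (_ <= _ + _ * X + _)%E](L2norm_sqn mQ fluxL).
rewrite -!EFinM -!EFinD lee_fin.
set z2 := sqn _ _ _; set p2 := sqn _ _ _; set f2 := sqn _ _ _; set r2 := sqn _ _ _.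
rewrite -(sqr_sqrtr (sqn_ge0 _ _ _ : 0 <= z2)) -(sqr_sqrtr (sqn_ge0 _ _ _ : 0 <= p2)).
rewrite -(sqr_sqrtr (sqn_ge0 _ _ _ : 0 <= f2)) -(sqr_sqrtr (sqn_ge0 _ _ _ : 0 <= r2)).
apply: (majorant_le al0 be0 hCF m0 mle _ _ _ _ _ est); try exact: sqrtr_ge0.
apply: le_trans (sqrt_sqnD mQ pL eL); rewrite le_eqVlt; apply/orP; left; apply/eqP.
by congr (Num.sqrt (sqn _ _ _)); apply/funext => x; rewrite [RHS]addrC subrKA.
Qed.
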